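(* Consider the single-sender (monopoly) game ($n=1$) described in the context, with $0<c<\bar v(\tilde\omega_1)$. In any equilibrium, the expected payoffs are $\bar v(\tilde\omega_1)/c$ for the sender and $U(\mu^0)$ for the receiver. Moreover, there is an equilibrium in which, in each round (until $\omega_1$ is revealed), the sender makes an All-or-Nothing offer with revelation probability $$\lambda^{\mathrm M}=\frac{c}{\bar v(\tilde\omega_1)},$$ and the receiver accepts (consults the sender) every round until $\omega_1$ is revealed.
   Context: **State and decision problem.** There is one sender and one receiver. The state $\omega_1$ lies in a Polish space $\Omega_1$, is constant over time, and is drawn from a common prior $\mu^0\in\Delta(\Omega_1)$. The sender's component $\omega_1$ contains all payoff-relevant information. The receiver has a closed action space $A$ and utility $u:A\times\Omega_1\to\mathbb R$, continuous and bounded; optimal actions are assumed to exist, so the maxima below are attained. **Game.** Rounds $t=0,1,2,\dots$. Nobody observes $\omega_1$ directly. At the beginning of each round, if the receiver has not yet stopped, the sender offers an experiment $\lambda_t$, i.e. a Markov kernel from $\Omega_1$ to a Polish message space $M\supset\Omega_1$ (where $M\setminus\Omega_1\neq\emptyset$). The sender cannot commit to offers in future rounds. The receiver observes the offer and either (i) stops ($d_t=0$), takes an action $a\in A$, and the game ends; or (ii) consults the sender ($d_t=1$), pays the attention cost $c>0$, observes a message $m_t\sim\lambda_t(\omega_1,\cdot)$, and the game moves to the next round. The receiver cannot wait without either stopping or consulting. All past offers, choices and messages are publicly observed; strategies map histories (and, for the receiver, also the current offer) into choices. **Payoffs.** The receiver gets $u(a,\omega_1)-c\sum_{t\ge0}\mathbf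 1\{d_t\ne0\}$; the sender gets $\sum_{t\ge0}\mathbf 1\{d_t=1\}$, the number of rounds in which she is consulted. **Equilibrium.** Perfect Bayesian equilibrium, with the requirement that the (common) belief $\mu^t$ about the state is updated only by Bayes' rule from the message of the consulted experiment (on and off path); offers themselves convey no information. **Values.** For a belief $\mu$, let $U(\mu)=\max_{a\in A}\mathbb E_{\omega_1\sim\mu}[u(a,\omega_1)]$ and $\bar U(\mu)=\mathbb E_{\omega_1\sim\mu}[\max_{a\in A}u(a,\omega_1)]$. The value of learning $\omega_1$ exactly, starting from the prior, is $\bar v(\tilde\omega_1)=\bar U(\mu^0)-U(\mu^0)$. **All-or-Nothing (AoN) offer.** An AoN offer with revelation probability $\lambda\in[0,1]$ is the experiment $\lambda\,\delta_{\omega_1}+(1-\lambda)\,\delta_{m}$ for some fixed message $m\in M\setminus\Omega_1$: it reveals $\omega_1$ with probability $\lambda$ and conveys no information otherwise. *)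

(* Defs.v *)
From HB Require Import structures.
From mathcomp Require Import all_boot all_order all_algebra.
From mathcomp Require Import all_classical all_reals all_analysis.
From mathcomp Require Import measurable_realfun.
Import Order.TTheory GRing.Theory Num.Theory.
Import numFieldNormedType.Exports.

Set Implicit Arguments.
Unset Strict Implicit.
Unset Printing Implicit Defensive.

Local Open Scope classical_set_scope.
Local Open Scope ring_scope.

Notation borel T := (g_sigma_algebraType (@open T)).

(* A complete uniformity given by balls indexed by R has a countable base, so
   together with the two properties below it is a Polish topology; conversely
   a Polish space is obtained in this way from any complete metric. *)
Definition polish {R : realType} (T : completePseudoMetricType R) : Prop :=
  hausdorff_space T /\ exists2 D : set T, countable D & dense D.

Definition topological_embedding {S T : topologicalType} (f : S -> T) : Prop :=
  injective f /\ @open S = [set f @^-1` V | V in @open T].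

(* Omega is the state space, M the message space, X a space containing the
   action set A. *)
Section Game.
Context {R : realType} {Omega M X : completePseudoMetricType R}.

Definition experiment : Type := R.-pker (borel Omega) ~> (borel M).

(* A history at which the game is still running: the offers made so far with
   the messages received, oldest first.  All these offers were accepted, since
   the game ends as soon as the receiver stops. *)
Definition history : Type := seq (experiment * M).

Definition sender_strategy : Type := history -> experiment.

(* [Some a]: stop and take the action a; [None]: consult the sender. *)
Definition receiver_strategy : Type := history -> experiment -> option X.

(* The common belief about the state; it does not depend on the current
   offer. *)
Definition belief_system : Type := history -> probability (borel Omega) R.

Section Play.
Variables (sigma : sender_strategy) (rho : receiver_strategy).

(* The functions below describe the game from the point where e is on offer
   after the history h. *)

Fixpoint play (h : history) (e : experiment) (ms : seq M) :
    history * experiment :=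
  if ms is m :: ms' then
    let h' := rcons h (e, m) in play h' (sigma h') ms'
  else (h, e).

Definition response (h : history) (e : experiment) (ms : seq M) : option X :=
  rho (play h e ms).1 (play h e ms).2.

(* The receiver consults in all the rounds in which ms is received. *)
Fixpoint reached (h : history) (e : experiment) (ms : seq M) : Prop :=
  if ms is m :: ms' then
    let h' := rcons h (e, m) in rho h e = None /\ reached h' (sigma h') ms'
  else True.

Definition consulted (h : history) (e : experiment) (n : nat) :
    set (n.-tuple (borel M)) :=
  [set ms | reached h e ms /\ response h e ms = None].

(* Choices depend measurably on the messages received from (h, e) on, so that
   expected payoffs from (h, e) on are meaningful.  No condition is put on
   choices at histories which are not reached from (h, e). *)
Definition measurable_play (h : history) (e : experiment) : Prop :=
  forall n : nat,
  [/\ measurable (@consulted h e n),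
      forall D : set (borel X), measurable D ->
        measurable [set ms : n.-tuple (borel M) |
          reached h e ms /\ exists2 a, D a & response h e ms = Some a]
    & forall C : set (borel M), measurable C ->
        measurable_fun (@consulted h e n `*` [set: borel Omega])
          (fun z : n.-tuple (borel M) * borel Omega =>
             (play h e z.1).2 z.2 C)].

(* The expectation, given the state w, of the value of F after n more
   consultations, counted as 0 if the receiver stops earlier. *)
Fixpoint stage_value (F : history -> experiment -> Omega -> \bar R) (n : nat)
    (h : history) (e : experiment) (w : Omega) : \bar R :=
  if n is n'.+1 then
    if rho h e is None then
      (\int[e w]_m (let h' := rcons h (e, m) in
                    stage_value F n' h' (sigma h') w))%E
    else 0%E
  else F h e w.

(* Expected number of consultations from (h, e) on, under the belief mu. *)
Definition sender_payoff (mu : probability (borel Omega) R)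
    (h : history) (e : experiment) : \bar R :=
  (\sum_(n <oo) \int[mu]_w
     stage_value (fun h' e' _ => if rho h' e' is None then 1 else 0) n h e w)%E.

(* Expected utility net of the attention costs from (h, e) on; the utility part
   is 0 on the event that the receiver never stops, in which case the costs are
   infinite. *)
Definition receiver_payoff (u : X -> Omega -> R) (c : R)
    (mu : probability (borel Omega) R) (h : history) (e : experiment) : \bar R :=
  ((\sum_(n <oo) \int[mu]_w
      stage_value
        (fun h' e' w' => if rho h' e' is Some a then (u a w')%:E else 0) n h e w)
   - c%:E * sender_payoff mu h e)%E.

End Play.

(* Bayes' rule on and off path: given (h, e), the next belief is, as a function
   of the message, a regular conditional distribution of the state given the
   message under the joint law (b h)(dw) e(w, dm). *)
Definition bayes_consistent (mu0 : probability (borel Omega) R)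
    (b : belief_system) : Prop :=
  b [::] = mu0 /\
  forall (h : history) (e : experiment),
    (forall B : set (borel Omega), measurable B ->
       measurable_fun setT (fun m : borel M => b (rcons h (e, m)) B)) /\
    (forall (B : set (borel Omega)) (C : set (borel M)),
       measurable B -> measurable C ->
       (\int[b h]_(w in B) e w C =
        \int[b h]_w \int[e w]_(m in C) b (rcons h (e, m)) B)%E).

Definition feasible (A : set X) (rho : receiver_strategy) : Prop :=
  forall h e a, rho h e = Some a -> A a.

Record equilibrium (A : set X) (u : X -> Omega -> R) (c : R)
    (mu0 : probability (borel Omega) R)
    (sigma : sender_strategy) (rho : receiver_strategy) (b : belief_system) :
    Prop := Equilibrium {
  eq_feasible : feasible A rho ;
  eq_measurable : forall h e, measurable_play sigma rho h e ;
  eq_bayes : bayes_consistent mu0 b ;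
  eq_sender : forall h (sigma' : sender_strategy),
    measurable_play sigma' rho h (sigma' h) ->
    (sender_payoff sigma' rho (b h) h (sigma' h)
       <= sender_payoff sigma rho (b h) h (sigma h))%E ;
  eq_receiver : forall h e (rho' : receiver_strategy),
    feasible A rho' -> measurable_play sigma rho' h e ->
    (receiver_payoff sigma rho' u c (b h) h e
       <= receiver_payoff sigma rho u c (b h) h e)%E
}.

Definition attains_max {T : Type} (A : set T) (f : T -> R) : Prop :=
  exists2 a, A a & forall a', A a' -> f a' <= f a.

(* In the next two definitions [sup] is a maximum as soon as optimal actions
   exist. *)
Definition value (A : set X) (u : X -> Omega -> R)
    (mu : probability (borel Omega) R) : R :=
  sup [set \int[mu]_w u a w | a in A].

Definition full_info_value (A : set X) (u : X -> Omega -> R)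
    (mu : probability (borel Omega) R) : R :=
  \int[mu]_w sup [set u a w | a in A].

Definition learning_value (A : set X) (u : X -> Omega -> R)
    (mu : probability (borel Omega) R) : R :=
  full_info_value A u mu - value A u mu.

(* iota is the inclusion of Omega into M. *)
Definition all_or_nothing (iota : Omega -> M) (m : M) (lambda : R)
    (e : experiment) : Prop :=
  [/\ 0 <= lambda <= 1, ~ range iota m &
      forall (w : Omega) (C : set (borel M)), measurable C ->
        (e w C = lambda%:E * dirac (iota w : borel M) C
                 + (1 - lambda)%:E * dirac (m : borel M) C)%E].

(* The history of n rounds in which the offers of sigma were consulted and
   returned the message m each time. *)
Fixpoint constant_history (sigma : sender_strategy) (m : M) (n : nat) :
    history :=
  if n is n'.+1 then
    let h := constant_history sigma m n' in rcons h (sigma h, m)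
  else [::].

End Game.

(* Main.v *)
Require Import Defs.
From HB Require Import structures.
From mathcomp Require Import all_boot all_order all_algebra.
From mathcomp Require Import all_classical all_reals all_analysis.
From mathcomp Require Import measurable_realfun.
From mathcomp Require Import ring lra.
Import Order.TTheory GRing.Theory Num.Theory.
Import numFieldNormedType.Exports.

(* Write v for the value of learning the state and S for the expected number of
   consultations.  The full-information value is a martingale along play, so a
   receiver who gets at least the value of stopping at once pays c S <= v.
   Conversely the receiver must accept an all-or-nothing offer of probability
   l > c / v; if it reveals nothing, the belief is unchanged, so that deviating
   to it gives S >= 1 + (1 - l) S, and S >= 1 / l for all such l.  Hence
   S = v / c, which leaves the receiver the value of stopping.

   In the equilibrium, the sender offers l = c / v at each belief with v >= c,
   which makes stopping and consulting equally good.  The difficulty is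
   measurability: a regular conditional probability and an exactly optimal
   measurable action are available only almost surely.  Beliefs are therefore
   updated along the history together with an optimal action, and are kept
   concentrated on a fixed set where optimal actions depend measurably on the
   state. *)

Set Implicit Arguments.
Unset Strict Implicit.
Unset Printing Implicit Defensive.

Local Open Scope classical_set_scope.
Local Open Scope ring_scope.

(** * Polish spaces *)

(** Payoffs are handled through truncations to N rounds. The sums [partial] obey one-round
    recursions, are compared by induction on N, and have monotone limits because utilities are
    shifted by their bound K to be nonnegative. The truncation error is governed by [running], the
    probability of at least N consultations, which vanishes once the expected number of
    consultations is finite; an infinite number costs the receiver -oo and is never a best reply.

    Optimality of the receiver has to be checked after every offer, also offers that the sender
    never makes. As later offers are worth no more than stopping, the value there is the better of
    stopping and consulting once, so a one-round lookahead is a best reply and no fixed point has to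
    be constructed.

    The posterior after an arbitrary offer is an uncontrolled choice, but it enters measurability
    only once: after the first message, null messages leave the belief and action unchanged and any
    other message ends the consultations. *)

Section PolishTools.
Context {R : realType}.

Lemma inv_natS_gt0 (k : nat) : 0 < k.+1%:R^-1 :> R.
Proof. by rewrite invr_gt0 ltr0Sn. Qed.

Lemma inv_natS_lt (e : R) : 0 < e -> exists k : nat, k.+1%:R^-1 < e.
Proof.
move=> e0; have [k _ /(_ k (leqnn k)) h] := near_infty_natSinv_lt (PosNum e0).
by exists k.
Qed.

Lemma measurable_cst_set d (T : measurableType d) (P : Prop) :
  measurable [set _ : T | P].
Proof.
have [p|p] := pselect P; first by rewrite (_ : [set _ | _] = setT)//; apply/seteqP; split.
by rewrite (_ : [set _ | _] = set0)//; apply/seteqP; split.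
Qed.

Lemma measurable_fun_piecewise d d' (T : measurableType d) (U : measurableType d')
    (D : set T) (f g : T -> U) :
  measurable D -> measurable_fun setT f -> measurable_fun setT g ->
  measurable_fun setT (fun t => if `[< D t >] then f t else g t).
Proof.
move=> mD mf mg; apply: measurable_fun_ifT => //.
apply: (measurable_fun_bool true); rewrite setTI (_ : _ @^-1` _ = D)//.
by apply/seteqP; split => t /= /asboolP.
Qed.

Lemma hausdorff_ball (X : completePseudoMetricType R) (x y : X) :
  hausdorff_space X -> (forall e : R, 0 < e -> ball x e y) -> x = y.
Proof.
move=> hX xy; apply: hX => A B /nbhs_ballP[e /= e0 eA] /nbhs_singleton By.
by exists y; split => //; apply: eA; exact: xy.
Qed.

(** Separability passes to subsets: for each point of a countable dense set and each radius 1/(k+1),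
    pick a point of A in that ball if there is one. *)
Lemma dense_sequence (X : completePseudoMetricType R) (A : set X) :
  polish X -> A !=set0 ->
  exists d : nat -> X, (forall n, A (d n)) /\
    forall a (e : R), A a -> 0 < e -> exists n, ball (d n) e a.
Proof.
move=> [_ [D cD dD]] [a0 Aa0].
have [f Df] : exists f : nat -> X, D `<=` range f.
  have /pfcard_geP[->|[f]] := cD; first by exists (fun=> a0).
  exists f => x Dx; have [n _ <-] := 'surj_f Dx; by exists n.
pose d (p : nat * nat) := xget a0 [set x | ball (f p.1) p.2.+1%:R^-1 x /\ A x].
have Ad p : A (d p) by rewrite /d; case: xgetP => // x _ [].
exists (fun n => odflt a0 (omap d (unpickle n))); split.
  by move=> n; case: unpickle => //= p; exact: Ad.
move=> a e Aa e0.
have [k ke] := inv_natS_lt (divr_gt0 e0 (ltr0Sn R 1)).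
have : interior (ball a k.+1%:R^-1) !=set0.
  by exists a; apply: nbhsx_ballx; exact: inv_natS_gt0.
move=> /(dD _)/(_ (open_interior _))[y [/interior_subset ya Dy]].
have [n _ fny] := Df y Dy.
exists (pickle (n, k)); rewrite pickleK /= /d.
case: xgetP => [x _ /= [nx _]|/(_ a)]; last first.
  by case=> /=; rewrite fny; split => //; exact: ball_sym.
apply: (@le_ball _ _ _ (k.+1%:R^-1 + k.+1%:R^-1)).
  by rewrite [e]splitr lerD// ltW.
apply: (ball_triangle (ball_sym nx)); rewrite /= fny; exact: ball_sym.
Qed.

Lemma measurable_fun_borel d (T : measurableType d) (Y : completePseudoMetricType R)
    (f : T -> Y) :
  (forall O : set Y, open O -> measurable (f @^-1` O)) ->
  measurable_fun [set: T] (f : T -> borel Y).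
Proof.
move=> h; refine (@measurability _ _ T (borel Y) setT f (@open Y) (erefl _) _).
by move=> _ [V oV <-]; rewrite setTI; exact: h.
Qed.

(** Take the least j with [E j t]. The default index 0 where there is none adds the complement of
    the union to the level set of 0. *)
Lemma measurable_first d (T : measurableType d) (E : nat -> set T) :
  (forall j, measurable (E j)) ->
  exists i : T -> nat, (forall j, measurable [set t | i t = j]) /\
    forall t, (exists j, E j t) -> E (i t) t.
Proof.
move=> mE.
pose hit t j := `[< E j t >].
pose i t := if pselect (exists j, hit t j) is left h then ex_minn h else 0%N.
exists i; split=> [j|t [j Ejt]]; last first.
  rewrite /i; case: pselect => [h|[]]; last by exists j; apply/asboolP.
  by case: ex_minnP => m hm _; exact/asboolP.
pose U := \bigcup_n E n.
have mU : measurable U by exact: bigcup_measurable.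
pose L := E j `\` \bigcup_(n < j) E n.
have mL : measurable L by apply: measurableD => //; exact: bigcup_measurable.
rewrite (_ : [set _ | _] = L `|` (if j == 0%N then ~` U else set0)).
  by apply: measurableU => //; case: ifP => _ //; exact: measurableC.
apply/seteqP; split => t.
  rewrite /= /i; case: pselect => [h|nh <-]; last first.
    by right => -[n _ htn]; apply: nh; exists n; apply/asboolP.
  case: ex_minnP => m hm mmin mj; left; split => /=.
    by rewrite -mj; exact/asboolP.
  move=> [n /= nj /asboolP htn].
  by have := mmin _ htn; rewrite mj leqNgt nj.
case=> [[/= htj nL]|]; last first.
  case: eqP => // -> nE; rewrite /= /i; case: pselect => // h; exfalso.
  by have [n /asboolP htn] := h; apply: nE; exists n.
rewrite /= /i; case: pselect => [h|[]]; last by exists j; apply/asboolP.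
case: ex_minnP => m hm mmin; apply/eqP; rewrite eqn_leq.
rewrite mmin; last exact/asboolP.
rewrite leqNgt; apply/negP => mj; apply: nL; exists m => //; exact/asboolP.
Qed.

(** Preimages of open sets are countable unions of level sets of the indices. [J k j] says that some
    error bound e, valid at level k for all t at once, keeps the ball around [y j] inside O; it is a
    condition on two integers, so it selects a countable union. *)
Lemma measurable_uniform_lim d (T : measurableType d)
    (Y : completePseudoMetricType R) (y : nat -> Y)
    (i : nat -> T -> nat) (f : T -> Y) :
  (forall k j, measurable [set t | i k t = j]) ->
  (forall e : R, 0 < e -> exists k, forall t, ball (y (i k t)) e (f t)) ->
  measurable_fun [set: T] (f : T -> borel Y).
Proof.
move=> mi fi; apply: measurable_fun_borel => O oO.
pose J k j := `[< exists2 e : R, (forall t, ball (y (i k t)) e (f t)) &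
                    ball (y j) e `<=` O >].
rewrite (_ : f @^-1` O =
    \bigcup_k \bigcup_(j in [set j | J k j]) [set t | i k t = j]); last first.
  apply/seteqP; split => [t Oft|t [k _ [j /asboolP[e he sO] /= ij]]]; last first.
    by apply: sO; rewrite -ij; exact: he.
  have /nbhs_ballP[e /= e0 eO] : nbhs (f t) O by exact: open_nbhs_nbhs.
  have [k hk] := fi _ (divr_gt0 e0 (ltr0Sn R 1)).
  exists k => //; exists (i k t) => //=; apply/asboolP; exists (e / 2) => //.
  move=> z yz; apply: eO; rewrite [e]splitr; apply: ball_triangle yz.
  exact/ball_sym.
by apply: bigcup_measurable => k _; apply: bigcup_measurable => j _; exact: mi.
Qed.

(** On the range of f the approximations [y (i k t)] converge to the preimage. Elsewhere they may
    disagree, so they are followed only on the measurable set [good] where they are mutually close,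
    and the inverse is constant off it. The range itself is never shown to be measurable. *)
Lemma measurable_left_inverse d (T : measurableType d)
    (Y : completePseudoMetricType R) (f : Y -> T) :
  polish Y ->
  (forall O : set Y, open O -> exists2 G, measurable G & O = f @^-1` G) ->
  exists2 r : T -> Y, measurable_fun [set: T] (r : T -> borel Y) &
    forall y, r (f y) = y.
Proof.
move=> pY fO.
have [y [_ dy]] : exists y : nat -> Y, (forall n, setT (y n)) /\
    forall a (e : R), setT a -> 0 < e -> exists n, ball (y n) e a.
  by apply: dense_sequence => //; exists point.
pose eps (k : nat) : R := k.+1%:R^-1.
have /choice[G GP] : forall p : nat * nat, exists G : set T,
    measurable G /\ interior (ball (y p.2) (eps p.1)) = f @^-1` G.
  move=> p; have [G mG eG] := fO _ (open_interior (ball (y p.2) (eps p.1))).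
  by exists G.
have /choice[i iP] : forall k, exists ik : T -> nat,
    (forall j, measurable [set t | ik t = j]) /\
    forall t, (exists j, G (k, j) t) -> G (k, ik t) t.
  by move=> k; apply: measurable_first => j; exact: (GP (k, j)).1.
have mi k j : measurable [set t | i k t = j] by exact: (iP k).1.
pose good := [set t | forall k l, ball (y (i k t)) (eps k + eps l) (y (i l t))].
have mgood : measurable good.
  rewrite (_ : good = \bigcap_k \bigcap_l \bigcup_p \bigcup_(q in
      [set q | ball (y p) (eps k + eps l) (y q)])
      ([set t | i k t = p] `&` [set t | i l t = q])).
    apply: bigcap_measurable => // k _; apply: bigcap_measurable => // l _.
    apply: bigcup_measurable => p _; apply: bigcup_measurable => q _.
    exact: measurableI.
  apply/seteqP; split => t /=.
    by move=> gt k _ l _; exists (i k t) => //; exists (i l t) => //=; exact: gt.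
  by move=> gt k l; have [p _ [q /= b [/= -> ->]]] := gt k I l I.
have goodf w : good (f w) /\ forall k, ball (y (i k (f w))) (eps k) w.
  suff h : forall k, ball (y (i k (f w))) (eps k) w.
    split => // k l; exact: (ball_triangle (h k) (ball_sym (h l))).
  move=> k; apply: interior_subset; rewrite (GP (k, _)).2.
  apply: (iP k).2; have [j jw] := dy w _ I (divr_gt0 (inv_natS_gt0 k) (ltr0Sn R 1)).
  exists j; change ((f @^-1` G (k, j)) w).
  rewrite -(GP (k, j)).2 /=; apply/nbhs_ballP; exists (eps k / 2) => /=.
    by rewrite divr_gt0 ?inv_natS_gt0.
  by move=> z wz; rewrite [eps k]splitr; exact: (ball_triangle jw wz).
(* Three radii: [good] bounds the distance to a later approximation by eps k plus a smaller radius,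
   and the limit is within eps k of that approximation. *)
pose F t := [set u : Y | forall k, ball (y (i k t)) (eps k *+ 3) u].
have Fne t : good t -> F t !=set0.
  move=> gt; have : cvg ((fun k => y (i k t)) @ \oo).
    apply/cauchy_cvgP; apply: cauchy_exP => e e0.
    have [k ke] := inv_natS_lt (divr_gt0 e0 (ltr0Sn R 1)).
    exists (y (i k t)), k => // l /= kl.
    apply: (@le_ball _ _ _ (eps k + eps l)); last exact: gt.
    rewrite [e]splitr lerD ?(ltW ke)// (le_trans _ (ltW ke))//.
    by rewrite /eps lef_pV2 ?posrE// ler_nat ltnS.
  move=> cy; exists (lim ((fun k => y (i k t)) @ \oo)) => k.
  have [N _ /(_ _) hN] := cvg_ball cy (inv_natS_gt0 k).
  set l := lim _ in hN *.
  have := hN (maxn N k) (leq_maxl _ _) => /ball_sym hl.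
  have hk := gt k (maxn N k).
  apply: (@le_ball _ _ _ (eps k + eps (maxn N k) + eps k)).
    rewrite !mulrS mulr0n addr0 addrA lerD2r lerD2l /eps lef_pV2 ?posrE//.
    by rewrite ler_nat ltnS leq_maxr.
  exact: ball_triangle hk hl.
pose r t := if `[< good t >] then xget point (F t) else y 0%N.
exists r.
  apply: (@measurable_uniform_lim _ _ _ y
    (fun k t => if `[< good t >] then i k t else 0%N)).
    move=> k j; rewrite (_ : [set _ | _] = (good `&` [set t | i k t = j]) `|`
        (~` good `&` [set t | 0%N = j])).
      apply: measurableU; apply: measurableI => //; first exact: measurableC.
      exact: measurable_cst_set.
    apply/seteqP; split => t /=; case: asboolP => gt.
    - by left. - by right. - by case=> -[]. - by case=> -[].
  move=> e e0; have [k ke] := inv_natS_lt (divr_gt0 e0 (ltr0Sn R 2)).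
  exists k => t; rewrite /r; case: asboolP => [/Fne[u Fu]|_]; last exact: ballxx.
  apply: (@le_ball _ _ _ (eps k *+ 3)).
    by rewrite -mulr_natr -ler_pdivlMr// ltW.
  by case: xgetP => [z _ Fz|/(_ u)//]; exact: Fz.
move=> w; have [gw iw] := goodf w.
rewrite /r; case: asboolP => // _.
have Fw : F (f w) w.
  move=> k; apply: le_ball (iw k).
  by rewrite mulrS lerDl mulrn_wge0// ltW ?inv_natS_gt0.
case: xgetP => [z _ Fz|/(_ w)//].
apply: (hausdorff_ball pY.1) => e e0.
have [k ke] := inv_natS_lt (divr_gt0 e0 (ltr0Sn R 5)).
apply: (@le_ball _ _ _ (eps k *+ 3 + eps k *+ 3)).
  by rewrite -mulrnDr -mulr_natr -ler_pdivlMr// ltW.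
exact: (ball_triangle (ball_sym (Fz k)) (Fw k)).
Qed.
End PolishTools.

(** * Measurable selection of maximisers *)

Section Selection.
Context {R : realType} {d : measure_display} {T : measurableType d}.
Context {X : completePseudoMetricType R}.
Variables (A : set X) (g : X -> T -> R).
Hypotheses (X_polish : polish X) (A_closed : closed A).
Hypothesis mg : forall a, A a -> measurable_fun [set: T] (g a).
Hypothesis cg : forall a t, A a -> g^~ t x @[x --> within A (nbhs a)] --> g a t.

Let best t a := A a /\ forall b, A b -> g b t <= g a t.
Hypothesis best_ex : forall t, exists a, best t a.

Let hit (L : set X) := [set t | exists2 a, L a & best t a].
Let appr (L : set X) := [set t | forall e : R, 0 < e -> exists a,
  [/\ A a, L a & forall b, A b -> g b t <= g a t + e]].

Let hit_appr L : hit L `<=` appr L.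
Proof.
move=> t [a La [Aa ba]] e e0; exists a; split => // b /ba gb.
by rewrite (le_trans gb)// lerDl ltW.
Qed.

Let A_neq0 : [set: T] !=set0 -> A !=set0.
Proof. by move=> [t _]; have [a []] := best_ex t; exists a. Qed.

Let within_near (a : X) t (e : R) : A a -> 0 < e ->
  exists2 r : R, 0 < r & forall b, A b -> ball a r b -> `|g a t - g b t| < e.
Proof.
move=> Aa e0; have /cvgrPdist_lt/(_ e e0) := @cg a t Aa.
rewrite near_withinE => /nbhs_ballP[r /= r0 h]; exists r => // b Ab ab.
exact: h.
Qed.

(** Unlike an exact maximiser, an approximate one can be sought in a dense sequence of the part of A
    in L and tested against a dense sequence of A, since g is continuous in the action. *)
Let measurable_appr (L : set X) : measurable (appr L).
Proof.
have [/A_neq0 A0|T0] := pselect ([set: T] !=set0); last first.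
  rewrite (_ : appr L = set0)//; apply/seteqP; split => // t _.
  by case: T0; exists t.
have [AL0|AL0] := pselect ((A `&` L) !=set0); last first.
  rewrite (_ : appr L = set0)//; apply/seteqP; split => // t.
  by move=> /(_ 1 ltr01)[a [Aa La _]]; case: AL0; exists a.
have [p [Ap dp]] := dense_sequence X_polish A0.
have [q [ALq dq]] := dense_sequence X_polish AL0.
rewrite (_ : appr L = \bigcap_k \bigcup_n \bigcap_m
    [set t | g (p m) t <= g (q n) t + k.+1%:R^-1]).
  apply: bigcap_measurable => // k _; apply: bigcup_measurable => n _.
  apply: bigcap_measurable => // m _.
  rewrite -[X in measurable X]setTI.
  have mm : measurable_fun [set: T] (g (p m)) by exact: mg.
  have mn : measurable_fun [set: T] (fun t => g (q n) t + k.+1%:R^-1).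
    by apply: measurable_funD => //; apply: mg; exact: (ALq n).1.
  have := measurable_fun_ler mm mn.
  by move=> /(_ measurableT [set true]); apply.
apply/seteqP; split => t.
  move=> tL k _; have k2 : 0 < k.+1%:R^-1 / 2 :> R.
    by rewrite divr_gt0 ?inv_natS_gt0.
  have [a [Aa La ab]] := tL _ k2.
  have [r r0 ar] := within_near t Aa k2.
  have [n /ball_sym nr] := dq a r (conj Aa La) r0.
  exists n => // m _ /=; rewrite (le_trans (ab _ (Ap m)))//.
  have := ar _ (ALq n).1 nr; rewrite ltr_norml => /andP[_].
  rewrite ltrBlDr => /ltW h.
  by rewrite [X in _ <= _ + X]splitr addrA lerD2r addrC.
move=> tL e e0; have [k ke] := inv_natS_lt (divr_gt0 e0 (ltr0Sn R 1)).
have [n _ hn] := tL k I; exists (q n).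
have [Aq Lq] := ALq n; split => // b Ab.
have e2 : 0 < e / 2 by rewrite divr_gt0.
have [r r0 br] := within_near t Ab e2.
have [m /ball_sym mr] := dp b r Ab r0.
have := br _ (Ap m) mr; rewrite ltr_norml => /andP[_].
rewrite ltrBlDr => /ltW h; rewrite (le_trans h)//.
rewrite [e in leRHS]splitr addrA [leLHS]addrC lerD2r (le_trans (hn m I))//.
by rewrite lerD2l ltW.
Qed.

(* Approximate maximisers are caught by nested sets along which every
   ultrafilter converges. *)
Let bigcap_appr (H : nat -> set X) :
  (forall k, closed (H k)) -> (forall k l, (k <= l)%N -> H l `<=` H k) ->
  (forall F : set_system X, UltraFilter F -> (forall k, F (H k)) -> cvg F) ->
  \bigcap_k appr (H k) `<=` hit (\bigcap_k H k).
Proof.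
move=> cH ndH Hcvg t tH.
have /choice[a aP] : forall k : nat, exists a,
    [/\ A a, H k a & forall b, A b -> g b t <= g a t + k.+1%:R^-1].
  by move=> k; apply: tH => //; exact: inv_natS_gt0.
have [F [uF GF]] := ultraFilterLemma (fmap_proper_filter a (@eventually_filter)).
have FA : F A by apply: GF; exists 0%N => // k _; exact: (let: And3 x _ _ := aP k in x).
have FH k : F (H k).
  by apply: GF; exists k => // l /= kl; apply: (ndH k l kl); have [_] := aP l.
have [a0 Fa0] : exists a0 : X, F --> a0 by apply/cvg_ex; exact: Hcvg.
have mem (L : set X) : closed L -> F L -> L a0.
  move=> cL FL; apply: cL => B /Fa0 FB.
  by have [x []] := filter_ex (filterI FL FB); exists x.
exists a0; first by move=> k _; exact: mem.
have Aa0 : A a0 by exact: mem.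
split => // b Ab; apply/ler_addgt0Pr => e e0.
have e2 : 0 < e / 2 by rewrite divr_gt0.
have [r r0 ar] := within_near t Aa0 e2.
have [k ke] := inv_natS_lt e2.
have Fr : F (ball a0 r) by apply: Fa0; exact: nbhsx_ballx.
have Fk : F (a @` [set l | (k <= l)%N]).
  by apply: GF; exists k => // l /= kl; exists l.
have [z [rx [l /= kl alz]]] := filter_ex (filterI Fr Fk).
rewrite -{z}alz in rx.
have [Al _ /(_ b Ab)gl] := aP l.
have := ar _ Al rx; rewrite ltr_norml => /andP[+ _].
rewrite ltrNl opprB ltrBlDr => /ltW h; rewrite (le_trans gl)//.
rewrite [e in leRHS]splitr addrA lerD//; first by rewrite addrC.
by rewrite (le_trans _ (ltW ke))// lef_pV2 ?posrE// ler_nat ltnS.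
Qed.

Variable nu : probability T R.

(** A bound on outer measure, phrased through measurable covers because [hit L] is not known to be
    measurable for a general L. *)
Let big (r : R) L := forall B, measurable B -> hit L `<=` B -> (r%:E < nu B)%E.

(** Outer measure is continuous along increasing sequences: if every piece had a cover B n of
    measure at most r', the intersections C n of the tails of B would increase to a cover of [hit L]
    of measure at most r'. *)
Let big_bigcup r r' L (E : nat -> set X) :
  {homo E : n m / (n <= m)%N >-> n `<=` m} ->
  [set: X] `<=` \bigcup_n E n -> r' < r -> big r L ->
  exists n, big r' (L `&` E n).
Proof.
move=> ndE cE rr bL; apply: contrapT => nb.
have /choice[B BP] : forall n, exists B : set T,
    [/\ measurable B, hit (L `&` E n) `<=` B & (nu B <= r'%:E)%E].
  move=> n; apply: contrapT => nB; apply: nb; exists n => B mB hB.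
  by rewrite ltNge; apply/negP => h; apply: nB; exists B.
pose C n := \bigcap_(m in [set m | (n <= m)%N]) B m.
have mC n : measurable (C n).
  by apply: bigcap_measurableType => m _; have [] := BP m.
have mU : measurable (\bigcup_n C n) by exact: bigcup_measurable.
have hU : hit L `<=` \bigcup_n C n.
  move=> t [a La ba]; have [n _ Ea] := cE a I.
  exists n => // m /= nm; have [_ + _] := BP m; apply.
  by exists a => //; split => //; exact: ndE Ea.
have := bL _ mU hU; rewrite ltNge => /negP; apply.
apply: (@le_trans _ _ r'%:E); last by rewrite lee_fin ltW.
have ndC : {homo C : n m / (n <= m)%N >-> (n <= m)%O}.
  move=> n m nm; apply/subsetPset => t h l /= ml.
  by apply: h => /=; exact: leq_trans ml.
apply: (cvge_to_le (nondecreasing_cvg_mu (mu := nu) mC mU ndC)).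
apply: nearW => n /=; have [mB _] := BP n; apply: le_trans.
by apply: le_measure; rewrite ?inE//; move=> t; apply => /=.
Qed.

(* Cutting X down to finitely many balls of radius 1, 1/2, 1/3, ..., while the
   set of parameters with a maximiser left keeps outer measure above 1 - e, ends
   in a compact set, where the first small ball containing a maximiser can be
   chosen measurably. *)
Let exhaust (e : R) : 0 < e -> exists T1 : set T, exists s : T -> X,
  [/\ measurable T1, ((1 - e)%:E <= nu T1)%E,
      measurable_fun [set: T] (s : T -> borel X), (forall t, A (s t)) &
      forall t, T1 t -> best t (s t)].
Proof.
move=> e0.
have T0 : [set: T] !=set0.
  apply/set0P/negP => /eqP T0; have := probability_setT nu.
  by rewrite T0 measure0 => /eqP; rewrite eq_sym onee_eq0.
have [a0 Aa0] := A_neq0 T0.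
have [x [_ dx]] : exists x : nat -> X, (forall n, setT (x n)) /\
    forall a (r : R), setT a -> 0 < r -> exists n, ball (x n) r a.
  by apply: dense_sequence => //; exists point.
pose C k j := closure (ball (x j) (k.+1%:R^-1 : R)).
have cC k j : closed (C k j) by exact: closed_closure.
have Cx k : [set: X] `<=` \bigcup_j C k j.
  move=> a _; have [j ja] := dx a _ I (inv_natS_gt0 k).
  by exists j => //; exact: subset_closure.
have Cb k j : C k j `<=` ball (x j) (k.+1%:R^-1 *+ 2 : R).
  move=> a /(_ (ball a k.+1%:R^-1)) h.
  have [z [xz az]] := h (nbhsx_ballx _ _ (inv_natS_gt0 k)).
  by rewrite mulr2n; exact: (ball_triangle xz (ball_sym az)).
pose U k n := \bigcup_(j < n) C k j.
have cU k n : closed (U k n) by apply: closed_bigcup => //; exact: finite_II.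
have ndU k : {homo U k : n m / (n <= m)%N >-> n `<=` m}.
  by move=> n m nm t [j /= jn Cj]; exists j => //=; exact: leq_trans nm.
have UT k : [set: X] `<=` \bigcup_n U k n.
  by move=> a /(Cx k)[j _ Cj]; exists j.+1 => //; exists j => /=.
(* Decreases strictly from 1 - e/2 towards 1 - e: each cut may lose a little measure, and 1 - e is
   left in the limit. *)
pose r (k : nat) : R := 1 - e + (e / 2) * k.+1%:R^-1.
pose N L k := xget 0%N [set n | big (r k.+1) (L `&` U k n)].
pose fix K k := if k is k'.+1 then K k' `&` U k' (N (K k') k') else [set: X].
have bK k : big (r k) (K k).
  elim: k => [B mB hB|k IH].
    have -> : B = setT.
      apply/seteqP; split => // t _; apply: hB.
      by have [a ba] := best_ex t; exists a.
    rewrite probability_setT lte_fin /r invr1 mulr1; move: e0; lra.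
  rewrite /= /N; case: xgetP => [n _//|nb].
  have rr : r k.+1 < r k.
    rewrite /r ltrD2l ltr_pM2l ?divr_gt0// ltf_pV2 ?posrE//.
    by rewrite ltr_nat.
  by have [n /nb] := big_bigcup (@ndU k) (@UT k) rr IH.
have cK k : closed (K k).
  elim: k => [|k IH] /=; first exact: closedT.
  exact: closedI.
have ndK k l : (k <= l)%N -> K l `<=` K k.
  move=> /subnK <-; elim: (l - k)%N => [//|m IH a].
  by rewrite addSn => -[/IH].
(* An ultrafilter that contains a finite union of small sets contains one of them; having
   arbitrarily small members it is Cauchy. *)
have Kcvg (F : set_system X) : UltraFilter F -> (forall k, F (K k)) -> cvg F.
  move=> uF FK; apply/cauchy_cvgP; apply: cauchy_exP => c c0.
  have [k kc] := inv_natS_lt (divr_gt0 c0 (ltr0Sn R 1)).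
  have : F (U k (N (K k) k)).
    by apply: filterS (FK k.+1) => a [].
  elim: (N _ _) => [|n IH].
    rewrite /U bigcup_mkord big_ord0 => F0.
    by exfalso; exact: (@filter_not_empty _ F _ F0).
  have [FC _|FC FU] := in_ultra_setVsetC (C k n) uF.
    exists (x n); apply: filterS FC => a /Cb; apply: le_ball.
    by rewrite mulr2n [c]splitr lerD// ltW.
  apply: IH; apply: filterS (filterI FC FU) => a [nCa [j /=]].
  rewrite ltnS leq_eqVlt => /orP[/eqP->//|jn Ca]; exists j => //.
(* A list of indices, newest first, stands for the intersection of the closed balls it names; the
   length of the remaining list fixes the radius. *)
pose fix Lp q : set X := if q is j :: q' then C (size q') j `&` Lp q' else setT.
have cL q : closed (Lp q).
  elim: q => [|j q IH] /=; first exact: closedT.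
  exact: closedI.
pose K' := \bigcap_k K k.
have hitK L : closed L -> hit (K' `&` L) = \bigcap_k appr (K k `&` L).
  move=> cLL; apply/seteqP; split => t.
    move=> [a [Ka La] ba] k _; apply: hit_appr; exists a => //.
    by split => //; exact: Ka.
  move=> h; have : hit (\bigcap_k (K k `&` L)) t.
    apply: bigcap_appr h.
    - by move=> k; exact: closedI.
    - by move=> k l kl a [Ka La]; split => //; exact: (ndK k l).
    - by move=> F uF FKL; apply: Kcvg => k; apply: filterS (FKL k) => a [].
  move=> [a Ka ba]; exists a => //; split.
    by move=> k _; have [] := Ka k I.
  by have [] := Ka 0%N I.
have mhit L : closed L -> measurable (hit (K' `&` L)).
  by move=> cLL; rewrite hitK//; apply: bigcap_measurable.
have /choice[i iP] : forall q : seq nat, exists i : T -> nat,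
    (forall j, measurable [set t | i t = j]) /\
    forall t, (exists j, hit (K' `&` Lp (j :: q)) t) ->
      hit (K' `&` Lp (i t :: q)) t.
  by move=> q; apply: measurable_first => j; exact: mhit.
(* Greedy descent: at each level the first ball that, together with the earlier choices, still
   contains a maximiser. There are countably many finite paths, so measurability is checked path by
   path. *)
pose fix path (k : nat) (t : T) {struct k} : seq nat :=
  if k is k'.+1 then i (path k' t) t :: path k' t else [::].
have size_path k t : size (path k t) = k by elim: k => //= k ->.
have mpath k q : measurable [set t | path k t = q].
  elim: k q => [|k IH] [|j q] /=.
  - exact: measurable_cst_set.
  - exact: measurable_cst_set.
  - by rewrite (_ : [set _ | _] = set0)//; apply/seteqP; split.
  rewrite (_ : [set _ | _] = [set t | path k t = q] `&` [set t | i q t = j]).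
    by apply: measurableI => //; exact: (iP q).1.
  apply/seteqP; split => t /=; first by case=> <- <-.
  by move=> [<- <-].
pose T1 := hit (K' `&` setT).
have mT1 : measurable T1 by apply: mhit; exact: closedT.
have hitp t k : T1 t -> hit (K' `&` Lp (path k t)) t.
  move=> tT; elim: k => [//|k [a [Ka La] ba]] /=.
  apply: (iP _).2; have [j _ Cj] := Cx (size (path k t)) a I.
  by exists j, a.
(* Ball indices are shifted by one: index 0 stands for the default action [a0] used off [T1]. *)
pose idx k t := if `[< T1 t >] then (head 0%N (path k.+1 t)).+1 else 0%N.
pose y n := if n is n'.+1 then x n' else a0.
pose s t := if `[< T1 t >] then
  xget a0 [set a | best t a /\ forall k, Lp (path k t) a] else a0.
have sP t : T1 t -> best t (s t) /\ forall k, Lp (path k t) (s t).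
  move=> tT; rewrite /s asboolT//; case: xgetP => // /=.
  have [a Ha ba] : hit (\bigcap_k (K k `&` Lp (path k t))) t.
    apply: bigcap_appr.
    - by move=> k; exact: closedI.
    - move=> k l kl a [Ka La]; split; first exact: (ndK k l).
      move: La; rewrite -(subnK kl); elim: (l - k)%N => [//|m IH].
      by rewrite addSn => -[_ /IH].
    - by move=> F uF FKL; apply: Kcvg => k; apply: filterS (FKL k) => a [].
    - move=> k _; apply: hit_appr; have [a [Ka La] ba] := hitp t k tT.
      by exists a => //; split => //; exact: Ka.
  move=> /(_ a); case; split => // k; by have [] := Ha k I.
exists T1, s; split => //.
- have -> : T1 = \bigcap_k appr (K k).
    rewrite /T1 hitK; last exact: closedT.
    by apply: eq_bigcapr => k _; rewrite setIT.
  have mI : measurable (\bigcap_k appr (K k)) by exact: bigcap_measurable.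
  have niK : {homo (fun k => appr (K k)) : n m / (n <= m)%N >-> (m <= n)%O}.
    move=> k l kl; apply/subsetPset => t h c c0.
    have [a [Aa Ka ga]] := h c c0; exists a; split => //; exact: (ndK k l).
  have nu_lty : (nu (appr (K 0%N)) < +oo)%E by rewrite ltey_eq fin_num_measure.
  apply: (cvge_to_ge (nonincreasing_cvg_mu nu_lty _ mI niK)) => //.
  apply: nearW => k /=; apply/ltW.
  apply: le_lt_trans (bK k _ (@measurable_appr _) (@hit_appr _)).
  by rewrite lee_fin /r lerDl mulr_ge0// divr_ge0// ltW.
- apply: (@measurable_uniform_lim _ _ _ _ y idx).
    move=> k j.
    have [dec decK] : exists dec : nat -> seq nat, forall q, dec (pickle q) = q.
      by exists (fun n => odflt [::] (unpickle n)) => q; rewrite pickleK.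
    rewrite (_ : [set _ | _] = (T1 `&` \bigcup_n ([set t | path k t = dec n] `&`
        [set t | (i (dec n) t).+1 = j])) `|` (~` T1 `&` [set t | 0%N = j])).
      apply: measurableU; apply: measurableI => //.
      - apply: bigcup_measurable => n _; apply: measurableI => //.
        case: j => [|j].
          by rewrite (_ : [set _ | _] = set0)//; apply/seteqP; split.
        rewrite (_ : [set _ | _] = [set t | i (dec n) t = j]).
          exact: (iP _).1.
        by apply/seteqP; split => t /=; [case|move->].
      - exact: measurableC.
      - exact: measurable_cst_set.
    apply/seteqP; split => t; rewrite /= /idx; case: asboolP => tT /=.
    - move=> ij; left; split => //; exists (pickle (path k t)); first by [].
      by split; rewrite /mkset decK.
    - by right.
    - by case=> [[_ [n _ [/= ->]]]|[]].
    - by case=> [[]|[]].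
  move=> c c0; have [k kc] := inv_natS_lt (divr_gt0 c0 (ltr0Sn R 1)).
  exists k => t; rewrite /idx; case: asboolP => tT /=; last first.
    by rewrite /s asboolF//; exact: ballxx.
  have [_ /(_ k.+1)/=[/Cb + _]] := sP t tT; rewrite size_path.
  by apply: le_ball; rewrite mulr2n [c]splitr lerD// ltW.
- move=> t; have [tT|tT] := pselect (T1 t); first by have [[]] := sP t tT.
  by rewrite /s asboolF.
- by move=> t /sP[].
Qed.

(** Apply [exhaust] with e = 1/(k+1) for every k. The union of the sets obtained has full measure,
    and on it the selection belonging to the first set that contains t is followed. *)
Lemma ae_argmax_selection : exists T1 : set T, exists s : T -> X,
  [/\ measurable T1, nu T1 = 1%E,
      measurable_fun [set: T] (s : T -> borel X), (forall t, A (s t)) &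
      forall t, T1 t -> forall b, A b -> g b t <= g (s t) t].
Proof.
have /choice[T1 T1P] : forall k : nat, exists T1 : set T, exists s : T -> X,
  [/\ measurable T1, ((1 - k.+1%:R^-1)%:E <= nu T1)%E,
      measurable_fun [set: T] (s : T -> borel X), (forall t, A (s t)) &
      forall t, T1 t -> best t (s t)].
  by move=> k; apply: exhaust; exact: inv_natS_gt0.
have /choice[s sP] := T1P.
have [i [mi iP]] : exists i : T -> nat,
    (forall j, measurable [set t | i t = j]) /\
    forall t, (exists j, T1 j t) -> T1 (i t) t.
  by apply: measurable_first => j; have [] := sP j.
exists (\bigcup_k T1 k), (fun t => s (i t) t).
have mU : measurable (\bigcup_k T1 k).
  by apply: bigcup_measurable => k _; have [] := sP k.
split => //.
- apply/eqP; rewrite eq_le probability_le1//=; apply/lee_addgt0Pr => e e0.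
  have [k ke] := inv_natS_lt e0; have [mk hk _ _ _] := sP k.
  have := le_trans hk (le_measure nu _ _ (bigcup_sup (i:=k) Logic.I)).
  rewrite !inE => /(_ mk mU) h.
  rewrite (le_trans _ (leeD2r e%:E h))// -EFinD lee_fin; move: ke.
  move: (k.+1%:R^-1) => z; lra.
- apply: measurable_fun_borel => O oO.
  rewrite (_ : _ @^-1` O = \bigcup_k ([set t | i t = k] `&` s k @^-1` O)).
    apply: bigcup_measurable => k _; apply: measurableI => //.
    have [_ _ ms _ _] := sP k; rewrite -[X in measurable X]setTI.
    by apply: ms => //; exact: sub_sigma_algebra.
  by apply/seteqP; split => t /= => [h|[k _ [/= -> ]]//]; exists (i t).
- by move=> t; have [_ _ _ + _] := sP (i t); apply.
- move=> t [k _ Tk]; have [_ _ _ _ h] := sP (i t).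
  by apply: (h t (iP t _)).2; exists k.
Qed.

End Selection.

(** * Disintegration *)

Section Coding.
Context {R : realType}.

Let ternary (b : nat -> bool) : R^nat :=
  series (fun k => (b k)%:R * (3 ^+ k.+1)^-1).

Definition ternary_val (b : nat -> bool) : R := limn (ternary b).

Let ternaryS b n :
  ternary b n.+1 = ((b 0%N)%:R + ternary (fun k => b k.+1) n) / 3.
Proof.
rewrite /ternary /series /= big_nat_recl//= expr1 mulrDl; congr (_ + _).
rewrite mulr_suml; apply: eq_bigr => k _.
by rewrite -mulrA; congr (_ * _); rewrite [in LHS]exprSr invfM.
Qed.

Let ternary_ge0 b n : 0 <= ternary b n.
Proof. by apply: sumr_ge0 => k _; rewrite mulr_ge0 ?ler0n// invr_ge0 exprn_ge0. Qed.

Let ternary_le b n : ternary b n <= 2^-1.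
Proof.
elim: n b => [|n IH] b; first by rewrite /ternary /series /= big_geq.
rewrite ternaryS; have := IH (fun k => b k.+1).
have : (b 0%N)%:R <= 1 :> R by rewrite lern1 leq_b1.
move: (_%:R) (ternary _ _) => u v; lra.
Qed.

Let ternary_cvg b : cvgn (ternary b).
Proof.
apply: nondecreasing_is_cvgn.
  apply/nondecreasing_seqP => n; rewrite /ternary /series /= big_nat_recr//=.
  by rewrite lerDl mulr_ge0 ?ler0n// invr_ge0 exprn_ge0.
by exists 2^-1 => _ [n _ <-]; exact: ternary_le.
Qed.

Lemma ternary_val_itv b : 0 <= ternary_val b <= 2^-1.
Proof.
apply/andP; split.
  by apply: limr_ge => //; apply: nearW => n; exact: ternary_ge0.
by apply: limr_le => //; apply: nearW => n; exact: ternary_le.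
Qed.

Let ternary_valE b :
  ternary_val b = ((b 0%N)%:R + ternary_val (fun k => b k.+1)) / 3.
Proof.
rewrite /ternary_val; apply/cvg_lim => //.
rewrite -cvg_shiftS; under eq_fun do rewrite ternaryS.
apply: cvgMl; apply: cvgD; first exact: cvg_cst.
exact: ternary_cvg.
Qed.

(** Digit extraction: triple and drop the leading digit. With digits 0 and 1 only, a code starting
    with 0 is at most 1/6 and one starting with 1 is at least 1/3, so the threshold 1/4 reads the
    digit. *)
Let residue (n : nat) : R -> R :=
  iter n (fun f x => 3 * f x - ((4^-1 < f x)%R : bool)%:R) idfun.

Let residueE n b : residue n (ternary_val b) = ternary_val (fun k => b (n + k)%N).
Proof.
elim: n => [|n IH] //=.
rewrite /residue /= -/(residue n) IH ternary_valE addn0.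
set v := ternary_val _.
have -> : ternary_val (fun k => b (n.+1 + k)%N) = v.
  by rewrite /v; congr ternary_val; apply/funext => k; rewrite addSnnS.
have /andP[v0 v1] : 0 <= v <= 2^-1 by exact: ternary_val_itv.
case: (b n) => /=.
  have -> : 4^-1 < (1 + v) / 3 by move: v0 v1; lra.
  by rewrite mulrCA divff// mulr1 addrC addKr.
have -> : (4^-1 < (0 + v) / 3) = false by apply/negbTE; rewrite -leNgt; lra.
by rewrite mulrCA divff// mulr1 add0r subr0.
Qed.

Let measurable_residue n : measurable_fun [set: R] (residue n).
Proof.
elim: n => [|n IH]; first exact: measurable_id.
apply: measurable_funB; first exact: measurable_funM.
rewrite (_ : (fun x => _) = \1_(residue n @^-1` `]4^-1, +oo[)).
  apply: measurable_indic; rewrite -[X in measurable X]setTI; exact: IH.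
apply/funext => x; rewrite indicE /=; congr ((_ : bool)%:R).
by apply/idP/idP; rewrite inE /= in_itv /= andbT.
Qed.

Lemma measurable_ternary_val d (T : measurableType d) (b : T -> nat -> bool) :
  (forall n, measurable [set t | b t n]) ->
  measurable_fun [set: T] (fun t => ternary_val (b t)).
Proof.
move=> mb; apply: (@measurable_fun_cvg _ _ _ _ (fun n t => ternary (b t) n)).
  move=> n; apply: measurable_sum => k; apply: measurable_funM => //.
  rewrite (_ : (fun t => _) = \1_[set t | b t k]); first exact: measurable_indic.
  apply/funext => t; rewrite indicE; congr ((_ : bool)%:R).
  by apply/idP/idP; rewrite inE.
by move=> t _; exact: ternary_cvg.
Qed.

(* The digits of the code of y tell which sets of a countable base contain y;
   base 3 keeps codes with digits 0 and 1 apart. *)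
Lemma borel_coding (Y : completePseudoMetricType R) : polish Y ->
  exists (f : Y -> R) (r : R -> Y),
    [/\ measurable_fun [set: borel Y] f,
        measurable_fun [set: R] (r : R -> borel Y),
        (forall y, 0 <= f y <= 1) & forall y, r (f y) = y].
Proof.
move=> pY.
have [x [_ dx]] : exists x : nat -> Y, (forall n, setT (x n)) /\
    forall a (r : R), setT a -> 0 < r -> exists n, ball (x n) r a.
  by apply: dense_sequence => //; exists point.
pose B n := if unpickle n is Some (i, k)
            then interior (ball (x i) (k.+1%:R^-1 : R)) else set0.
have oB n : open (B n).
  by rewrite /B; case: unpickle => [[i k]|]; [exact: open_interior|exact: open0].
pose b (y : Y) n := `[< B n y >].
have mb n : measurable [set y : borel Y | b y n].
  rewrite (_ : [set _ | _] = B n); first exact: sub_sigma_algebra.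
  by apply/seteqP; split => y /=; rewrite /b asboolE.
pose f y := ternary_val (b y).
have mf : measurable_fun [set: borel Y] f by exact: measurable_ternary_val.
have fO (O : set Y) : open O -> exists2 G : set R, measurable G & O = f @^-1` G.
  (* O is the union of the base sets it contains, and membership in the n-th base set is the n-th
     digit of the code. *)
  move=> oO; exists (\bigcup_(n in [set n | B n `<=` O])
      (residue n @^-1` `]4^-1, +oo[)).
    apply: bigcup_measurable => n _; rewrite -[X in measurable X]setTI.
    exact: measurable_residue.
  have digit n y : (4^-1 < residue n (f y)) = b y n.
    rewrite /f residueE ternary_valE addn0.
    set v := ternary_val _.
    have /andP[v0 v1] : 0 <= v <= 2^-1 by exact: ternary_val_itv.
    by apply/idP/idP; case: (b y n) => //=; lra.
  apply/seteqP; split => y.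
    move=> Oy; have /nbhs_ballP[e /= e0 eO] : nbhs y O by exact: open_nbhs_nbhs.
    have [k ke] := inv_natS_lt (divr_gt0 e0 (ltr0Sn R 1)).
    have [i iy] := dx y _ I (divr_gt0 (inv_natS_gt0 k) (ltr0Sn R 1)).
    exists (pickle (i, k)) => /=.
      move=> z; rewrite /B pickleK => /interior_subset iz.
      apply: eO; apply: (@le_ball _ _ _ (k.+1%:R^-1 / 2 + k.+1%:R^-1)).
        rewrite [e]splitr lerD ?(ltW ke)// (le_trans _ (ltW ke))//.
        by rewrite ler_piMr ?invf_le1 ?ler1n// ltW// inv_natS_gt0.
      exact: ball_triangle (ball_sym iy) iz.
    rewrite in_itv /= andbT digit; apply/asboolP; rewrite /B pickleK.
    apply/nbhs_ballP; exists (k.+1%:R^-1 / 2) => /=.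
      by rewrite divr_gt0 ?inv_natS_gt0.
    by move=> z yz; rewrite [k.+1%:R^-1]splitr; exact: (ball_triangle iy yz).
  move=> [n /= nO]; rewrite in_itv /= andbT digit => /asboolP; exact: nO.
have [r mr rf] := measurable_left_inverse pY fO.
exists f, r; split => // y.
have /andP[-> h] := ternary_val_itv (b y); rewrite (le_trans h)//.
by rewrite invf_le1 ?ler1n.
Qed.

End Coding.

Local Open Scope ereal_scope.

(** * Pushforwards, joint laws and Bayes' rule for integrals *)

Section MeasureTools.
Context {d d'} {T : measurableType d} {T' : measurableType d'} {R : realType}.

Section push.
Variables (m : {measure set T -> \bar R}) (f : T -> T').

(** Carrying the measurability proof as an argument lets the measure structure be inferred from the
    term; [kernel_of] and [restr_marginal] follow the same pattern. *)
Definition push_measure (mf : measurable_fun [set: T] f) : set T' -> \bar R :=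
  pushforward m f.

Hypothesis mf : measurable_fun [set: T] f.

Let push0 : push_measure mf set0 = 0.
Proof. by rewrite /push_measure /pushforward preimage_set0 measure0. Qed.

Let push_ge0 B : 0 <= push_measure mf B.
Proof. exact: measure_ge0. Qed.

Let push_sigma_additive : semi_sigma_additive (push_measure mf).
Proof.
move=> F mF tF mUF; rewrite /push_measure /pushforward preimage_bigcup.
apply: measure_semi_sigma_additive.
- by move=> n; rewrite -[X in measurable X]setTI; exact: mf.
- apply/trivIsetP => /= i j _ _ ij; rewrite -preimage_setI.
  by move/trivIsetP : tF => /(_ _ _ _ _ ij) ->//; rewrite preimage_set0.
- by rewrite -preimage_bigcup -[X in measurable X]setTI; exact: mf.
Qed.

HB.instance Definition _ := isMeasure.Build _ _ _
  (push_measure mf) push0 push_ge0 push_sigma_additive.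

Lemma ge0_integral_push (g : T' -> \bar R) :
  measurable_fun [set: T'] g -> (forall y, 0 <= g y) ->
  \int[push_measure mf]_y g y = \int[m]_x g (f x).
Proof. by move=> mg g0; rewrite (ge0_integral_pushforward mf). Qed.

End push.

Section push_probability.
Variables (m : probability T R) (f : T -> T') (mf : measurable_fun [set: T] f).

Let push1 : push_measure m mf [set: T'] = 1.
Proof. by rewrite /push_measure /pushforward preimage_setT; exact: probability_setT. Qed.

HB.instance Definition _ := Measure_isProbability.Build _ _ _
  (push_measure m mf) push1.

Definition push_probability : probability T' R := push_measure m mf.
End push_probability.

Section kernel_of.
Variable b : T -> probability T' R.

Definition kernel_of
    (mb : forall B, measurable B -> measurable_fun [set: T] (fun t => b t B))
    (t : T) : {measure set T' -> \bar R} := b t.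

Hypothesis mb : forall B, measurable B -> measurable_fun [set: T] (fun t => b t B).

HB.instance Definition _ := isKernel.Build _ _ _ _ _ (kernel_of mb) mb.

Let kernel_of1 t : kernel_of mb t [set: T'] = 1.
Proof. exact: probability_setT. Qed.

HB.instance Definition _ := Kernel_isProbability.Build _ _ _ _ _
  (kernel_of mb) kernel_of1.

End kernel_of.

Lemma eq_measure_rect (m1 m2 : {finite_measure set (T * T')%type -> \bar R}) :
  (forall B C, measurable B -> measurable C -> m1 (B `*` C) = m2 (B `*` C)) ->
  forall S, measurable S -> m1 S = m2 S.
Proof.
move=> h; apply: (@measure_unique _ R _
  [set B `*` C | B in measurable & C in measurable] (fun=> setT)).
- exact: measurable_prod_measurableType.
- move=> _ _ [B mB [C mC <-]] [B' mB' [C' mC' <-]].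
  exists (B `&` B'); first exact: measurableI.
  by exists (C `&` C'); [exact: measurableI|rewrite setXI].
- by move=> _; exists setT => //; exists setT => //; rewrite setXTT.
- by rewrite bigcup_const.
- by move=> _ [B mB [C mC <-]]; exact: h.
- by move=> _; rewrite ltey_eq fin_num_measure.
Qed.

End MeasureTools.

Section Joint.
Context {d d'} {Y : measurableType d} {M : measurableType d'} {R : realType}.
Variables (mu : probability Y R) (e : R.-pker Y ~> M).

Let mpair (y : Y) : measurable_fun [set: M] (fun m => (y, m)).
Proof. exact: pair1_measurable. Qed.

(** [kcomp] composes a kernel from a first space with a kernel from a product. With the one-point
    space as first space, mu becomes a kernel, and the composition with [graph] is the joint law of
    state and message. *)
Let graph (z : unit * Y) : {measure set (Y * M) -> \bar R} :=
  push_measure (e z.2) (@mpair z.2).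

Let measurable_graph S : measurable S ->
  measurable_fun [set: unit * Y] (graph ^~ S).
Proof.
move=> mS; rewrite [X in measurable_fun _ X](_ : _ = (fun y => e y (xsection S y)) \o snd).
  apply: measurableT_comp => //.
  by apply: measurable_fun_xsection_finite_kernel; rewrite inE.
apply/funext => z /=; rewrite /graph /push_measure /pushforward xsectionE.
by [].
Qed.

HB.instance Definition _ := isKernel.Build _ _ _ _ _ graph measurable_graph.

Let graph1 z : graph z [set: Y * M] = 1.
Proof.
rewrite /graph /= /push_measure /pushforward preimage_setT.
exact: prob_kernel.
Qed.

HB.instance Definition _ := Kernel_isProbability.Build _ _ _ _ _ graph graph1.

Let mprior B : measurable B -> measurable_fun [set: unit] (fun _ : unit => mu B).
Proof. by []. Qed.

Definition joint : set (Y * M) -> \bar R := kcomp (kernel_of mprior) graph tt.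

HB.instance Definition _ := Measure.on joint.

Lemma integral_joint f :
  measurable_fun [set: Y * M] f -> (forall z, 0 <= f z) ->
  \int[joint]_z f z = \int[mu]_y \int[e y]_m f (y, m).
Proof.
move=> mf f0; rewrite [LHS]integral_kcomp//=; apply: eq_integral => y _.
by rewrite /graph ge0_integral_push.
Qed.

Lemma jointE S : measurable S -> joint S = \int[mu]_y e y (xsection S y).
Proof.
move=> mS; rewrite /joint /kcomp /=; apply: eq_integral => y _.
by rewrite /graph /push_measure /pushforward xsectionE.
Qed.

Let joint1 : joint [set: Y * M] = 1.
Proof.
rewrite jointE// -[RHS](probability_setT mu) -[RHS]mul1e -integral_cst//.
by apply: eq_integral => y _; rewrite xsectionE preimage_setT; exact: prob_kernel.
Qed.

HB.instance Definition _ := Measure_isProbability.Build _ _ _ joint joint1.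

Lemma joint_rect B C : measurable B -> measurable C ->
  joint (B `*` C) = \int[mu]_(y in B) e y C.
Proof.
move=> mB mC; rewrite jointE; last exact: measurableX.
rewrite [RHS]integral_mkcond; apply: eq_integral => y _.
rewrite patchE; case: ifPn => yB; first by rewrite in_xsectionX.
by rewrite notin_xsectionX// measure0.
Qed.

Definition marginal : probability M R :=
  push_probability joint (@measurable_snd _ _ Y M).

Lemma integral_marginal g :
  measurable_fun [set: M] g -> (forall m, 0 <= g m) ->
  \int[marginal]_m g m = \int[mu]_y \int[e y]_m g m.
Proof.
move=> mg g0; rewrite /marginal ge0_integral_push// integral_joint//.
exact: measurableT_comp.
Qed.

Lemma marginalE C : measurable C -> marginal C = \int[mu]_y e y C.
Proof.
move=> mC; rewrite -joint_rect//; congr (joint _).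
by apply/seteqP; split => -[y m] //= [].
Qed.

End Joint.

Section BayesSwap.
Context {d d'} {Y : measurableType d} {M : measurableType d'} {R : realType}.
Variables (mu : probability Y R) (e : R.-pker Y ~> M).
Variable beta : M -> probability Y R.
Hypothesis mbeta :
  forall B, measurable B -> measurable_fun [set: M] (fun m => beta m B).
Hypothesis bayes : forall B C, measurable B -> measurable C ->
  \int[mu]_(y in B) e y C = \int[mu]_y \int[e y]_(m in C) beta m B.

Let mswap : measurable_fun [set: M * Y] (fun z => (z.2, z.1)).
Proof. exact: measurable_fun_pair. Qed.

Let swapped : probability (Y * M)%type R :=
  push_probability (joint (marginal mu e) (kernel_of mbeta)) mswap.

(** The Bayes identity says that two laws on Y * M agree on rectangles: state first and then
    message, or message from its marginal and then state from beta. They are therefore equal and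
    integrate every nonnegative f alike. *)
Lemma bayes_swap (f : Y * M -> \bar R) :
  measurable_fun [set: Y * M] f -> (forall z, 0 <= f z) ->
  \int[mu]_y \int[e y]_m f (y, m) =
  \int[mu]_y \int[e y]_m \int[beta m]_y' f (y', m).
Proof.
move=> mf f0; rewrite -integral_joint//.
transitivity (\int[swapped]_z f z).
  apply: eq_measure_integral => S mS _; apply: eq_measure_rect => // B C mB mC.
  rewrite [LHS]joint_rect// bayes//.
  transitivity (joint (marginal mu e) (kernel_of mbeta) (C `*` B)); last first.
    by congr (joint _ _ _); apply/seteqP; split => -[y m] /= [].
  rewrite [RHS]joint_rect// [RHS]integral_mkcond [RHS]integral_marginal.
  - by apply: eq_integral => y _; rewrite integral_mkcond.
  - by apply/(measurable_restrictT _ _).1 => //; apply: measurable_funTS; exact: mbeta.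
  - by move=> m; rewrite patchE; case: ifP.
rewrite /swapped ge0_integral_push// integral_joint//; last first.
  exact: measurableT_comp.
rewrite integral_marginal//.
  apply: (@measurable_fun_integral_finite_kernel _ _ M Y R
    (fun z => f (z.2, z.1)) (kernel_of mbeta)) => //.
  exact: measurableT_comp.
by move=> m; exact: integral_ge0.
Qed.

End BayesSwap.

(** * Conditional probabilities and their realisation by quantiles *)

Section Density.
Context {d d'} {Y : measurableType d} {M : measurableType d'} {R : realType}.
Variables (J : probability (Y * M)%type R) (nu : probability M R).
Hypothesis J_nu : forall C, measurable C -> J ([set: Y] `*` C) = nu C.

Section restr.
Variable E : set Y.

Definition restr_marginal (mE : measurable E) : set M -> \bar R :=
  fun C => J (E `*` C).

Hypothesis mE : measurable E.

Let restr0 : restr_marginal mE set0 = 0.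
Proof. by rewrite /restr_marginal setX0 measure0. Qed.

Let restr_ge0 C : 0 <= restr_marginal mE C.
Proof. exact: measure_ge0. Qed.

Let restr_sigma_additive : semi_sigma_additive (restr_marginal mE).
Proof.
move=> F mF tF mUF; rewrite /restr_marginal setX_bigcupr.
apply: measure_semi_sigma_additive.
- by move=> n; exact: measurableX.
- apply/trivIsetP => /= i j _ _ ij; rewrite -setXI setIid.
  by move/trivIsetP : tF => /(_ _ _ _ _ ij) ->//; rewrite setX0.
- by apply: bigcup_measurable => k _; exact: measurableX.
Qed.

HB.instance Definition _ := isMeasure.Build _ _ _
  (restr_marginal mE) restr0 restr_ge0 restr_sigma_additive.

Let restr_fin : fin_num_fun (restr_marginal mE).
Proof. by move=> C mC; apply: fin_num_measure; exact: measurableX. Qed.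

HB.instance Definition _ := @Measure_isFinite.Build _ _ _
  (restr_marginal mE) restr_fin.

(** Radon-Nikodym: the part of the marginal coming from E is dominated by nu, and g m is a
    conditional probability of E given m. *)
Lemma density_ex : exists g : M -> R,
  [/\ measurable_fun [set: M] g, (forall m, (0 <= g m)%R) &
      forall C, measurable C -> J (E `*` C) = \int[nu]_(m in C) (g m)%:E].
Proof.
have dom : restr_marginal mE `<< nu.
  apply/null_content_dominatesP => C mC nC.
  apply/eqP; rewrite /restr_marginal -measure_le0.
  rewrite (le_trans (_ : _ <= J ([set: Y] `*` C)))//; last by rewrite J_nu// nC.
  apply: le_measure; rewrite ?inE; [exact: measurableX..|].
  by move=> -[y m] [].
have [g [g0 gfin gint gE]] := radon_nikodym_sigma_finite dom.
exists (fine \o g); split.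
- apply: measurableT_comp => //; exact: measurable_int gint.
- by move=> m; rewrite fine_ge0.
- move=> C mC; rewrite -[LHS]/(restr_marginal mE C) gE//.
  by apply: eq_integral => m _; rewrite /= fineK.
Qed.

End restr.

Definition is_density (E : set Y) (g : M -> R) :=
  [/\ measurable_fun [set: M] g, (forall m, (0 <= g m)%R) &
      forall C, measurable C -> J (E `*` C) = \int[nu]_(m in C) (g m)%:E].

(** A density of the difference of E' and E, added to g, is a density of E' and so equals g' almost
    everywhere. *)
Lemma density_le E E' g g' : measurable E -> measurable E' -> E `<=` E' ->
  is_density E g -> is_density E' g' -> {ae nu, forall m, (g m <= g' m)%R}.
Proof.
move=> mE mE' EE' [mg g0 gE] [mg' g'0 g'E].
have mD : measurable (E' `\` E) by exact: measurableD.
have [h [mh h0 hE]] := density_ex mD.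
have : ae_eq nu setT (fun m => (g' m)%:E) (fun m => (g m + h m)%:E).
  apply: integral_ae_eq => //.
  - apply/integrableP; split; first exact/measurable_EFinP.
    rewrite (eq_integral (fun m => (g' m)%:E)).
      by rewrite -g'E// ltey_eq fin_num_measure//; exact: measurableX.
    by move=> m _; rewrite /= ger0_norm.
  - by apply/measurable_EFinP; exact: measurable_funD.
  - move=> C _ mC; rewrite -g'E//.
    under eq_integral do rewrite EFinD.
    rewrite ge0_integralD//; last 4 first.
    + by move=> m _; rewrite lee_fin.
    + by apply/measurable_EFinP; exact: measurable_funTS.
    + by move=> m _; rewrite lee_fin.
    + by apply/measurable_EFinP; exact: measurable_funTS.
    rewrite -gE// -hE// -measureU; first last.
    + by apply/seteqP; split => -[y m] //= [[Ey _] [[]]].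
    + exact: measurableX.
    + exact: measurableX.
    congr (J _); apply/seteqP; split => -[y m] /=.
      by move=> [Ey Cm]; have [yE|yE] := pselect (E y); [left|right].
    by move=> [[/EE' ? ?]|[[? _] ?]].
apply: filterS => m /(_ I)[->]; by rewrite lerDl.
Qed.

End Density.

Section UniformBelow.
Context {R : realType}.

Lemma uniform_below (c : R) : (0 <= c <= 1)%R ->
  uniform_prob (@ltr01 R) [set t | (t < c)%R] = c%:E.
Proof.
move=> /andP[c0 c1]; rewrite /uniform_prob integral_uniform_pdf.
rewrite (_ : _ `&` _ = `[0%R, c[%classic `&` `[0%R, 1%R]%classic); last first.
  apply/seteqP; split => t /=; rewrite !in_itv /=.
    by move=> [-> /andP[-> ->]].
  by move=> [/andP[-> ->] ->].
rewrite (eq_integral (fun=> 1)); last first.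
  move=> t; rewrite inE /= !in_itv /= /uniform_pdf => -[_ ->].
  by rewrite subr0 invr1.
rewrite integral_cst ?mul1e//; last exact: measurableI.
rewrite (_ : _ `&` _ = `[0%R, c[%classic).
  rewrite [LHS]lebesgue_measure_itv /= lte_fin; case: ltP => [_|c0'].
    by rewrite oppr0 adde0.
  by congr (_%:E); apply/eqP; rewrite eq_le c0 c0'.
apply/seteqP; split => t /=; rewrite !in_itv /=; first by case.
by move=> /andP[t0 tc]; split; rewrite t0 //= (le_trans (ltW tc)).
Qed.

End UniformBelow.

Section Disintegration.
Context {R : realType} {Y : completePseudoMetricType R}.
Context {d : measure_display} {M : measurableType d}.
Variables (mu : probability (borel Y) R) (e : R.-pker (borel Y) ~> M).

(* The state is coded by a number in [0, 1]; a conditional law of the code is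
   realised as the law of its quantile function under the uniform law. *)
Lemma disintegration : polish Y -> exists beta : M -> probability (borel Y) R,
  (forall B, measurable B -> measurable_fun [set: M] (fun m => beta m B)) /\
  forall B C, measurable B -> measurable C ->
    \int[mu]_(y in B) e y C = \int[mu]_y \int[e y]_(m in C) beta m B.
Proof.
move=> pY; have [f [r [mf mr f01 rf]]] := borel_coding pY.
pose J : probability (borel Y * M)%type R := joint mu e.
pose nu : probability M R := marginal mu e.
have J_nu C : measurable C -> J ([set: borel Y] `*` C) = nu C.
  by move=> mC; rewrite [LHS]joint_rect// [RHS]marginalE.
pose E (q : rat) := [set y : borel Y | (f y <= ratr q)%R].
have mE q : measurable (E q).
  rewrite (_ : E q = f @^-1` `]-oo, ratr q]).
    by rewrite -[X in measurable X]setTI; exact: mf.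
  by apply/seteqP; split => y; rewrite /= in_itv.
(* [F q m] is the conditional distribution function of the code at the rational q, given m. *)
have /choice[F FP] : forall q, exists g, is_density J nu (E q) g.
  by move=> q; exact: (density_ex J_nu (mE q)).
pose rats n : rat := odflt 0%R (unpickle n).
have ratsP q : exists n, rats n = q.
  by exists (pickle q); rewrite /rats pickleK.
have Fae : {ae nu, forall m, (forall i j, (rats i <= rats j)%R ->
    (F (rats i) m <= F (rats j) m)%R) /\ forall i, (F (rats i) m <= 1)%R}.
  have h1 : {ae nu, forall m, forall i j, (rats i <= rats j)%R ->
      (F (rats i) m <= F (rats j) m)%R}.
    apply: ae_foralln => i; apply: ae_foralln => j.
    have [ij|ij] := pselect (rats i <= rats j)%R; last first.
      by apply: aeW => m /ij.
    have EE : E (rats i) `<=` E (rats j).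
      by move=> y; rewrite /E /= => /le_trans; apply; rewrite ler_rat.
    by apply: filterS (density_le J_nu (mE _) (mE _) EE (FP _) (FP _)) => m.
  have h2 : {ae nu, forall m, forall i, (F (rats i) m <= 1)%R}.
    apply: ae_foralln => i.
    have d1 : is_density J nu setT (fun=> 1%R).
      split => // C mC; rewrite J_nu// integral_cst ?mul1e//.
    by have := density_le J_nu (mE (rats i)) measurableT (@subsetT _ _) (FP _) d1.
  by apply: filterS2 h1 h2 => m.
(* The uniform law lives on [measurableTypeR R]; the identity carries it over to R. *)
have mid : measurable_fun [set: measurableTypeR R] (idfun : _ -> R).
  by move=> _ B mB; rewrite setTI.
pose U01 : probability (measurableTypeR R) R := uniform_prob (@ltr01 R).
pose P01 : probability R R := push_probability U01 mid.
have mP01 (B : set R) : measurable B -> measurable_fun [set: M] (fun=> P01 B).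
  by [].
pose L : probability (M * R)%type R := joint nu (kernel_of mP01).
pose Z (q : rat) := [set z : M * R | (z.2 < F q z.1)%R].
have mZ q : measurable (Z q).
  have mF : measurable_fun [set: M * R] (fun z => F q z.1).
    by apply: measurableT_comp => //; have [] := FP q.
  have := measurable_fun_ltr (@measurable_snd _ _ M R) mF.
  by move=> /(_ measurableT [set true] I); rewrite setTI.
pose idx (ok : pred rat) n := [set i | (i < n)%N /\ ok (rats i)].
pose ZU ok n := \bigcup_(i in idx ok n) Z (rats i).
pose EU ok n := \bigcup_(i in idx ok n) E (rats i).
have mZU ok n : measurable (ZU ok n) by exact: bigcup_measurable.
have mEU ok n : measurable (EU ok n) by exact: bigcup_measurable.
(* A nonempty finite family of rationals has a largest member, to which both unions reduce: exactly
   for the sets E, and for the sets Z almost surely by monotonicity of F. Infinite families follow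
   by continuity from below. *)
have LU ok n C : measurable C ->
    L ((C `*` setT) `&` ZU ok n) = J (EU ok n `*` C).
  move=> mC.
  have [nok|[i [[ni oki] imax]]] : (forall i, ~ idx ok n i) \/
      exists i, idx ok n i /\ forall j, idx ok n j -> (rats j <= rats i)%R.
    elim: n => [|n [nok|[i [[ni oki] imax]]]]; first by left => i [].
      have [okn|nokn] := boolP (ok (rats n)).
        right; exists n; split; first by split.
        move=> j [+ okj]; rewrite ltnS leq_eqVlt => /orP[/eqP->//|jn].
        by case: (nok j).
      left => j [+ okj]; rewrite ltnS leq_eqVlt => /orP[/eqP jn|jn].
        by move: nokn; rewrite -jn okj.
      by case: (nok j).
    right; have [okn|nokn] := boolP (ok (rats n)); last first.
      exists i; split; first by split => //; exact: ltnW.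
      move=> j [+ okj]; rewrite ltnS leq_eqVlt => /orP[/eqP jn|jn].
        by move: nokn; rewrite -jn okj.
      exact: imax.
    have [ri|ri] := leP (rats n) (rats i).
      exists i; split; first by split => //; exact: ltnW.
      move=> j [+ okj]; rewrite ltnS leq_eqVlt => /orP[/eqP->//|jn].
      exact: imax.
    exists n; split; first by split.
    move=> j [+ okj]; rewrite ltnS leq_eqVlt => /orP[/eqP->//|jn].
    by rewrite (le_trans (imax j _) (ltW ri)).
    have -> : ZU ok n = set0 by apply/seteqP; split => // z [j /nok].
    have -> : EU ok n = set0 by apply/seteqP; split => // z [j /nok].
    by rewrite setI0 set0X !measure0.
  have -> : EU ok n = E (rats i).
    apply/seteqP; split => y; last by move=> Ey; exists i.
    by move=> [j /imax ji]; rewrite /E /= => /le_trans; apply; rewrite ler_rat.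
  have [mF F0 FE] := FP (rats i).
  have mS : measurable ((C `*` setT) `&` ZU ok n).
    by apply: measurableI => //; exact: measurableX.
  rewrite FE// [LHS]jointE//= integral_mkcond.
  rewrite [RHS]integral_mkcond.
  have sec m : xsection ((C `*` setT) `&` ZU ok n) m =
      if m \in C then \bigcup_(j in idx ok n) [set t | (t < F (rats j) m)%R]
      else set0.
    rewrite xsectionE; case: ifPn => mC'; apply/seteqP; split => t //=.
    - by move=> [_ [j ij Zj]]; exists j.
    - by move=> [j ij Zj]; split; [split => //; exact: set_mem|exists j].
    - by move=> [[/mem_set]]; rewrite (negbTE mC').
  apply: ge0_ae_eq_integral => //.
  - rewrite patch_setT.
    apply: (@measurable_fun_xsection_finite_kernel _ _ M R R (kernel_of mP01)).
    by rewrite inE.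
  - apply/(measurable_restrictT _ _).1 => //; apply: measurable_funTS.
    exact/measurable_EFinP.
  - by move=> m _; rewrite patchE; case: ifP.
  - by move=> m _; rewrite patchE; case: ifP => // _; rewrite lee_fin.
  apply: filterS Fae => m [Fmono F1] _; rewrite patch_setT patchE sec.
  case: ifPn => _; last by rewrite measure0.
  rewrite (_ : \bigcup_(j in _) _ = [set t | (t < F (rats i) m)%R]).
    by apply: uniform_below; rewrite F0 F1.
  apply/seteqP; split => t /=; last by move=> tF; exists i.
  by move=> [j /imax/Fmono jF /= /lt_le_trans]; apply.
have LUT ok C : measurable C ->
    L ((C `*` setT) `&` \bigcup_n ZU ok n) = J ((\bigcup_n EU ok n) `*` C).
  move=> mC; rewrite setI_bigcupr setX_bigcupl.
  have ndi : {homo idx ok : n m / (n <= m)%N >-> n `<=` m}.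
    by move=> n m nm i [ni oki]; split => //; exact: leq_trans nm.
  have mA n : measurable ((C `*` setT) `&` ZU ok n).
    by apply: measurableI => //; exact: measurableX.
  have mB n : measurable (EU ok n `*` C) by exact: measurableX.
  have cA : L \o (fun n => (C `*` setT) `&` ZU ok n) @ \oo -->
      L (\bigcup_n ((C `*` setT) `&` ZU ok n)).
    apply: nondecreasing_cvg_mu => //; first exact: bigcup_measurable.
    move=> n m nm; apply/subsetPset; apply: setIS => z [i ii Zi].
    by exists i => //; exact: ndi ii.
  have cB : J \o (fun n => EU ok n `*` C) @ \oo -->
      J (\bigcup_n (EU ok n `*` C)).
    apply: nondecreasing_cvg_mu => //; first exact: bigcup_measurable.
    move=> n m nm; apply/subsetPset => -[y t] [[i ii Ei] Ct].
    by split => //; exists i => //; exact: ndi ii.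
  have eLJ : L \o (fun n => (C `*` setT) `&` ZU ok n) =
      J \o (fun n => EU ok n `*` C) by apply/funext => n /=; rewrite LU.
  by rewrite eLJ in cA; exact: cvg_unique cA cB.
(* Its infimum is the quantile function of [F ^~ m] at t, where z = (m, t). Adjoining 1 and keeping
   nonnegative rationals only makes the infimum meaningful at every z, also where F fails to be
   monotone, and agrees with codes lying in [0, 1]. *)
pose below (z : M * R) :=
  [set 1%R] `|` [set (ratr (rats i) : R) | i in [set i | (0 <= rats i)%R /\ Z (rats i) z]].
pose Q z := inf (below z).
pose okx (x : R) := fun q : rat => (0 <= q)%R && (ratr q < x)%R.
have QltE x : [set z | (Q z < x)%R] =
    if (1 < x)%R then setT else \bigcup_n ZU (okx x) n.
  have lb z : has_lbound (below z).
    exists 0%R => _ [->//|[i [i0 _] <-]]; by rewrite ler0q.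
  case: ltP => x1; apply/seteqP; split => z //=.
  - by move=> _; apply: le_lt_trans x1; apply: ge_inf => //; left.
  - move=> /inf_lt-/(_ (ex_intro _ 1%R (or_introl erefl)))[y].
    case=> [/= -> |[i [i0 Zi] <-] ix]; first by rewrite ltNge x1.
    by exists i.+1 => //; exists i => //; split => //; rewrite /okx i0.
  - move=> [n _ [i [ni /andP[i0 ix]] Zi]]; apply: le_lt_trans ix.
    by apply: ge_inf => //; right; exists i.
have mQ : measurable_fun [set: M * R] Q.
  apply: (measurability _ (RGenInftyO.measurableE R)) => _ [_ [x ->] <-].
  rewrite setTI (_ : _ @^-1` _ = [set z | (Q z < x)%R]); last first.
    by apply/seteqP; split => z; rewrite /= in_itv.
  by rewrite QltE; case: ifP => // _; exact: bigcup_measurable.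
have Qlt x C : measurable C ->
    L ((C `*` setT) `&` [set z | (Q z < x)%R]) = J ([set y | (f y < x)%R] `*` C).
  move=> mC; rewrite QltE; case: ltP => x1.
    rewrite setIT [LHS]joint_rect//.
    transitivity (\int[nu]_(y in C) cst 1 y).
      by apply: eq_integral => m _; exact: probability_setT.
    rewrite integral_cst// mul1e.
    transitivity (J ([set: borel Y] `*` C)); first by rewrite J_nu.
    congr (J _); congr (_ `*` _).
    apply/seteqP; split => y //= _.
    by have /andP[_ /le_lt_trans] := f01 y; apply.
  rewrite LUT//; congr (J _); congr (_ `*` _).
  apply/seteqP; split => y /=.
    by move=> [n _ [i [ni /andP[i0 ix]]]]; rewrite /E /= => /le_lt_trans; apply.
  move=> /rat_in_itvoo[q]; rewrite in_itv /= => /andP[fq qx].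
  have [i iq] := ratsP q; exists i.+1 => //; exists i.
    split => //; rewrite /= iq /okx qx andbT -(ler0q R).
    by have /andP[f0 _] := f01 y; rewrite (le_trans f0)// ltW.
  by rewrite iq /E /= ltW.
(* For fixed C both sides are measures in D, so it is enough to compare them on the half-lines
   treated by [Qlt]. *)
have law C D : measurable C -> measurable D ->
    L ((C `*` setT) `&` Q @^-1` D) = J ((f @^-1` D) `*` C).
  move=> mC mD.
  have mCX : measurable (C `*` [set: R]) by exact: measurableX.
  have mXC : measurable ([set: borel Y] `*` C) by exact: measurableX.
  have mfst : measurable_fun [set: borel Y * M] (fun z => f z.1).
    exact: measurableT_comp.
  pose m1 := push_measure (mrestr L mCX) mQ.
  pose m2 := push_measure (mrestr J mXC) mfst.
  have m1E B : m1 B = L ((C `*` setT) `&` Q @^-1` B).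
    by rewrite /m1 /push_measure /pushforward /mrestr setIC.
  have m2E B : m2 B = J ((f @^-1` B) `*` C).
    rewrite /m2 /push_measure /pushforward /mrestr; congr (J _).
    by apply/seteqP; split => -[y m] //= => [[? []]|[]].
  rewrite -m1E -m2E.
  apply: (@measure_unique _ R _ (@RGenInftyO.G R) (fun k => `]-oo, k%:R[%classic)).
  - exact: RGenInftyO.measurableE.
  - move=> _ _ [x ->] [y ->]; exists (Num.min x y).
    by apply/seteqP; split => z; rewrite /= !in_itv /= lt_min => /andP.
  - by move=> k; exists k%:R.
  - apply/seteqP; split => // x _; exists (Num.bound `|x|) => //=.
    rewrite in_itv /= (le_lt_trans (ler_norm x))//.
    by apply: archi_boundP.
  - move=> _ [x ->]; apply: etrans (m1E _) _; apply: etrans (esym (m2E _)).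
    have h (T : Type) (g : T -> R) : g @^-1` `]-oo, x[ = [set z | (g z < x)%R].
      by apply/seteqP; split => z; rewrite /= in_itv.
    by rewrite !h Qlt.
  - move=> k; apply: (@le_lt_trans _ _ 1); last exact: ltry.
    apply: le_trans (_ : m1 _ <= 1) => //; rewrite m1E.
    apply: probability_le1; apply: measurableI => //.
    by rewrite -[X in measurable X]setTI; exact: (mQ).
  - exact: mD.
have mQm m : measurable_fun [set: R] (fun t => r (Q (m, t)) : borel Y).
  apply: (measurableT_comp mr).
  exact: (measurableT_comp mQ (@pair1_measurable _ _ M R m)).
exists (fun m => push_probability P01 (mQm m)).
have mrQ (B : set (borel Y)) : measurable B -> measurable [set z | B (r (Q z))].
  move=> mB; rewrite -[X in measurable X]setTI.
  exact: (measurableT_comp mr mQ).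
have betaE (B : set (borel Y)) m : measurable B ->
    push_probability P01 (mQm m) B = P01 (xsection [set z | B (r (Q z))] m).
  by move=> mB; rewrite xsectionE.
have mb (B : set (borel Y)) : measurable B ->
    measurable_fun setT (fun m => push_probability P01 (mQm m) B).
  move=> mB; under eq_fun do rewrite betaE//.
  apply: (@measurable_fun_xsection_finite_kernel _ _ M R R (kernel_of mP01)).
  by rewrite inE; exact: mrQ.
split => // B C mB mC.
rewrite -joint_rect//.
transitivity (L ((C `*` setT) `&` Q @^-1` (r @^-1` B))).
  rewrite law//; last by rewrite -[X in measurable X]setTI; exact: mr.
  congr (J _); congr (_ `*` _); apply/seteqP; split => y /=; by rewrite rf.
under [RHS]eq_integral do rewrite integral_mkcond.
rewrite -integral_marginal; last 2 first.
- by apply/(measurable_restrictT _ _).1 => //; apply: measurable_funTS; exact: mb.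
- by move=> m; rewrite patchE; case: ifP.
rewrite [LHS]jointE; last first.
  by apply: measurableI; [exact: measurableX|exact: mrQ].
apply: eq_integral => m _; rewrite patchE; case: ifPn => Cm.
  rewrite betaE//; congr (P01 _); rewrite !xsectionE.
  apply/seteqP; split => t /=; first by case.
  by move=> Bt; split => //; split => //; exact: set_mem.
rewrite (_ : xsection _ _ = set0) ?measure0// xsectionE.
apply/seteqP; split => t //= [[/mem_set]]; by rewrite (negbTE Cm).
Qed.
End Disintegration.

(** * Measurability along the play *)

Section PlayMeasurability.
Context {R : realType} {Omega M X : completePseudoMetricType R}.
Variables (sigma : @sender_strategy R Omega M).
Variables (rho : @receiver_strategy R Omega M X).
Implicit Types (h : @history R Omega M) (e : @experiment R Omega M).

Lemma play_rcons h e ms m :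
  play sigma h e (rcons ms m) =
  (rcons (play sigma h e ms).1 ((play sigma h e ms).2, m),
   sigma (rcons (play sigma h e ms).1 ((play sigma h e ms).2, m))).
Proof. by elim: ms h e => //= m' ms IH h e; rewrite IH. Qed.

Lemma reached_rcons h e ms m :
  reached sigma rho h e (rcons ms m) <->
  reached sigma rho h e ms /\ response sigma rho h e ms = None.
Proof.
elim: ms h e => [|m' ms IH] h e /=; first by split=> [[]|[]].
split=> [[rh /IH[]]//|[[rh rm] rs]]; split => //; exact/IH.
Qed.

(** Play from the next history is a section of play from (h, e): the first message is fixed at m. *)
Lemma measurable_play_cons h e m : rho h e = None ->
  measurable_play sigma rho h e ->
  measurable_play sigma rho (rcons h (e, m)) (sigma (rcons h (e, m))).
Proof.
move=> rh mp n; have [mc mr mk] := mp n.+1.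
pose cns (ms : n.-tuple (borel M)) : n.+1.-tuple (borel M) := [tuple of m :: ms].
have mcns : measurable_fun [set: n.-tuple (borel M)] cns.
  by apply: measurable_cons.
have pre (S : set (n.+1.-tuple (borel M))) :
    measurable S -> measurable (cns @^-1` S).
  by move=> mS; rewrite -[X in measurable X]setTI; exact: mcns.
have cE : @consulted _ _ _ _ sigma rho (rcons h (e, m)) (sigma (rcons h (e, m))) n =
    cns @^-1` @consulted _ _ _ _ sigma rho h e n.+1.
  apply/seteqP; split => ms /=; first by move=> [? ?]; split.
  by move=> [[_ ?] ?].
split.
- by rewrite cE; exact: pre.
- move=> D mD; have := pre _ (mr D mD); congr (measurable _).
  apply/seteqP; split => ms /=; first by move=> [[_ ?] ?].
  by move=> [? ?]; split.
- move=> C mC; rewrite cE.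
  pose cns2 (z : n.-tuple (borel M) * borel Omega) := (cns z.1, z.2).
  have mcns2 : measurable_fun setT cns2.
    by apply: measurable_fun_pair => //; exact: measurableT_comp.
  have mcX : measurable ((@consulted _ _ _ _ sigma rho h e n.+1) `*` [set: borel Omega]).
    exact: measurableX.
  have := mk C mC; move=> mkC _ B mB.
  have := mkC mcX B mB => mS.
  have := mcns2 measurableT _ mS; rewrite setTI; congr (measurable _).
Qed.

(** Joint measurability in the messages received and the state. Message sequences that are not
    reached give 0, because [measurable_play] says nothing about choices there. *)
Definition stage_measurable (G : history -> experiment -> Omega -> \bar R) h e :=
  forall k, measurable_fun [set: k.-tuple (borel M) * borel Omega]
    (fun z => if `[< reached sigma rho h e z.1 >]
      then G (play sigma h e z.1).1 (play sigma h e z.1).2 z.2 else 0).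

Section kernel.
Variables (h : @history R Omega M) (e : @experiment R Omega M) (n : nat).

(** The law of the next message, replaced by the zero measure where the receiver does not consult,
    so that integrating against it performs one step of [stage_value]. *)
Definition play_kernel (mp : measurable_play sigma rho h e)
    (z : n.-tuple (borel M) * borel Omega) : {measure set (borel M) -> \bar R} :=
  if `[< (@consulted _ _ _ _ sigma rho h e n) z.1 >]
  then (play sigma h e z.1).2 z.2 else mzero.

Hypothesis mp : measurable_play sigma rho h e.

Let measurable_play_kernel C : measurable C ->
  measurable_fun [set: n.-tuple (borel M) * borel Omega]
    (play_kernel mp ^~ C).
Proof.
move=> mC; have [mc _ mk] := mp n.
have mD : measurable ((@consulted _ _ _ _ sigma rho h e n) `*` [set: borel Omega]).
  exact: measurableX.
have := (measurable_restrictT _ mD).1 (mk C mC).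
congr (measurable_fun _ _); apply/funext => z.
rewrite patchE /play_kernel; case: asboolP => cz.
  by rewrite mem_set.
by rewrite memNset // => -[].
Qed.

HB.instance Definition _ := isKernel.Build _ _ _ _ _ (play_kernel mp)
  measurable_play_kernel.

Let play_kernel_uub : measure_fam_uub (play_kernel mp).
Proof.
(* The uniform bound has to be strict, so 1 would not do. *)
exists 2%R => z; apply: (@le_lt_trans _ _ 1); last by rewrite lte_fin ltr1n.
rewrite /play_kernel; case: ifP => _; last by rewrite /mzero lee01.
by rewrite prob_kernel.
Qed.

HB.instance Definition _ := Kernel_isFinite.Build _ _ _ _ _ (play_kernel mp)
  play_kernel_uub.

End kernel.

Lemma stage_value_ge0 G n h e w : (forall h e w, 0 <= G h e w) ->
  0 <= stage_value sigma rho G n h e w.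
Proof.
move=> G0; elim: n h e => [|n IH] h e //=.
by case: (rho h e) => // ; apply: integral_ge0 => m _; exact: IH.
Qed.

Lemma measurable_rcons d1 d2 (T1 : measurableType d1) (T2 : measurableType d2)
    k (f : T1 -> k.-tuple T2) (g : T1 -> T2) :
  measurable_fun setT f -> measurable_fun setT g ->
  measurable_fun setT (fun x => [tuple of rcons (f x) (g x)]).
Proof.
move=> mf mg; apply/measurable_fun_tnthP => i.
have [ik|ik] := ltnP i k.
  rewrite (_ : _ \o _ = fun x => tnth (f x) (Ordinal ik)).
    exact: (measurableT_comp (measurable_tnth (Ordinal ik)) mf).
  apply/funext => x /=; rewrite !(tnth_nth (g x)) /= nth_rcons size_tuple ik.
  by [].
rewrite (_ : _ \o _ = g)//; apply/funext => x /=.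
have ei : nat_of_ord i = k by apply/eqP; rewrite eqn_leq ik -ltnS ltn_ord.
by rewrite (tnth_nth (g x)) /= nth_rcons size_tuple ei ltnn eqxx.
Qed.

(** Induction on n for all tuple lengths at once: the value with n + 1 consultations to go after k
    messages is the integral, over the last of k + 1 messages, of the value with n to go. *)
Lemma measurable_stage G h e : (forall h e w, 0 <= G h e w) ->
  measurable_play sigma rho h e -> stage_measurable G h e ->
  forall n, stage_measurable (stage_value sigma rho G n) h e.
Proof.
move=> G0 mp mG; elim=> [//|n IH] k.
pose g := fun z : k.+1.-tuple (borel M) * borel Omega =>
  if `[< reached sigma rho h e z.1 >] then
    stage_value sigma rho G n (play sigma h e z.1).1 (play sigma h e z.1).2 z.2
  else 0.
pose g' := fun y : (k.-tuple (borel M) * borel Omega) * borel M =>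
  g ([tuple of rcons y.1.1 y.2], y.1.2).
have mg' : measurable_fun setT g'.
  apply: (measurableT_comp (IH k.+1)); apply: measurable_fun_pair.
    by apply: measurable_rcons => //; exact: measurableT_comp.
  exact: measurableT_comp.
have g'0 y : 0 <= g' y.
  by rewrite /g' /g; case: ifP => // _; exact: stage_value_ge0.
have := @measurable_fun_integral_finite_kernel _ _ _ _ R g'
  (play_kernel (n := k) mp) g'0 mg'.
congr (measurable_fun _ _); apply/funext => -[ms w] /=.
rewrite /play_kernel; case: asboolP => /= [[rm rs]|nc].
  rewrite asboolT//; rewrite /response in rs; rewrite rs.
  apply: eq_integral => m _; rewrite /g' /g /= asboolT; last exact/reached_rcons.
  by rewrite play_rcons.
rewrite integral_measure_zero; case: asboolP => // rm.
case er : (rho _ _) => //; exfalso; apply: nc; split => //.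
Qed.

Lemma measurable_stage0 G h e : stage_measurable G h e ->
  measurable_fun [set: borel Omega] (G h e).
Proof.
move=> /(_ 0%N) mG.
have mp : measurable_fun [set: borel Omega]
    (fun w => ([tuple] : 0.-tuple (borel M), w)).
  exact: measurable_fun_pair.
have := measurableT_comp mG mp; congr (measurable_fun _ _).
by apply/funext => w /=; rewrite asboolT.
Qed.

Lemma measurable_stage1 G h e : rho h e = None -> stage_measurable G h e ->
  measurable_fun [set: borel Omega * borel M]
    (fun z => G (rcons h (e, z.2)) (sigma (rcons h (e, z.2))) z.1).
Proof.
move=> rh /(_ 1%N) mG.
have mp : measurable_fun [set: borel Omega * borel M]
    (fun z => ([tuple z.2] : 1.-tuple (borel M), z.1)).
  apply: measurable_fun_pair => //; apply: measurable_cons => //.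
have := measurableT_comp mG mp; congr (measurable_fun _ _).
by apply/funext => -[w m] /=; rewrite asboolT.
Qed.

Lemma stage_measurable_cons G h e m : rho h e = None ->
  stage_measurable G h e ->
  stage_measurable G (rcons h (e, m)) (sigma (rcons h (e, m))).
Proof.
move=> rh mG k.
have mp : measurable_fun [set: k.-tuple (borel M) * borel Omega]
    (fun z => ([tuple of m :: z.1] : k.+1.-tuple (borel M), z.2)).
  by apply: measurable_fun_pair => //; exact: measurable_cons.
have := measurableT_comp (mG k.+1) mp; congr (measurable_fun _ _).
apply/funext => -[ms w] /=; congr (if _ then _ else _).
by apply/asboolP/asboolP => [[]|].
Qed.

Lemma stage_measurable_cst h e (r : \bar R) : measurable_play sigma rho h e ->
  stage_measurable (fun h e w => if rho h e is None then r else 0) h e.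
Proof.
move=> mp k; have [mc _ _] := mp k.
have mD : measurable ((@consulted _ _ _ _ sigma rho h e k) `*` [set: borel Omega]).
  exact: measurableX.
have := (measurable_restrictT (cst r) mD).1 (measurable_cst _).
congr (measurable_fun _ _); apply/funext => -[ms w]; rewrite patchE /=.
case: asboolP => rm /=.
  case er : (rho _ _) => [a|].
    by rewrite memNset// => -[[_]]; rewrite /= /response er.
  by rewrite mem_set.
by rewrite memNset// => -[[]].
Qed.

(** Utilities are controlled on A alone, so joint measurability is asked of some function that
    agrees with g there. *)
Lemma stage_measurable_act h e (A : set X) (g : X -> Omega -> R) :
  feasible A rho ->
  (exists2 g' : borel X * borel Omega -> R, measurable_fun setT g' &
     forall a w, A a -> g' (a, w) = g a w) ->
  measurable_play sigma rho h e ->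
  stage_measurable (fun h e w => if rho h e is Some a then (g a w)%:E else 0) h e.
Proof.
move=> fA [g' mg' g'E] mp k; have [_ mr _] := mp k.
pose D := [set ms : k.-tuple (borel M) | reached sigma rho h e ms /\
  exists2 a, [set: X] a & response sigma rho h e ms = Some a].
have mD : measurable D by exact: mr.
pose resp (ms : k.-tuple (borel M)) : borel X :=
  if `[< reached sigma rho h e ms >] then odflt point (response sigma rho h e ms)
  else point.
have mresp : measurable_fun D resp.
  move=> _ B mB; have := mr B mB; congr (measurable _).
  apply/seteqP; split => ms /=.
    move=> [rm [a Ba ra]]; split; first by split => //; exists a.
    by rewrite /resp asboolT// ra.
  move=> [[rm [a _ ra]]]; rewrite /resp asboolT// ra /= => Ba.
  by split => //; exists a.
have mDX : measurable (D `*` [set: borel Omega]) by exact: measurableX.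
have mrespT : measurable_fun setT resp.
  have := (measurable_restrictT _ mD).1 mresp.
  congr (measurable_fun _ _); apply/funext => ms; rewrite patchE.
  case: ifPn => // /negP nD; rewrite /resp; case: asboolP => // rm.
  case er : (response _ _ _ _ _) => [a|//]; exfalso; apply: nD.
  by rewrite inE; split => //; exists a.
have mf : measurable_fun (D `*` [set: borel Omega])
    (fun z => (g' (resp z.1, z.2))%:E).
  apply: measurable_funTS; apply/measurable_EFinP; apply: measurableT_comp => //.
  by apply: measurable_fun_pair => //; exact: measurableT_comp.
have := (measurable_restrictT _ mDX).1 mf.
congr (measurable_fun _ _); apply/funext => -[ms w]; rewrite patchE /=.
case: asboolP => rm /=; last by rewrite memNset// => -[[]].
case er : (rho _ _) => [a|].
  rewrite mem_set; last by split => //; split => //; exists a.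
  by rewrite /resp asboolT// /response er /= g'E//; exact: fA er.
by rewrite memNset// => -[[_ [a _]]]; rewrite /= /response er.
Qed.

End PlayMeasurability.

Local Close Scope ereal_scope.

(** * Values of beliefs *)

Lemma bounded_integrable {R : realType} d (T : measurableType d)
    (mu : probability T R) (f : T -> R) (K : R) :
  measurable_fun setT f -> (forall t, `|f t| <= K) ->
  mu.-integrable setT (EFin \o f).
Proof.
move=> mf fK; apply: measurable_bounded_integrable => //.
  exact: le_lt_trans (probability_le1 _ _) (ltry _).
exists K; split; first exact: num_real.
by move=> r Kr t _; exact: le_trans (fK t) (ltW Kr).
Qed.

Lemma integral_probability_cst {R : realType} d (T : measurableType d)
    (mu : probability T R) (r : \bar R) : (\int[mu]_t r = r)%E.
Proof. by rewrite integral_cst// [X in (_ * X)%E]probability_setT mule1. Qed.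

Lemma integral_pker_cst {R : realType} d d' (T : measurableType d)
    (T' : measurableType d') (k : R.-pker T ~> T') t (r : \bar R) :
  (\int[k t]_y r = r)%E.
Proof. by rewrite integral_cst// [X in (_ * X)%E]prob_kernel mule1. Qed.

Lemma integral_shift {R : realType} d (T : measurableType d)
    (mu : probability T R) (f : T -> R) (K : R) :
  measurable_fun setT f -> (forall t, `|f t| <= K) ->
  (\int[mu]_t (f t + K)%:E = (\int[mu]_t f t + K)%:E)%E.
Proof.
move=> mf fK; have fi := bounded_integrable mu mf fK.
under eq_integral do rewrite EFinD.
rewrite (integralD measurableT fi (finite_measure_integrable_cst mu K measurableT)).
rewrite EFinD; congr (_ + _)%E; last exact: (integral_probability_cst mu K%:E).
by rewrite /Rintegral fineK//; exact: integrable_fin_num.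
Qed.

Definition decision_problem {R : realType} {Omega X : completePseudoMetricType R}
    (A : set X) (u : X -> Omega -> R) (K : R) : Prop :=
  [/\ polish X, closed A,
      {within A `*` [set: Omega], continuous (fun z : X * Omega => u z.1 z.2)},
      forall a w, A a -> `|u a w| <= K &
      forall mu : probability (borel Omega) R,
        attains_max A (fun a => \int[mu]_w u a w)].

Section Values.
Context {R : realType} {Omega X : completePseudoMetricType R}.
Variables (A : set X) (u : X -> Omega -> R) (K : R).
Hypothesis dp : decision_problem A u K.
Let X_polish : polish X. Proof. by case: dp. Qed.
Let A_closed : closed A. Proof. by case: dp. Qed.
Let u_continuous : {within A `*` [set: Omega],
  continuous (fun z : X * Omega => u z.1 z.2)}.
Proof. by case: dp. Qed.
Let u_le a w : A a -> `|u a w| <= K.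
Proof. by case: dp => _ _ _ h _; exact: h. Qed.
Let optimal_action (mu : probability (borel Omega) R) :
  attains_max A (fun a => \int[mu]_w u a w).
Proof. by case: dp. Qed.
Implicit Types mu : probability (borel Omega) R.

Let u_near a w (e : R) : A a -> 0 < e -> exists2 r : R, 0 < r &
  forall b w', A b -> ball a r b -> ball w r w' -> `|u a w - u b w'| < e.
Proof.
move=> Aa e0; have /subspace_continuousP/(_ (a, w)) := u_continuous.
move=> /(_ (conj Aa I)) => /cvgrPdist_lt/(_ e e0).
rewrite near_withinE => /nbhs_ballP[r /= r0 h]; exists r => // b w' Ab ab ww'.
by apply: (h (b, w')) => //=; split.
Qed.

Lemma utility_cvg a w : A a -> u ^~ w x @[x --> within A (nbhs a)] --> u a w.
Proof.
move=> Aa; apply/cvgrPdist_lt => e e0; rewrite near_withinE.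
have [r r0 h] := u_near w Aa e0; apply/nbhs_ballP; exists r => //= b ab Ab.
by apply: h => //; exact: ballxx.
Qed.

Lemma measurable_utility a : A a -> measurable_fun [set: borel Omega] (u a).
Proof.
move=> Aa.
apply: (measurability _ (RGenOInfty.measurableE R)) => _ [_ [x ->] <-].
rewrite setTI; apply: sub_sigma_algebra => /=.
rewrite openE => w /=; rewrite in_itv /= andbT => xw.
have xw0 : 0 < u a w - x by rewrite subr_gt0.
have [r r0 h] := u_near w Aa xw0; apply/nbhs_ballP; exists r => //= w' ww'.
rewrite /= in_itv /= andbT; have := h a w' Aa (ballxx _ r0) ww'.
by rewrite ltr_norml => /andP[_]; rewrite ltrD2l ltrN2.
Qed.

(** Existence of optimal actions at beliefs, applied to the point mass at w. *)
Lemma utility_best w : exists a, A a /\ forall b, A b -> u b w <= u a w.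
Proof.
have E a : A a -> \int[dirac (w : borel Omega)]_w' u a w' = u a w.
  move=> Aa; rewrite /Rintegral integral_dirac//; last first.
    by apply/measurable_EFinP; exact: measurable_utility.
  by rewrite diracT mul1e.
have [a Aa h] := optimal_action (dirac (w : borel Omega)).
by exists a; split => // b Ab; rewrite -!E//; exact: h.
Qed.

Let A0 : A !=set0.
Proof. by have [a []] := utility_best point; exists a. Qed.

Lemma utility_bound_ge0 : 0 <= K.
Proof. by have [a Aa] := A0; exact: le_trans (normr_ge0 _) (u_le point Aa). Qed.

Definition best_utility (w : Omega) : R := sup [set u a w | a in A].

Let has_sup_u w : has_sup [set u a w | a in A].
Proof.
have [a Aa] := A0; split; first by exists (u a w), a.
by exists K => _ [b Ab <-]; rewrite (le_trans (ler_norm _))// u_le.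
Qed.

Lemma best_utility_ge a w : A a -> u a w <= best_utility w.
Proof. by move=> Aa; apply: ub_le_sup; [exact: (has_sup_u w).2|exists a]. Qed.

Lemma best_utilityE a w : A a -> (forall b, A b -> u b w <= u a w) ->
  best_utility w = u a w.
Proof.
move=> Aa h; apply/eqP; rewrite eq_le best_utility_ge// andbT.
by apply: ge_sup; [exact: (has_sup_u w).1|move=> _ [b Ab <-]; exact: h].
Qed.

Lemma best_utility_le w : `|best_utility w| <= K.
Proof. by have [a [Aa h]] := utility_best w; rewrite (best_utilityE Aa h) u_le. Qed.

(** Lower semicontinuity: an action that yields more than x at w still does so at nearby states. *)
Lemma measurable_best_utility : measurable_fun [set: borel Omega] best_utility.
Proof.
apply: (measurability _ (RGenOInfty.measurableE R)) => _ [_ [x ->] <-].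
rewrite setTI; apply: sub_sigma_algebra => /=.
rewrite openE => w /=; rewrite in_itv /= andbT => xw.
have [a [Aa aw]] := utility_best w; rewrite (best_utilityE Aa aw) in xw.
have xw0 : 0 < u a w - x by rewrite subr_gt0.
have [r r0 h] := u_near w Aa xw0; apply/nbhs_ballP; exists r => //= w' ww'.
rewrite /= in_itv /= andbT; have := h a w' Aa (ballxx _ r0) ww'.
rewrite ltr_norml => /andP[_]; rewrite ltrD2l ltrN2 => /lt_le_trans; apply.
exact: best_utility_ge.
Qed.

(** Rounding the action to a nearby point of a dense sequence in A gives jointly measurable
    functions that converge to u on A; u is cut off outside A. *)
Lemma joint_utility : exists2 g : borel X * borel Omega -> R,
  measurable_fun setT g & forall a w, A a -> g (a, w) = u a w.
Proof.
have [x [Ax dx]] := dense_sequence X_polish A0.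
have /choice[i iP] : forall k, exists i : borel X -> nat,
    (forall j, measurable [set a | i a = j]) /\ forall a,
    (exists j, interior (ball (x j) (k.+1%:R^-1 : R)) a) ->
    interior (ball (x (i a)) (k.+1%:R^-1 : R)) a.
  move=> k; apply: measurable_first => j; apply: sub_sigma_algebra.
  exact: open_interior.
pose D : set (borel X * borel Omega) := (A : set (borel X)) `*` setT.
have mA : measurable (A : set (borel X)).
  rewrite -[A]setCK; apply: measurableC; apply: sub_sigma_algebra.
  exact: closed_openC.
have mD : measurable D by exact: measurableX.
pose f k := fun z : borel X * borel Omega => u (x (i k z.1)) z.2.
have mf k : measurable_fun setT (f k).
  move=> _ B mB; rewrite setTI.
  rewrite (_ : _ @^-1` B = \bigcup_j ([set a | i k a = j] `*` (u (x j) @^-1` B))).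
    apply: bigcup_measurable => j _; apply: measurableX; first exact: (iP k).1.
    by rewrite -[X in measurable X]setTI; exact: measurable_utility.
  apply/seteqP; split => -[a w] /=; rewrite /f /=.
    by move=> Bw; exists (i k a).
  by move=> [j _ [/= <-]].
have mu_D : measurable_fun D (fun z : borel X * borel Omega => u z.1 z.2).
  apply: (@measurable_fun_cvg _ _ _ _ f) => [k|[a w] [Aa _]].
    exact: measurable_funTS.
  apply/cvgrPdist_lt => e e0 /=.
  have [r r0 h] := u_near w Aa e0.
  have [k kr] := inv_natS_lt r0.
  exists k => // l /= kl; apply: h => //; last exact: ballxx.
  apply: (@le_ball _ _ _ l.+1%:R^-1).
    by rewrite (le_trans _ (ltW kr))// lef_pV2 ?posrE// ler_nat ltnS.
  apply: ball_sym; apply: interior_subset; apply: (iP l).2.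
  have [j jw] := dx a _ Aa (divr_gt0 (inv_natS_gt0 l) (ltr0Sn R 1)).
  exists j; apply/nbhs_ballP; exists (l.+1%:R^-1 / 2) => /=.
    by rewrite divr_gt0 ?inv_natS_gt0.
  by move=> z yz; rewrite [l.+1%:R^-1]splitr; exact: (ball_triangle jw yz).
exists ((fun z : borel X * borel Omega => u z.1 z.2) \_ D).
  exact: (measurable_restrictT _ mD).1 mu_D.
by move=> a w Aa; rewrite patchE mem_set.
Qed.

(** Dominated convergence speaks of sequences, so a failure of the limit is first turned into a
    sequence of actions [x k] that tends to a. *)
Lemma expected_utility_cvg (mu : probability (borel Omega) R) a : A a ->
  (fun x => \int[mu]_w u x w) x @[x --> within A (nbhs a)] --> \int[mu]_w u a w.
Proof.
move=> Aa; apply/cvgrPdist_lt => e e0; rewrite near_withinE.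
apply: contrapT => ne.
have /choice[x xP] : forall k : nat, exists x, [/\ A x, ball a (k.+1%:R^-1 : R) x &
    e <= `|\int[mu]_w u a w - \int[mu]_w u x w|].
  move=> k; apply: contrapT => nx; apply: ne; apply/nbhs_ballP.
  exists k.+1%:R^-1 => /=; first exact: inv_natS_gt0.
  move=> x ax Ax; rewrite ltNge; apply/negP => h; apply: nx.
  by exists x.
have Ax k : A (x k) by have [] := xP k.
have cux w : (fun k => u (x k) w) @ \oo --> u a w.
  apply/cvgrPdist_lt => d d0; have [r r0 h] := u_near w Aa d0.
  have [k kr] := inv_natS_lt r0.
  exists k => // l /= kl; apply: h => //; last exact: ballxx.
  have [_ + _] := xP l; apply: le_ball.
  by rewrite (le_trans _ (ltW kr))// lef_pV2 ?posrE// ler_nat ltnS.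
have [_ _ cv] : [/\ mu.-integrable setT (EFin \o u a),
    [sequence (\int[mu]_w `|(u (x n) w)%:E - (u a w)%:E|)%E]_n @ \oo --> 0%E &
    [sequence (\int[mu]_w (u (x n) w)%:E)%E]_n @ \oo --> (\int[mu]_w (u a w)%:E)%E].
  apply: (@dominated_convergence _ _ _ _ _ _ _ _ (cst K%:E)) => //.
  - by move=> n; apply/measurable_EFinP; exact: measurable_utility.
  - by apply/measurable_EFinP; exact: measurable_utility.
  - apply: aeW => w _; apply: cvg_EFin; last exact: cux.
    by apply: nearW.
  - exact: finite_measure_integrable_cst.
  - by apply: aeW => w n _ /=; rewrite lee_fin u_le.
have : (fun n => \int[mu]_w u (x n) w) @ \oo --> \int[mu]_w u a w.
  by apply: fine_cvg; rewrite /Rintegral fineK//; apply: integrable_fin_num => //;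
    apply: bounded_integrable (measurable_utility Aa) _ => w; exact: u_le.
move=> /cvgrPdist_lt/(_ e e0)[N _ /(_ N (leqnn N))].
by have [_ _ h] := xP N; rewrite /= ltNge h.
Qed.

(** With K added, utilities are nonnegative and the exchange of sums and integrals needs no
    integrability; [receiver_payoffE] takes K off again. *)
Definition shifted_value (mu : probability (borel Omega) R) : \bar R :=
  (value A u mu + K)%:E.

Definition shifted_full_value (mu : probability (borel Omega) R) : \bar R :=
  (full_info_value A u mu + K)%:E.

Lemma shifted_utilityE mu a : A a ->
  (\int[mu]_w (u a w + K)%:E = (\int[mu]_w u a w + K)%:E)%E.
Proof.
by move=> Aa; apply: integral_shift; [exact: measurable_utility|move=> w; exact: u_le].
Qed.

Let has_sup_value mu : has_sup [set \int[mu]_w u a w | a in A].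
Proof.
have [a Aa aP] := optimal_action mu; split.
  by exists (\int[mu]_w u a w), a.
by exists (\int[mu]_w u a w) => _ [b Ab <-]; exact: aP.
Qed.

Lemma value_ge mu a : A a -> \int[mu]_w u a w <= value A u mu.
Proof. by move=> Aa; apply: ub_le_sup; [exact: (has_sup_value mu).2|exists a]. Qed.

Lemma valueE mu a : A a -> (forall b, A b -> \int[mu]_w u b w <= \int[mu]_w u a w) ->
  value A u mu = \int[mu]_w u a w.
Proof.
move=> Aa h; apply/eqP; rewrite eq_le value_ge// andbT.
by apply: ge_sup; [exact: (has_sup_value mu).1|move=> _ [b Ab <-]; exact: h].
Qed.

Lemma shifted_value_ge mu a : A a ->
  (\int[mu]_w (u a w + K)%:E <= shifted_value mu)%E.
Proof. by move=> Aa; rewrite shifted_utilityE// lee_fin lerD2r value_ge. Qed.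

Lemma shifted_utility_ge0 a w : A a -> 0 <= u a w + K.
Proof. by move=> /(u_le w); rewrite ler_norml -lerBlDr sub0r => /andP[]. Qed.

Lemma shifted_value_ge0 mu : (0 <= shifted_value mu)%E.
Proof.
have [a Aa] := A0; apply: le_trans (shifted_value_ge mu Aa).
by apply: integral_ge0 => w _; rewrite lee_fin shifted_utility_ge0.
Qed.

Lemma shifted_full_valueE mu :
  shifted_full_value mu = (\int[mu]_w (best_utility w + K)%:E)%E.
Proof.
by rewrite (integral_shift mu measurable_best_utility best_utility_le).
Qed.

Lemma best_utility_shift_ge0 w : 0 <= best_utility w + K.
Proof.
by have := best_utility_le w; rewrite ler_norml -lerBlDr sub0r => /andP[].
Qed.

Lemma shifted_utility_le_full mu a : A a ->
  (\int[mu]_w (u a w + K)%:E <= shifted_full_value mu)%E.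
Proof.
move=> Aa; rewrite shifted_full_valueE; apply: ge0_le_integral => //.
- by move=> w _; rewrite lee_fin shifted_utility_ge0.
- by apply/measurable_EFinP/measurable_funD => //; exact: measurable_utility.
- by apply/measurable_EFinP/measurable_funD => //; exact: measurable_best_utility.
- by move=> w _; rewrite lee_fin lerD2r best_utility_ge.
Qed.

Lemma shifted_value_le_full mu :
  (shifted_value mu <= shifted_full_value mu)%E.
Proof.
have [a Aa aP] := optimal_action mu.
by rewrite /shifted_value (valueE Aa aP) -shifted_utilityE// shifted_utility_le_full.
Qed.

Lemma shifted_full_value_le mu : (shifted_full_value mu <= (2 * K)%:E)%E.
Proof.
rewrite shifted_full_valueE.
have -> : ((2 * K)%:E = \int[mu]_w (2 * K)%:E)%E.
  by rewrite integral_probability_cst.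
apply: ge0_le_integral => //.
- by move=> w _; rewrite lee_fin best_utility_shift_ge0.
- by apply/measurable_EFinP/measurable_funD => //; exact: measurable_best_utility.
- move=> w _; rewrite lee_fin; have := best_utility_le w; rewrite ler_norml.
  by move: (best_utility w) => b /andP[_]; lra.
Qed.

Section Parametric.
Context {d : measure_display} {T : measurableType d}.
Variable beta : T -> probability (borel Omega) R.
Hypothesis mbeta : forall B, measurable B -> measurable_fun setT (fun t => beta t B).

Lemma measurable_shifted_utility a : A a ->
  measurable_fun setT (fun t => \int[beta t]_w (u a w + K)%:E)%E.
Proof.
move=> Aa; apply: (@measurable_fun_integral_kernel _ _ _ _ _
  (fun t => beta t : {measure set _ -> \bar R})) => //.
- by move=> w; rewrite lee_fin shifted_utility_ge0.
- by apply/measurable_EFinP/measurable_funD => //; exact: measurable_utility.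
Qed.

Lemma measurable_expected_utility a : A a ->
  measurable_fun setT (fun t => \int[beta t]_w u a w).
Proof.
move=> Aa; rewrite (_ : (fun t => _) =
    (fun t => fine (\int[beta t]_w (u a w + K)%:E)%E - K)).
  apply: measurable_funB => //; apply: measurableT_comp => //.
  exact: measurable_shifted_utility.
by apply/funext => t; rewrite shifted_utilityE//= addrK.
Qed.

Lemma measurable_shifted_full_value :
  measurable_fun setT (fun t => shifted_full_value (beta t)).
Proof.
under eq_fun do rewrite shifted_full_valueE.
apply: (@measurable_fun_integral_kernel _ _ _ _ _
  (fun t => beta t : {measure set _ -> \bar R})) => //.
- by move=> w; rewrite lee_fin best_utility_shift_ge0.
- by apply/measurable_EFinP/measurable_funD => //; exact: measurable_best_utility.
Qed.

(** Expected utility is continuous in the action, so the supremum exceeds y as soon as some term of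
    a dense sequence in A does. *)
Lemma measurable_value : measurable_fun setT (fun t => value A u (beta t)).
Proof.
have [x [Ax dx]] := dense_sequence X_polish A0.
apply: (measurability _ (RGenOInfty.measurableE R)) => _ [_ [y ->] <-].
rewrite setTI.
rewrite (_ : _ @^-1` _ = \bigcup_n
    ((fun t => \int[beta t]_w u (x n) w) @^-1` `]y, +oo[)).
  apply: bigcup_measurable => n _; rewrite -[X in measurable X]setTI.
  exact: measurable_expected_utility.
apply/seteqP; split => t /=; last first.
  move=> [n _ /=]; rewrite !in_itv /= !andbT => /lt_le_trans; apply.
  exact: value_ge.
rewrite in_itv /= andbT; have [a Aa aP] := optimal_action (beta t).
rewrite (valueE Aa aP) => ya.
have ya0 : 0 < \int[beta t]_w u a w - y by rewrite subr_gt0.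
have /cvgrPdist_lt/(_ _ ya0) := @expected_utility_cvg (beta t) a Aa.
rewrite near_withinE => /nbhs_ballP[r /= r0 h].
have [n /ball_sym an] := dx a r Aa r0; exists n => //=.
rewrite in_itv /= andbT; have := h _ an (Ax n).
by rewrite ltr_norml => /andP[_]; rewrite ltrD2l ltrN2.
Qed.

Lemma measurable_shifted_value :
  measurable_fun setT (fun t => shifted_value (beta t)).
Proof.
by apply/measurable_EFinP/measurable_funD => //; exact: measurable_value.
Qed.

Lemma measurable_learning_value :
  measurable_fun setT (fun t => learning_value A u (beta t)).
Proof.
apply: measurable_funB; last exact: measurable_value.
rewrite (_ : (fun t => _) = (fun t => fine (shifted_full_value (beta t)) - K)).
  apply: measurable_funB => //; apply: measurableT_comp => //.
  exact: measurable_shifted_full_value.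
by apply/funext => t; rewrite /shifted_full_value /= addrK.
Qed.

End Parametric.

End Values.

Local Open Scope ereal_scope.

(** * Expected numbers of consultations and payoffs *)

Definition bayes_rule {R : realType} {Omega M : completePseudoMetricType R}
    (b : @belief_system R Omega M) : Prop :=
  forall (h : @history R Omega M) (e : @experiment R Omega M),
  (forall B : set (borel Omega), measurable B ->
     measurable_fun setT (fun m : borel M => b (rcons h (e, m)) B)) /\
  (forall (B : set (borel Omega)) (C : set (borel M)),
     measurable B -> measurable C ->
     \int[b h]_(w in B) e w C =
     \int[b h]_w \int[e w]_(m in C) b (rcons h (e, m)) B).

Section Expectations.
Context {R : realType} {Omega M X : completePseudoMetricType R}.
Variable b : @belief_system R Omega M.
Implicit Types (h : @history R Omega M) (e : @experiment R Omega M).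
Hypothesis b_bayes : bayes_rule b.

Lemma posterior_measurable h e (B : set (borel Omega)) : measurable B ->
  measurable_fun setT (fun m : borel M => b (rcons h (e, m)) B).
Proof. exact: (b_bayes h e).1. Qed.

(** The passage from [stage_value], defined state by state, to recursions on beliefs: the posterior
    after m takes over the conditioning on the state. *)
Lemma integral_posterior h e (f : borel Omega * borel M -> \bar R) :
  measurable_fun setT f -> (forall z, 0 <= f z) ->
  \int[b h]_w \int[e w]_m f (w, m) =
  \int[marginal (b h) e]_m \int[b (rcons h (e, m))]_w f (w, m).
Proof.
move=> mf f0; rewrite (bayes_swap (@posterior_measurable h e) (b_bayes h e).2)//.
rewrite integral_marginal//; last by move=> m; exact: integral_ge0.
apply: (@measurable_fun_integral_finite_kernel _ _ _ _ R
    (fun z => f (z.2, z.1)) (kernel_of (@posterior_measurable h e))) => //.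
apply: measurableT_comp => //; exact: measurable_fun_pair.
Qed.

Lemma measurable_posterior_integral h e (f : borel Omega * borel M -> \bar R) :
  measurable_fun setT f -> (forall z, 0 <= f z) ->
  measurable_fun setT
    (fun m : borel M => \int[b (rcons h (e, m))]_w f (w, m)).
Proof.
move=> mf f0; apply: (@measurable_fun_integral_finite_kernel _ _ _ _ R
    (fun z => f (z.2, z.1)) (kernel_of (@posterior_measurable h e))) => //.
apply: measurableT_comp => //; exact: measurable_fun_pair.
Qed.

Section Strategies.
Variables (sigma : @sender_strategy R Omega M) (rho : @receiver_strategy R Omega M X).

Definition expect (G : history -> experiment -> Omega -> \bar R) n h e :=
  \int[b h]_w stage_value sigma rho G n h e w.

Definition partial G N h e := \sum_(0 <= n < N) expect G n h e.

Section nonneg.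
Variable G : @history R Omega M -> @experiment R Omega M -> Omega -> \bar R.
Hypothesis G_ge0 : forall h e w, 0 <= G h e w.

Lemma expect_ge0 n h e : 0 <= expect G n h e.
Proof. by apply: integral_ge0 => w _; exact: stage_value_ge0. Qed.

Lemma partial_ge0 N h e : 0 <= partial G N h e.
Proof. by apply: sume_ge0 => n _; exact: expect_ge0. Qed.

Lemma partial_nd h e : nondecreasing_seq (partial G ^~ h ^~ e).
Proof.
by apply/ereal_nondecreasing_series => n _ _; exact: expect_ge0.
Qed.

Lemma partial_cvg h e : cvgn (partial G ^~ h ^~ e).
Proof. exact: ereal_nondecreasing_is_cvgn (@partial_nd h e). Qed.

Lemma expect_stop n h e a : rho h e = Some a -> expect G n.+1 h e = 0.
Proof.
by move=> ra; rewrite /expect /= ra integral0.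
Qed.

Lemma partial_stop N h e a : rho h e = Some a ->
  partial G N.+1 h e = expect G 0 h e.
Proof.
move=> ra; rewrite /partial big_nat_recl//= big1 ?adde0// => n _.
exact: expect_stop ra.
Qed.

Variables (h : @history R Omega M) (e : @experiment R Omega M).
Hypothesis rho_h : rho h e = None.
Hypothesis mp : measurable_play sigma rho h e.
Hypothesis mG : stage_measurable sigma rho G h e.

Let mstage n : measurable_fun [set: borel Omega * borel M] (fun z =>
  stage_value sigma rho G n (rcons h (e, z.2)) (sigma (rcons h (e, z.2))) z.1).
Proof.
exact: (measurable_stage1 rho_h (measurable_stage G_ge0 mp mG n)).
Qed.

Lemma measurable_expect n : measurable_fun setT
  (fun m : borel M => expect G n (rcons h (e, m)) (sigma (rcons h (e, m)))).
Proof.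
apply: (@measurable_posterior_integral h e (fun z =>
  stage_value sigma rho G n (rcons h (e, z.2)) (sigma (rcons h (e, z.2))) z.1)).
  exact: mstage.
by move=> z; exact: stage_value_ge0.
Qed.

Lemma measurable_partial N : measurable_fun setT
  (fun m : borel M => partial G N (rcons h (e, m)) (sigma (rcons h (e, m)))).
Proof.
by apply: emeasurable_sum => n; exact: measurable_expect.
Qed.

Lemma expectS n : expect G n.+1 h e = \int[marginal (b h) e]_m
  expect G n (rcons h (e, m)) (sigma (rcons h (e, m))).
Proof.
rewrite /expect /= rho_h; apply: (@integral_posterior h e (fun z =>
  stage_value sigma rho G n (rcons h (e, z.2)) (sigma (rcons h (e, z.2))) z.1)).
  exact: mstage.
by move=> z; exact: stage_value_ge0.
Qed.

Lemma partialS N : partial G N.+1 h e = expect G 0 h e +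
  \int[marginal (b h) e]_m partial G N (rcons h (e, m)) (sigma (rcons h (e, m))).
Proof.
rewrite /partial big_nat_recl//=; congr (_ + _).
rewrite ge0_integral_sum//.
- by apply: eq_bigr => n _; exact: expectS.
- by move=> n; exact: measurable_expect.
- by move=> n m _; exact: expect_ge0.
Qed.

End nonneg.
End Strategies.

Section Utility.
Variables (A : set X) (u : X -> Omega -> R) (K c : R).
Hypothesis dp : decision_problem A u K.
Hypothesis c_gt0 : (0 < c)%R.

Local Notation UK := (shifted_value A u K).
Local Notation FK := (shifted_full_value A u K).

(** The full-information value is linear in the belief, and the posteriors average to the current
    belief. *)
Lemma integral_full_value h e :
  \int[marginal (b h) e]_m FK (b (rcons h (e, m))) = FK (b h).
Proof.
have mf := measurable_best_utility dp.
under eq_integral do rewrite (shifted_full_valueE dp).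
rewrite -(@integral_posterior h e (fun z => (best_utility A u z.1 + K)%:E)).
- rewrite (shifted_full_valueE dp); apply: eq_integral => w _.
  by rewrite /= integral_pker_cst.
- by apply/measurable_EFinP/measurable_funD => //; exact: measurableT_comp.
- by move=> z; rewrite lee_fin (best_utility_shift_ge0 dp).
Qed.

Let mUK h e : measurable_fun setT (fun m : borel M => UK (b (rcons h (e, m)))).
Proof. exact: (measurable_shifted_value dp (@posterior_measurable h e)). Qed.

Let mFK h e : measurable_fun setT (fun m : borel M => FK (b (rcons h (e, m)))).
Proof. exact: (measurable_shifted_full_value dp (@posterior_measurable h e)). Qed.

Let FK_ge0 mu : 0 <= FK mu.
Proof. exact: le_trans (shifted_value_ge0 dp mu) (shifted_value_le_full dp mu). Qed.

Section Payoffs.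
Variables (sigma : @sender_strategy R Omega M) (rho : @receiver_strategy R Omega M X).
Hypothesis rho_feasible : feasible A rho.

Definition consult_stage h e (w : Omega) : \bar R :=
  if rho h e is None then 1 else 0.

Definition act_stage (g : X -> Omega -> R) h e w : \bar R :=
  if rho h e is Some a then (g a w)%:E else 0.

Definition net_stage := act_stage (fun a w => u a w + K)%R.
Definition stop_stage := act_stage (fun _ _ => 1%R).

Lemma consult_stage_ge0 h e w : 0 <= consult_stage h e w.
Proof. by rewrite /consult_stage; case: (rho h e). Qed.

Lemma net_stage_ge0 h e w : 0 <= net_stage h e w.
Proof.
rewrite /net_stage /act_stage; case er : (rho h e) => [a|//].
by rewrite lee_fin (shifted_utility_ge0 dp)//; exact: rho_feasible er.
Qed.

Lemma stop_stage_ge0 h e w : 0 <= stop_stage h e w.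
Proof. by rewrite /stop_stage /act_stage; case: (rho h e) => // a; rewrite lee_fin. Qed.

Lemma stage_measurable_consult h e : measurable_play sigma rho h e ->
  stage_measurable sigma rho consult_stage h e.
Proof. exact: stage_measurable_cst. Qed.

Lemma stage_measurable_net h e : measurable_play sigma rho h e ->
  stage_measurable sigma rho net_stage h e.
Proof.
apply: (stage_measurable_act rho_feasible).
have [g mg gE] := joint_utility dp.
exists (fun z => g z + K)%R; first exact: measurable_funD.
by move=> a w Aa; rewrite gE.
Qed.

Lemma stage_measurable_stop h e : measurable_play sigma rho h e ->
  stage_measurable sigma rho stop_stage h e.
Proof.
apply: (stage_measurable_act rho_feasible).
by exists (fun=> 1%R).
Qed.

Local Notation P := (partial sigma rho consult_stage).
Local Notation U := (partial sigma rho net_stage).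
Local Notation Q := (partial sigma rho stop_stage).

(** The probability of at least N consultations. The shift by one is there because [consult_stage]
    at stage n refers to consultation number n + 1. *)
Definition running N h e : \bar R :=
  if N is n.+1 then expect sigma rho consult_stage n h e else 1.

Lemma running_ge0 N h e : 0 <= running N h e.
Proof. by case: N => [|n] //=; apply: expect_ge0; exact: consult_stage_ge0. Qed.

Lemma running_stop N h e a : rho h e = Some a -> running N.+1 h e = 0.
Proof.
move=> ra; case: N => [|N] /=; last exact: expect_stop ra.
by rewrite /expect /= /consult_stage ra integral0.
Qed.

Lemma measurable_running N h e : rho h e = None -> measurable_play sigma rho h e ->
  measurable_fun setT (fun m : borel M =>
    running N (rcons h (e, m)) (sigma (rcons h (e, m)))).
Proof.
move=> rh mp; case: N => [|N] //=; apply: measurable_expect => //.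
  exact: consult_stage_ge0.
exact: stage_measurable_consult.
Qed.

Lemma runningS N h e : rho h e = None -> measurable_play sigma rho h e ->
  running N.+1 h e = \int[marginal (b h) e]_m
    running N (rcons h (e, m)) (sigma (rcons h (e, m))).
Proof.
move=> rh mp; case: N => [|N] /=.
  rewrite integral_probability_cst /expect /= /consult_stage rh.
  by rewrite integral_probability_cst.
apply: expectS => //; first exact: consult_stage_ge0.
exact: stage_measurable_consult.
Qed.

Lemma expect_consult0 h e : rho h e = None -> expect sigma rho consult_stage 0 h e = 1.
Proof.
by move=> rh; rewrite /expect /= /consult_stage rh integral_probability_cst.
Qed.

Lemma expect_consult_stop n h e a : rho h e = Some a ->
  expect sigma rho consult_stage n h e = 0.
Proof. by move=> ra; exact: (running_stop n ra). Qed.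

Lemma expect_act0 g h e : rho h e = None ->
  expect sigma rho (act_stage g) 0 h e = 0.
Proof. by move=> rh; rewrite /expect /= /act_stage rh integral0. Qed.

Lemma partial_consultS N h e : rho h e = None -> measurable_play sigma rho h e ->
  P N.+1 h e = 1 + \int[marginal (b h) e]_m
    P N (rcons h (e, m)) (sigma (rcons h (e, m))).
Proof.
move=> rh mp; rewrite partialS ?expect_consult0//; first exact: consult_stage_ge0.
exact: stage_measurable_consult.
Qed.

Lemma partial_netS N h e : rho h e = None -> measurable_play sigma rho h e ->
  U N.+1 h e = \int[marginal (b h) e]_m
    U N (rcons h (e, m)) (sigma (rcons h (e, m))).
Proof.
move=> rh mp; rewrite partialS ?expect_act0 ?add0e//; first exact: net_stage_ge0.
exact: stage_measurable_net.
Qed.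

Lemma partial_stopS N h e : rho h e = None -> measurable_play sigma rho h e ->
  Q N.+1 h e = \int[marginal (b h) e]_m
    Q N (rcons h (e, m)) (sigma (rcons h (e, m))).
Proof.
move=> rh mp; rewrite partialS ?expect_act0 ?add0e//; first exact: stop_stage_ge0.
exact: stage_measurable_stop.
Qed.

Lemma partial_consult_stop N h e a : rho h e = Some a -> P N h e = 0.
Proof.
by move=> ra; rewrite /partial big1// => n _; exact: expect_consult_stop ra.
Qed.

Lemma partial_net_stop N h e a : rho h e = Some a ->
  U N.+1 h e = \int[b h]_w (u a w + K)%:E.
Proof.
by move=> ra; rewrite (partial_stop _ _ _ ra) /expect /= /net_stage /act_stage ra.
Qed.

Lemma measurable_partial_consult N h e : rho h e = None ->
  measurable_play sigma rho h e -> measurable_fun setT (fun m : borel M =>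
    P N (rcons h (e, m)) (sigma (rcons h (e, m)))).
Proof.
move=> rh mp; apply: measurable_partial => //; first exact: consult_stage_ge0.
exact: stage_measurable_consult.
Qed.

Lemma measurable_partial_net N h e : rho h e = None ->
  measurable_play sigma rho h e -> measurable_fun setT (fun m : borel M =>
    U N (rcons h (e, m)) (sigma (rcons h (e, m)))).
Proof.
move=> rh mp; apply: measurable_partial => //; first exact: net_stage_ge0.
exact: stage_measurable_net.
Qed.

Lemma measurable_partial_stop N h e : rho h e = None ->
  measurable_play sigma rho h e -> measurable_fun setT (fun m : borel M =>
    Q N (rcons h (e, m)) (sigma (rcons h (e, m)))).
Proof.
move=> rh mp; apply: measurable_partial => //; first exact: stop_stage_ge0.
exact: stage_measurable_stop.
Qed.

Let P_ge0 N h e : 0 <= P N h e.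
Proof. by apply: partial_ge0; exact: consult_stage_ge0. Qed.

Let U_ge0 N h e : 0 <= U N h e.
Proof. by apply: partial_ge0; exact: net_stage_ge0. Qed.

Let Q_ge0 N h e : 0 <= Q N h e.
Proof. by apply: partial_ge0; exact: stop_stage_ge0. Qed.

Lemma partial_net_le_full N h e : measurable_play sigma rho h e ->
  U N h e <= FK (b h).
Proof.
elim: N h e => [|N IH] h e mp; first by rewrite /partial big_geq.
case rh : (rho h e) => [a|].
  rewrite (partial_net_stop _ rh) (shifted_utility_le_full dp)//.
  exact: rho_feasible rh.
rewrite partial_netS// -(integral_full_value h e).
apply: ge0_le_integral => //; first exact: measurable_partial_net.
by move=> m _; apply: IH; exact: measurable_play_cons.
Qed.

(** Conservation of mass: by round N play has either stopped or gone through N consultations. *)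
Lemma partial_stop_running N h e : measurable_play sigma rho h e ->
  Q N h e + running N h e = 1.
Proof.
elim: N h e => [|N IH] h e mp; first by rewrite /partial big_geq// add0e.
case rh : (rho h e) => [a|].
  rewrite (running_stop _ rh) adde0 (partial_stop _ _ _ rh).
  by rewrite /expect /= /stop_stage /act_stage rh integral_probability_cst.
rewrite partial_stopS// runningS// -ge0_integralD//; last 3 first.
- exact: measurable_partial_stop.
- by move=> m _; exact: running_ge0.
- exact: measurable_running.
rewrite -[RHS](integral_probability_cst (marginal (b h) e)).
by apply: eq_integral => m _; apply: IH; exact: measurable_play_cons.
Qed.

Lemma running_le1 N h e : measurable_play sigma rho h e -> running N h e <= 1.
Proof. by move=> mp; rewrite -(partial_stop_running N mp) leeDr. Qed.

Lemma partial_stop_le1 N h e : measurable_play sigma rho h e -> Q N h e <= 1.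
Proof. by move=> mp; rewrite -(partial_stop_running N mp) leeDl// running_ge0. Qed.

(* FK is a martingale along play, while each consultation raises the expected
   value of UK by at least c. *)
Lemma partial_consult_bound N h e :
  (forall h e, rho h e = None ->
    UK (b h) + c%:E <= \int[marginal (b h) e]_m UK (b (rcons h (e, m)))) ->
  measurable_play sigma rho h e -> c%:E * P N h e + UK (b h) <= FK (b h).
Proof.
move=> rule; elim: N h e => [|N IH] h e mp.
  by rewrite /partial big_geq// mule0 add0e (shifted_value_le_full dp).
case rh : (rho h e) => [a|].
  by rewrite (partial_consult_stop _ rh) mule0 add0e (shifted_value_le_full dp).
rewrite partial_consultS// ge0_muleDr//; last exact: integral_ge0.
rewrite mule1 addeAC [_ + UK _]addeC.
rewrite (le_trans (leeD2r _ (rule h e rh)))//.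
have mP := measurable_partial_consult N rh mp.
rewrite -ge0_integralZl//; last by rewrite lee_fin ltW.
rewrite -ge0_integralD//; last 3 first.
- by move=> m _; exact: shifted_value_ge0 dp _.
- by move=> m _; apply: mule_ge0 => //; rewrite lee_fin ltW.
- exact: measurable_funeM.
rewrite -[leRHS](integral_full_value h e); apply: ge0_le_integral => //.
- move=> m _; apply: adde_ge0; first exact: shifted_value_ge0 dp _.
  by apply: mule_ge0 => //; rewrite lee_fin ltW.
- by apply: emeasurable_funD => //; exact: measurable_funeM.
- by move=> m _; rewrite addeC; apply: IH; exact: measurable_play_cons.
Qed.

End Payoffs.
End Utility.
End Expectations.

Lemma ge0_bounded_integrable {R : realType} d (T : measurableType d)
    (mu : {measure set T -> \bar R}) (f : T -> \bar R) (r : R) :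
  mu setT = 1 -> measurable_fun setT f -> (forall t, 0 <= f t <= r%:E) ->
  mu.-integrable setT f.
Proof.
move=> mu1 mf fr; apply/integrableP; split => //.
apply: (@le_lt_trans _ _ (\int[mu]_t r%:E)).
  apply: ge0_le_integral => //; first exact: measurableT_comp.
  by move=> t _; have /andP[f0 f1] := fr t; rewrite gee0_abs.
by rewrite integral_cst// [X in _ * X]mu1 mule1 ltry.
Qed.

Lemma sender_payoff_ge0 {R : realType} {Omega M X : completePseudoMetricType R}
    (sigma : @sender_strategy R Omega M) (rho : @receiver_strategy R Omega M X)
    mu h e : 0 <= sender_payoff sigma rho mu h e.
Proof.
apply: nneseries_ge0 => n _ _; apply: integral_ge0 => w _.
by apply: stage_value_ge0; exact: consult_stage_ge0.
Qed.

(** * Verification inequalities and payoffs as limits of truncations *)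

Section Bounds.
Context {R : realType} {Omega M X : completePseudoMetricType R}.
Variable b : @belief_system R Omega M.
Implicit Types (h : @history R Omega M) (e : @experiment R Omega M).
Hypothesis b_bayes : bayes_rule b.
Variables (A : set X) (u : X -> Omega -> R) (K c : R).
Hypothesis dp : decision_problem A u K.
Hypothesis c_gt0 : (0 < c)%R.

Local Notation UK := (shifted_value A u K).
Local Notation FK := (shifted_full_value A u K).

Variables (sigma : @sender_strategy R Omega M) (rho : @receiver_strategy R Omega M X).
Hypothesis rho_feasible : feasible A rho.

Local Notation P := (partial b sigma rho (consult_stage rho)).
Local Notation U := (partial b sigma rho (net_stage u K rho)).
Local Notation Q := (partial b sigma rho (stop_stage rho)).
Local Notation run := (running b sigma rho).

Let mUK h e : measurable_fun setT (fun m : borel M => UK (b (rcons h (e, m)))).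
Proof. exact: (measurable_shifted_value dp (@posterior_measurable _ _ _ _ b_bayes h e)). Qed.

Let UK_ge0 mu : 0 <= UK mu. Proof. exact: shifted_value_ge0 dp mu. Qed.

Let P_ge0 N h e : 0 <= P N h e.
Proof. by apply: partial_ge0; exact: consult_stage_ge0. Qed.

Let U_ge0 N h e : 0 <= U N h e.
Proof. by apply: partial_ge0; exact: (net_stage_ge0 dp rho_feasible). Qed.

Let c_ge0 : 0 <= c%:E. Proof. by rewrite lee_fin ltW. Qed.

Let K_ge0 : 0 <= (2 * K)%:E.
Proof. by rewrite lee_fin mulr_ge0// (utility_bound_ge0 dp). Qed.

Section Value.
Variable V : @history R Omega M -> @experiment R Omega M -> \bar R.
Hypothesis V_sigma : forall h, V h (sigma h) = UK (b h).

(** Verification argument: V dominates both stopping and consulting once followed by the stopping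
    value. Since V is the stopping value again on the sender's own offers, the one-round inequality
    iterates along play for every receiver strategy. *)
Lemma partial_net_upper N h e :
  (forall h e, UK (b h) <= V h e) ->
  (forall h e, \int[marginal (b h) e]_m UK (b (rcons h (e, m))) <= V h e + c%:E) ->
  measurable_play sigma rho h e -> U N h e <= V h e + c%:E * P N h e.
Proof.
move=> VU VC; elim: N h e => [|N IH] h e mp.
  by rewrite /partial !big_geq// mule0 adde0 (le_trans (UK_ge0 _) (VU h e)).
case rh : (rho h e) => [a|].
  rewrite (partial_net_stop _ _ _ _ _ rh) (partial_consult_stop _ _ _ rh).
  rewrite mule0 adde0 (le_trans (shifted_value_ge dp _ (rho_feasible rh)))//.
rewrite (partial_netS b_bayes dp rho_feasible)// (partial_consultS b_bayes)//.
have mP := measurable_partial_consult b_bayes N rh mp.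
rewrite ge0_muleDr//; last exact: integral_ge0.
rewrite mule1 addeA -ge0_integralZl//.
apply: le_trans (leeD2r _ (VC h e)).
rewrite -ge0_integralD//; last 2 first.
- by move=> m _; exact: mule_ge0.
- exact: measurable_funeM.
apply: ge0_le_integral => //.
- exact: (measurable_partial_net b_bayes dp rho_feasible).
- by apply: emeasurable_funD => //; exact: measurable_funeM.
- move=> m _; rewrite -V_sigma; apply: IH; exact: measurable_play_cons.
Qed.

(** The converse for a receiver whose choices attain V. The last term accounts for plays still
    running after N rounds, which V credits with at most 2 K each; it vanishes in the limit when the
    expected number of consultations is finite. *)
Lemma partial_net_lower N h e :
  (forall h e, V h e <= (2 * K)%:E) ->
  (forall h e a, rho h e = Some a -> V h e <= \int[b h]_w (u a w + K)%:E) ->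
  (forall h e, rho h e = None ->
    V h e + c%:E <= \int[marginal (b h) e]_m UK (b (rcons h (e, m)))) ->
  measurable_play sigma rho h e ->
  V h e + c%:E * P N h e <= U N h e + (2 * K)%:E * run N h e.
Proof.
move=> VK VS VC; elim: N h e => [|N IH] h e mp.
  by rewrite /partial !big_geq// mule0 adde0 add0e /= mule1.
case rh : (rho h e) => [a|].
  rewrite (partial_net_stop _ _ _ _ _ rh) (partial_consult_stop _ _ _ rh).
  by rewrite (running_stop _ _ _ rh) !mule0 !adde0; exact: VS.
rewrite (partial_netS b_bayes dp rho_feasible)// (partial_consultS b_bayes)//.
rewrite (runningS b_bayes)//.
have mP := measurable_partial_consult b_bayes N rh mp.
have mU := measurable_partial_net b_bayes dp rho_feasible N rh mp.
have mr := measurable_running b_bayes N rh mp.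
rewrite ge0_muleDr//; last exact: integral_ge0.
rewrite mule1 addeA -ge0_integralZl//.
apply: le_trans (leeD2r _ (VC h e rh)) _.
rewrite -ge0_integralZl//; last by move=> m _; exact: running_ge0.
rewrite -ge0_integralD//; last 2 first.
- by move=> m _; exact: mule_ge0.
- exact: measurable_funeM.
rewrite -ge0_integralD//; last 2 first.
- by move=> m _; apply: mule_ge0 => //; exact: running_ge0.
- exact: measurable_funeM.
apply: ge0_le_integral => //.
- by move=> m _; apply: adde_ge0 => //; exact: mule_ge0.
- by apply: emeasurable_funD => //; exact: measurable_funeM.
- by apply: emeasurable_funD => //; exact: measurable_funeM.
- move=> m _; rewrite -V_sigma; apply: IH; exact: measurable_play_cons.
Qed.

End Value.

Section Limits.
Variables (h : @history R Omega M) (e : @experiment R Omega M).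
Hypothesis mp : measurable_play sigma rho h e.

Lemma sender_payoffE : sender_payoff sigma rho (b h) h e = limn (fun N => P N h e).
Proof. by []. Qed.

Lemma partial_consult_cvg : (fun N => P N h e) @ \oo --> sender_payoff sigma rho (b h) h e.
Proof.
by rewrite sender_payoffE; apply: partial_cvg; exact: consult_stage_ge0.
Qed.

Definition net_payoff := limn (fun N => U N h e).

Lemma partial_net_cvg : (fun N => U N h e) @ \oo --> net_payoff.
Proof. by apply: partial_cvg; exact: (net_stage_ge0 dp rho_feasible). Qed.

Lemma net_payoff_le_full : net_payoff <= FK (b h).
Proof.
apply: (cvge_to_le partial_net_cvg); apply: nearW => N.
exact: (partial_net_le_full b_bayes dp rho_feasible).
Qed.

Lemma net_payoff_ge0 : 0 <= net_payoff.
Proof. by apply: (cvge_to_ge partial_net_cvg); apply: nearW => N. Qed.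

Lemma net_payoff_fin : net_payoff \is a fin_num.
Proof.
rewrite ge0_fin_numE ?net_payoff_ge0//.
exact: le_lt_trans net_payoff_le_full (ltry _).
Qed.

(** Up to a shift, [running] is the general term of the series of consultations, whose sum is
    finite. *)
Lemma running_cvg0 : sender_payoff sigma rho (b h) h e < +oo ->
  (fun N => run N h e) @ \oo --> 0.
Proof.
move=> Slt.
have S_ge0 := sender_payoff_ge0 sigma rho (b h) h e.
have Sfin : sender_payoff sigma rho (b h) h e \is a fin_num.
  by rewrite ge0_fin_numE.
have Pfin N : P N h e \is a fin_num.
  rewrite ge0_fin_numE// (le_lt_trans _ Slt)// sender_payoffE.
  apply: nneseries_lim_ge => n _ _; apply: expect_ge0.
  exact: consult_stage_ge0.
rewrite -cvg_shiftS.
rewrite (_ : (fun n => _) = (fun n => P n.+1 h e - P n h e)); last first.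
  apply/funext => n; have -> : P n.+1 h e = P n h e + run n.+1 h e.
    by rewrite /partial big_nat_recr.
  by rewrite addeAC subee// add0e.
rewrite -(subee Sfin); apply: cvgeB.
- by rewrite fin_num_adde_defl// fin_numN.
- by rewrite (cvg_shiftS (fun N => P N h e)); exact: partial_consult_cvg.
- exact: partial_consult_cvg.
Qed.

Lemma partial_stop_cvg : (fun N => Q N h e) @ \oo --> limn (fun N => Q N h e).
Proof. by apply: partial_cvg; exact: stop_stage_ge0. Qed.

(** Finitely many expected consultations force the receiver to stop almost surely. *)
Lemma limn_partial_stop : sender_payoff sigma rho (b h) h e < +oo ->
  limn (fun N => Q N h e) = 1.
Proof.
move=> Slt; apply/cvg_lim => //.
rewrite (_ : (fun N => Q N h e) = (fun N => 1 - run N h e)).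
  rewrite -[X in _ --> X]sube0; apply: cvgeB => //; last exact: running_cvg0.
  exact: cvg_cst.
apply/funext => N; rewrite -(partial_stop_running b_bayes rho_feasible N mp) addeK//.
rewrite ge0_fin_numE ?running_ge0//.
exact: le_lt_trans (running_le1 b_bayes rho_feasible N mp) (ltry _).
Qed.

End Limits.

Let net_stage_le h e w : net_stage u K rho h e w <= (2 * K)%:E.
Proof.
rewrite /net_stage /act_stage; case rh : (rho h e) => [a|//].
rewrite lee_fin; have [_ _ _ /(_ a w (rho_feasible rh)) uK _] := dp.
by move: uK; rewrite ler_norml => /andP[_]; lra.
Qed.

Let stop_stage_le h e w : stop_stage rho h e w <= 1%:E.
Proof. by rewrite /stop_stage /act_stage; case: (rho h e). Qed.

Let stage_le G (r : R) : (0 <= r)%R -> (forall h e w, 0 <= G h e w) ->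
  (forall h e w, G h e w <= r%:E) ->
  forall n h e w, measurable_play sigma rho h e -> stage_measurable sigma rho G h e ->
  stage_value sigma rho G n h e w <= r%:E.
Proof.
move=> r0 G0 Gr; elim=> [|n IH] h e w mp mG //=.
case rh : (rho h e) => [a|]; first by rewrite lee_fin.
rewrite -[leRHS](integral_pker_cst e w); apply: ge0_le_integral => //.
- by move=> m _; exact: stage_value_ge0.
- have mS := measurable_stage1 rh (measurable_stage G0 mp mG n).
  exact: (measurableT_comp mS (@pair1_measurable _ _ (borel Omega) (borel M) w)).
- move=> m _; apply: IH; first exact: measurable_play_cons.
  exact: stage_measurable_cons.
Qed.

Let stage_integrable G (r : R) : (0 <= r)%R -> (forall h e w, 0 <= G h e w) ->
  (forall h e w, G h e w <= r%:E) ->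
  forall n h e w, rho h e = None ->
  measurable_play sigma rho h e -> stage_measurable sigma rho G h e ->
  (e w).-integrable setT (fun m : borel M =>
    stage_value sigma rho G n (rcons h (e, m)) (sigma (rcons h (e, m))) w).
Proof.
move=> r0 G0 Gr n h e w rh mp mG.
apply: (@ge0_bounded_integrable _ _ _ _ _ r); first exact: prob_kernel.
  have mS := measurable_stage1 rh (measurable_stage G0 mp mG n).
  exact: (measurableT_comp mS (@pair1_measurable _ _ (borel Omega) (borel M) w)).
move=> m; rewrite stage_value_ge0//=; apply: stage_le => //.
  exact: measurable_play_cons.
exact: stage_measurable_cons.
Qed.

Let K2_ge0 : (0 <= 2 * K)%R. Proof. by rewrite -lee_fin. Qed.

(* The utility is recovered from the nonnegative stage values by subtracting K
   at the stopping time. *)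
Lemma stage_value_act n h e w : measurable_play sigma rho h e ->
  stage_value sigma rho (act_stage rho u) n h e w =
  stage_value sigma rho (net_stage u K rho) n h e w -
  K%:E * stage_value sigma rho (stop_stage rho) n h e w.
Proof.
elim: n h e => [|n IH] h e mp /=.
  rewrite /net_stage /stop_stage /act_stage; case: (rho h e) => [a|].
    by rewrite mule1 -EFinB addrK.
  by rewrite mule0 sube0.
case rh : (rho h e) => [a|]; first by rewrite mule0 sube0.
under eq_integral => m _ do rewrite (IH _ _ (measurable_play_cons m rh mp)).
have inet := stage_integrable K2_ge0 (net_stage_ge0 dp rho_feasible)
  net_stage_le n w rh mp (stage_measurable_net dp rho_feasible mp).
have istop := stage_integrable ler01 (@stop_stage_ge0 _ _ _ _ rho)
  stop_stage_le n w rh mp (stage_measurable_stop rho_feasible mp).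
rewrite integralB//; last exact: integrableZl.
by rewrite integralZl.
Qed.

Lemma expect_act n h e : measurable_play sigma rho h e ->
  \int[b h]_w stage_value sigma rho (act_stage rho u) n h e w =
  expect b sigma rho (net_stage u K rho) n h e -
  K%:E * expect b sigma rho (stop_stage rho) n h e.
Proof.
move=> mp.
under eq_integral => w _ do rewrite (stage_value_act n w mp).
have I G r : (0 <= r)%R -> (forall h e w, 0 <= G h e w) ->
    (forall h e w, G h e w <= r%:E) -> stage_measurable sigma rho G h e ->
    (b h).-integrable setT (stage_value sigma rho G n h e).
  move=> r0 G0 Gr mG.
  apply: (@ge0_bounded_integrable _ _ _ _ _ r); first exact: probability_setT.
    exact: (measurable_stage0 (measurable_stage G0 mp mG n)).
  by move=> w; rewrite stage_value_ge0//=; exact: stage_le.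
have inet := I _ _ K2_ge0 (net_stage_ge0 dp rho_feasible) net_stage_le
  (stage_measurable_net dp rho_feasible mp).
have istop := I _ _ ler01 (@stop_stage_ge0 _ _ _ _ rho) stop_stage_le
  (stage_measurable_stop rho_feasible mp).
rewrite integralB//; last exact: integrableZl.
by rewrite integralZl.
Qed.

(** The extra K is collected only upon stopping, so it is removed in proportion to the probability
    of ever stopping, the limit of Q. *)
Lemma receiver_payoffE h e : measurable_play sigma rho h e ->
  receiver_payoff sigma rho u c (b h) h e =
  net_payoff h e - K%:E * limn (fun N => Q N h e)
  - c%:E * sender_payoff sigma rho (b h) h e.
Proof.
move=> mp; rewrite /receiver_payoff; congr (_ - _).
have Ufin N : U N h e \is a fin_num.
  rewrite ge0_fin_numE// (le_lt_trans _ (ltry (2 * K)))//.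
  apply: le_trans (shifted_full_value_le dp (b h)).
  exact: (partial_net_le_full b_bayes dp rho_feasible).
have Qfin N : Q N h e \is a fin_num.
  rewrite ge0_fin_numE; last by apply: partial_ge0; exact: stop_stage_ge0.
  exact: le_lt_trans (partial_stop_le1 b_bayes rho_feasible N mp) (ltry _).
have Efin n : expect b sigma rho (stop_stage rho) n h e \is a fin_num.
  rewrite ge0_fin_numE; last by apply: expect_ge0; exact: stop_stage_ge0.
  apply: le_lt_trans (_ : _ <= Q n.+1 h e) _; last first.
    by rewrite -ge0_fin_numE//; apply: partial_ge0; exact: stop_stage_ge0.
  rewrite /partial big_nat_recr//= leeDr//; apply: partial_ge0.
  exact: stop_stage_ge0.
apply/cvg_lim => //.
rewrite (_ : (fun n => _) = (fun N => U N h e - K%:E * Q N h e)); last first.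
  apply/funext => N; elim: N => [|N IH].
    by rewrite /partial !big_geq// mule0 sube0.
  have US : U N.+1 h e = U N h e + expect b sigma rho (net_stage u K rho) N h e.
    by rewrite /partial big_nat_recr.
  have QS : Q N.+1 h e = Q N h e + expect b sigma rho (stop_stage rho) N h e.
    by rewrite /partial big_nat_recr.
  rewrite big_nat_recr//= IH expect_act// US QS.
  move: (Efin N) (Qfin N).
  move: (expect _ _ _ (stop_stage rho) _ _ _) (Q N h e) => t q tfin qfin.
  rewrite (@muleDr _ K%:E q t)//; last exact: fin_num_adde_defl.
  rewrite fin_num_oppeD; last by rewrite fin_numM.
  by rewrite addeACA.
apply: cvgeB.
- by apply: fin_num_adde_defr; exact: net_payoff_fin.
- exact: partial_net_cvg.
- by apply: cvgeZl => //; exact: partial_stop_cvg.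
Qed.

Lemma receiver_payoff_fin h e : measurable_play sigma rho h e ->
  sender_payoff sigma rho (b h) h e < +oo ->
  receiver_payoff sigma rho u c (b h) h e =
  net_payoff h e - K%:E - c%:E * sender_payoff sigma rho (b h) h e.
Proof.
by move=> mp Slt; rewrite receiver_payoffE// limn_partial_stop// mule1.
Qed.

Lemma receiver_payoff_oo h e : measurable_play sigma rho h e ->
  sender_payoff sigma rho (b h) h e = +oo ->
  receiver_payoff sigma rho u c (b h) h e = -oo.
Proof.
move=> mp Soo; rewrite receiver_payoffE// Soo gt0_muley ?lte_fin//=.
have Qfin : limn (fun N => Q N h e) \is a fin_num.
  have Qle : limn (fun N => Q N h e) <= 1.
    apply: (cvge_to_le (@partial_stop_cvg h e)); apply: nearW => N.
    exact: (partial_stop_le1 b_bayes rho_feasible).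
  rewrite ge0_fin_numE; first exact: le_lt_trans Qle (ltry _).
  apply: (cvge_to_ge (@partial_stop_cvg h e)); apply: nearW => N.
  by apply: partial_ge0; exact: stop_stage_ge0.
by rewrite addeNy.
Qed.

End Bounds.

(** * All-or-nothing offers, short plays and deviations *)

Section AonKernel.
Context {R : realType} {Omega M : completePseudoMetricType R}.
Variables (iota : Omega -> M) (m0 : M) (l l' : {nonneg R}).
Hypothesis miota : measurable_fun [set: borel Omega] (iota : _ -> borel M).
Hypothesis ll' : (l%:num + l'%:num = 1)%R.

Definition aon_measure (mi : measurable_fun [set: borel Omega] (iota : _ -> borel M))
    (w : borel Omega) : {measure set (borel M) -> \bar R} :=
  measure_add (mscale l (dirac (iota w : borel M)))
              (mscale l' (dirac (m0 : borel M))).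

Lemma aon_measureE w C : aon_measure miota w C =
  l%:num%:E * dirac (iota w : borel M) C + l'%:num%:E * dirac (m0 : borel M) C.
Proof. by rewrite [LHS]measure_addE. Qed.

Let measurable_aon C : measurable C ->
  measurable_fun [set: borel Omega] (aon_measure miota ^~ C).
Proof.
move=> mC; under eq_fun do rewrite aon_measureE.
apply: emeasurable_funD => //; apply: measurable_funeM.
exact: (measurable_kernel (kdirac miota) _ mC).
Qed.

HB.instance Definition _ := isKernel.Build _ _ _ _ _ (aon_measure miota) measurable_aon.

Let aon1 w : aon_measure miota w [set: borel M] = 1.
Proof. by rewrite aon_measureE !diracT !mule1 -EFinD ll'. Qed.

HB.instance Definition _ := Kernel_isProbability.Build _ _ _ _ _
  (aon_measure miota) aon1.

Definition aon_kernel : @experiment R Omega M := aon_measure miota.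

End AonKernel.

Section Aon.
Context {R : realType} {Omega M : completePseudoMetricType R}.
Variables (iota : Omega -> M) (m0 : M).
Hypothesis miota : measurable_fun [set: borel Omega] (iota : _ -> borel M).

Lemma aon_ex (l : R) : ~ range iota m0 -> (0 <= l <= 1)%R ->
  exists e : @experiment R Omega M, all_or_nothing iota m0 l e.
Proof.
move=> nm0 l01; have /andP[l0 l1] := l01.
have l'0 : (0 <= 1 - l)%R by rewrite subr_ge0.
have ll' : ((NngNum l0)%:num + (NngNum l'0)%:num = 1)%R by rewrite /= addrC subrK.
exists (aon_kernel m0 miota ll'); split => // w C mC.
exact: aon_measureE.
Qed.

Lemma integral_aon (l : R) (e : @experiment R Omega M) w (g : M -> \bar R) :
  all_or_nothing iota m0 l e ->
  measurable_fun [set: borel M] g -> (forall m, 0 <= g m) ->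
  \int[e w]_m g m = l%:E * g (iota w) + (1 - l)%:E * g m0.
Proof.
move=> [/andP[l0 l1] nm0 eE] mg g0.
have l'0 : (0 <= 1 - l)%R by rewrite subr_ge0.
rewrite (eq_measure_integral (aon_measure m0 (NngNum l0) (NngNum l'0) miota w)).
  rewrite ge0_integral_measure_add// !ge0_integral_mscale//.
  by rewrite !integral_dirac// !diracT !mul1e.
by move=> C mC _; rewrite eE// aon_measureE.
Qed.

End Aon.

Section SimplePlay.
Context {R : realType} {Omega M X : completePseudoMetricType R}.
Variables (sigma : @sender_strategy R Omega M) (rho : @receiver_strategy R Omega M X).
Variables (h : @history R Omega M) (e : @experiment R Omega M).

Let measurable_unit (S : set (0.-tuple (borel M))) : measurable S.
Proof.
have [[x Sx]|S0] := pselect (S !=set0).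
  rewrite (_ : S = setT)//; apply/seteqP; split => // y _.
  by rewrite (tuple0 y) -(tuple0 x).
rewrite (_ : S = set0)//; apply/seteqP; split => // y Sy.
by case: S0; exists y.
Qed.

Lemma measurable_play_stop a : rho h e = Some a -> measurable_play sigma rho h e.
Proof.
move=> ra; have c0 n : @consulted _ _ _ _ sigma rho h e n = set0.
  apply/seteqP; split => // ms; case: n ms => [|n] ms [] /=.
    by rewrite (tuple0 ms) /response /= ra.
  by rewrite (tuple_eta ms) /= ra => -[].
move=> n; split.
- by rewrite c0.
- move=> D mD; case: n => [//|n].
  rewrite (_ : [set _ | _] = set0)//; apply/seteqP; split => // ms [].
  by rewrite (tuple_eta ms) /= ra => -[].
- by move=> C mC; rewrite c0 set0X; exact: measurable_fun_set0.
Qed.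

Lemma measurable_play_once (alpha : M -> X) : rho h e = None ->
  (forall m, rho (rcons h (e, m)) (sigma (rcons h (e, m))) = Some (alpha m)) ->
  measurable_fun [set: borel M] (alpha : _ -> borel X) ->
  measurable_play sigma rho h e.
Proof.
move=> rh rm malpha.
have cS n : @consulted _ _ _ _ sigma rho h e n.+1 = set0.
  apply/seteqP; split => // ms; case/tupleP: ms => m ms.
  rewrite /consulted /=; case: n ms => [|n] ms [] /=.
    by rewrite (tuple0 ms) /response /= rm.
  by case/tupleP: ms => m' ms /= [_ []]; rewrite rm.
move=> n; split.
- by case: n => [|n]; rewrite ?cS.
- move=> D mD; case: n => [//|[|n]].
    rewrite (_ : [set _ | _] = (fun ms => tnth ms ord0) @^-1` (alpha @^-1` D)).
      rewrite -[X in measurable X]setTI.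
      apply: (measurable_tnth ord0) => //.
      by rewrite -[X in measurable X]setTI; exact: malpha.
    apply/seteqP; split => ms; case/tupleP: ms => m ms; rewrite (tuple0 ms) /=.
      by move=> [_ [a Da]]; rewrite /response /= rm => -[am]; rewrite am.
    by move=> /= Da; split => //; exists (alpha m) => //; rewrite /response /= rm.
  rewrite (_ : [set _ | _] = set0)//; apply/seteqP; split => // ms [].
  case/tupleP: ms => m ms; case/tupleP: ms => m' ms /= [_ []].
  by rewrite rm.
- move=> C mC; case: n => [|n]; last by rewrite cS set0X; exact: measurable_fun_set0.
  apply: measurable_funTS.
  rewrite (_ : (fun z => _) = (fun w => e w C) \o snd).
    by apply: measurableT_comp => //; exact: measurable_kernel.
  by apply/funext => -[ms w] /=; rewrite (tuple0 ms).
Qed.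

End SimplePlay.

Section Congruence.
Context {R : realType} {Omega M X : completePseudoMetricType R}.
Variables (sigma sigma' : @sender_strategy R Omega M).
Variable rho : @receiver_strategy R Omega M X.
Implicit Types (h : @history R Omega M) (e : @experiment R Omega M).

Lemma stage_value_congr F n h e w :
  (forall h', (size h < size h')%N -> sigma h' = sigma' h') ->
  stage_value sigma rho F n h e w = stage_value sigma' rho F n h e w.
Proof.
elim: n h e => [//|n IH] h e hs /=; case: (rho h e) => //.
apply: eq_integral => m _; rewrite hs ?size_rcons// IH// => h' hh'.
by apply: hs; rewrite size_rcons in hh'; exact: ltnW.
Qed.

Lemma play_congr h e ms :
  (forall h', (size h < size h')%N -> sigma h' = sigma' h') ->
  play sigma h e ms = play sigma' h e ms.
Proof.
elim: ms h e => [//|m ms IH] h e hs /=; rewrite hs ?size_rcons// IH// => h' hh'.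
by apply: hs; rewrite size_rcons in hh'; exact: ltnW.
Qed.

(** From (h, e) on, the sender is asked only at histories longer than h, so a change of her strategy
    at h itself is invisible there. *)
Lemma reached_congr h e ms :
  (forall h', (size h < size h')%N -> sigma h' = sigma' h') ->
  reached sigma rho h e ms <-> reached sigma' rho h e ms.
Proof.
elim: ms h e => [//|m ms IH] h e hs /=; rewrite hs ?size_rcons//.
suff : forall e', reached sigma rho (rcons h (e, m)) e' ms <->
    reached sigma' rho (rcons h (e, m)) e' ms by move=> ->.
move=> e'; apply: IH => h' hh'.
by apply: hs; rewrite size_rcons in hh'; exact: ltnW.
Qed.

Lemma measurable_play_congr h e :
  (forall h', (size h < size h')%N -> sigma h' = sigma' h') ->
  measurable_play sigma rho h e -> measurable_play sigma' rho h e.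
Proof.
move=> hs mp n; have [m1 m2 m3] := mp n.
have eresp ms : response sigma rho h e ms = response sigma' rho h e ms.
  by rewrite /response (play_congr _ _ hs).
have ec : @consulted _ _ _ _ sigma rho h e n = @consulted _ _ _ _ sigma' rho h e n.
  by apply/seteqP; split => ms /=; rewrite /consulted /= (reached_congr _ _ hs) eresp.
split.
- by rewrite -ec.
- move=> D mD; have := m2 D mD; congr (measurable _).
  by apply/seteqP; split => ms /=; rewrite (reached_congr _ _ hs) eresp.
- move=> C mC; have := m3 C mC; rewrite ec; congr (measurable_fun _ _).
  by apply/funext => z; rewrite (play_congr _ _ hs).
Qed.

Lemma sender_payoff_congr (mu : probability (borel Omega) R) h e :
  (forall h', (size h < size h')%N -> sigma h' = sigma' h') ->
  sender_payoff sigma rho mu h e = sender_payoff sigma' rho mu h e.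
Proof.
move=> hs; rewrite /sender_payoff; apply: eq_eseriesr => n _.
by apply: eq_integral => w _; exact: stage_value_congr.
Qed.

End Congruence.

(** S k stands for the payoff after k null messages. These payoffs are assumed neither equal nor
    finite, so the equation S = 1 + (1 - l) S cannot be solved; unrolling the inequality n times,
    for all k at once, yields the partial geometric sum instead. *)
Lemma geometric_lower {R : realType} (S : nat -> \bar R) (l : R) : (0 < l <= 1)%R ->
  (forall k, 0 <= S k) -> (forall k, 1 + (1 - l)%:E * S k.+1 <= S k) ->
  (l^-1)%:E <= S 0%N.
Proof.
move=> /andP[l0 l1] S0 SS.
have l'0 : (0 <= 1 - l)%R by rewrite subr_ge0.
have claim n k : ((1 - (1 - l) ^+ n) / l)%:E <= S k.
  elim: n k => [|n IH] k; first by rewrite expr0 subrr mul0r.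
  apply: le_trans (SS k); apply: le_trans (leeD2l 1 (lee_wpmul2l _ (IH k.+1))).
    rewrite -EFinM -EFinD lee_fin exprS; set q := ((1 - l) ^+ n)%R.
    by rewrite -subr_ge0 le_eqVlt; apply/orP; left; apply/eqP; field; rewrite gt_eqF.
  by rewrite lee_fin.
apply/lee_addgt0Pr => e e0.
have cg : (fun n => ((1 - l) ^+ n)%R) @ \oo --> (0%R : R).
  apply: cvg_expr; rewrite ger0_norm//; move: l0; lra.
have le0 : (0 < e * l)%R by rewrite mulr_gt0.
have /cvgrPdist_lt/(_ _ le0)[n _ /(_ n (leqnn n))] := cg.
rewrite sub0r normrN /= => hn.
apply: le_trans (leeD2r e%:E (claim n 0%N)).
rewrite -EFinD lee_fin mulrBl mul1r -addrA lerDl addrC subr_ge0 ler_pdivrMr//.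
by rewrite ltW// (le_lt_trans (ler_norm _)).
Qed.

(** * Equilibrium payoffs *)

(** Bayes' rule pins the belief after a null message down on measurable sets only, so values have to
    be compared through these. *)
Lemma eq_learning_value {R : realType} {Omega X : completePseudoMetricType R}
    (A : set X) (u : X -> Omega -> R) (mu mu' : probability (borel Omega) R) :
  (forall B, measurable B -> mu B = mu' B) ->
  learning_value A u mu = learning_value A u mu'.
Proof.
move=> h; rewrite /learning_value /full_info_value /value.
have E (f : Omega -> R) : (\int[mu]_w f w = \int[mu']_w f w)%R.
  by congr fine; apply: eq_measure_integral => B mB _; exact: h.
congr (_ - sup _)%R; first exact: E.
by apply/seteqP; split => _ [a Aa <-]; exists a.
Qed.

Section Embedding.
Context {R : realType} {Omega M : completePseudoMetricType R}.
Variable iota : Omega -> M.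
Hypothesis iota_embedding : topological_embedding iota.

Lemma measurable_embedding : measurable_fun [set: borel Omega] (iota : _ -> borel M).
Proof.
apply: measurable_fun_borel => V oV; apply: sub_sigma_algebra.
have [_ oE] := iota_embedding.
by change (@open Omega (iota @^-1` V)); rewrite oE; exists V.
Qed.

Lemma embedding_left_inverse : polish Omega ->
  exists2 r : M -> Omega, measurable_fun [set: borel M] (r : _ -> borel Omega) &
    forall w, r (iota w) = w.
Proof.
move=> pO; have [_ oE] := iota_embedding.
apply: (@measurable_left_inverse R _ (borel M) Omega iota) => // V oV.
have : (@open Omega) V by [].
rewrite oE => -[W oW <-]; exists W => //; exact: sub_sigma_algebra.
Qed.

Lemma measurable_singleton (m : M) : polish M -> measurable ([set m] : set (borel M)).
Proof.
move=> [hM _]; rewrite -[[set m]]setCK; apply: measurableC.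
apply: sub_sigma_algebra; apply: closed_openC.
by apply: accessible_closed_set1; exact: hausdorff_accessible.
Qed.

End Embedding.

Section PartOne.
Context {R : realType} {Omega M X : completePseudoMetricType R}.
Variable b : @belief_system R Omega M.
Implicit Types (h : @history R Omega M) (e : @experiment R Omega M).
Hypothesis b_bayes : bayes_rule b.
Variables (A : set X) (u : X -> Omega -> R) (K c : R).
Hypothesis dp : decision_problem A u K.
Hypothesis c_gt0 : (0 < c)%R.

Local Notation UK := (shifted_value A u K).
Local Notation FK := (shifted_full_value A u K).

Section OneShot.
Variables (sigma : @sender_strategy R Omega M) (rho : @receiver_strategy R Omega M X).
Hypothesis rho_feasible : feasible A rho.
Variables (h : @history R Omega M) (e : @experiment R Omega M).

Lemma sender_payoff_stop a : rho h e = Some a ->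
  sender_payoff sigma rho (b h) h e = 0.
Proof.
move=> ra; rewrite sender_payoffE; apply/cvg_lim => //.
rewrite (_ : (fun N => _) = cst 0); first exact: cvg_cst.
by apply/funext => N; exact: (partial_consult_stop _ _ _ ra).
Qed.

Lemma net_payoff_stop a : rho h e = Some a ->
  net_payoff b u K sigma rho h e = \int[b h]_w (u a w + K)%:E.
Proof.
move=> ra; apply/cvg_lim => //; rewrite -cvg_shiftS.
rewrite (_ : (fun N => _) = cst (\int[b h]_w (u a w + K)%:E)); first exact: cvg_cst.
by apply/funext => N; exact: (partial_net_stop _ _ _ _ _ ra).
Qed.

Lemma receiver_payoff_stop a : rho h e = Some a ->
  receiver_payoff sigma rho u c (b h) h e = (\int[b h]_w u a w)%R%:E.
Proof.
move=> ra; have mp := measurable_play_stop sigma ra.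
rewrite (receiver_payoff_fin b_bayes c dp rho_feasible)//.
  rewrite (sender_payoff_stop ra) mule0 sube0 (net_payoff_stop ra).
  by rewrite (shifted_utilityE dp (b h) (rho_feasible ra)) -EFinB addrK.
by rewrite (sender_payoff_stop ra).
Qed.

Section Once.
Variable alpha : M -> X.
Hypotheses (rho_h : rho h e = None)
  (rho_next : forall m,
     rho (rcons h (e, m)) (sigma (rcons h (e, m))) = Some (alpha m))
  (malpha : measurable_fun [set: borel M] (alpha : _ -> borel X)).

Let mp : measurable_play sigma rho h e.
Proof. exact: measurable_play_once rho_h rho_next malpha. Qed.

Lemma sender_payoff_once : sender_payoff sigma rho (b h) h e = 1.
Proof.
rewrite sender_payoffE; apply/cvg_lim => //; rewrite -cvg_shiftS.
rewrite (_ : (fun N => _) = cst 1); first exact: cvg_cst.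
apply/funext => N; rewrite (partial_consultS b_bayes)//.
under eq_integral => m _ do rewrite (partial_consult_stop _ _ _ (rho_next m)).
by rewrite integral0 adde0.
Qed.

Let mutil : measurable_fun [set: borel Omega * borel M]
  (fun z => (u (alpha z.2) z.1 + K)%:E).
Proof.
have [g mg gE] := joint_utility dp; apply/measurable_EFinP/measurable_funD => //.
rewrite (_ : (fun z => _) = (fun z => g (alpha z.2, z.1))).
  apply: (measurableT_comp mg); apply: measurable_fun_pair => //.
  exact: (measurableT_comp malpha measurable_snd).
by apply/funext => z; rewrite gE//; exact: rho_feasible (rho_next z.2).
Qed.

Lemma net_payoff_once : net_payoff b u K sigma rho h e =
  \int[b h]_w \int[e w]_m (u (alpha m) w + K)%:E.
Proof.
(* After one consultation the action is taken at stage 1, so the partial sums are constant from N =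
   2 on. *)
apply/cvg_lim => //; rewrite -(cvg_shiftn 2) /=.
rewrite (_ : (fun N => _) = cst (\int[b h]_w \int[e w]_m (u (alpha m) w + K)%:E)).
  exact: cvg_cst.
apply/funext => N; rewrite addn2 (partial_netS b_bayes dp rho_feasible)//=.
under eq_integral => m _ do rewrite (partial_net_stop _ _ _ _ _ (rho_next m)).
rewrite -(@integral_posterior _ _ _ _ b_bayes h e
  (fun z => (u (alpha z.2) z.1 + K)%:E))//.
move=> z; rewrite lee_fin (shifted_utility_ge0 dp)//.
exact: rho_feasible (rho_next z.2).
Qed.

Lemma receiver_payoff_once : receiver_payoff sigma rho u c (b h) h e =
  \int[b h]_w \int[e w]_m (u (alpha m) w + K)%:E - K%:E - c%:E.
Proof.
rewrite (receiver_payoff_fin b_bayes c dp rho_feasible)//.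
  by rewrite sender_payoff_once mule1 net_payoff_once.
by rewrite sender_payoff_once ltry.
Qed.

End Once.

End OneShot.

Variables (iota : Omega -> M) (m0 : M).
Hypotheses (Omega_polish : polish Omega) (M_polish : polish M).
Hypothesis iota_embedding : topological_embedding iota.

(** In every state m0 is received with the same probability 1 - l > 0. As an atom of the message law
    it leaves Bayes' rule no almost sure freedom. *)
Lemma posterior_null h e (l : R) (B : set (borel Omega)) : (l < 1)%R ->
  all_or_nothing iota m0 l e -> measurable B -> b (rcons h (e, m0)) B = b h B.
Proof.
move=> l1 [/andP[l0 _] nm0 eE] mB.
have ms := measurable_singleton m0 M_polish.
have e_m0 w : e w [set m0] = (1 - l)%:E.
  rewrite eE// !diracE.
  rewrite (@memNset _ [set m0] (iota w)); last by move=> im0; apply: nm0; exists w.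
  by rewrite (@mem_set _ [set m0] m0)// mule0 add0e mule1.
have := (b_bayes h e).2 B [set m0] mB ms.
under eq_integral => w _ do rewrite e_m0.
rewrite integral_cst//.
under [RHS]eq_integral => w _.
  rewrite (eq_integral (cst (b (rcons h (e, m0)) B))); last first.
    by move=> m; rewrite inE => ->.
  rewrite integral_cst// e_m0.
  over.
rewrite integral_probability_cst.
have f1 : b h B \is a fin_num by exact: fin_num_measure.
have f2 : b (rcons h (e, m0)) B \is a fin_num by exact: fin_num_measure.
move=> EB; have {EB} : (1 - l)%:E * b h B = b (rcons h (e, m0)) B * (1 - l)%:E by [].
rewrite -(fineK f1) -(fineK f2) -!EFinM => -[E]; congr (_%:E).
have l'0 : (1 - l != 0)%R by rewrite subr_eq0 gt_eqF.
by apply: (mulfI l'0); rewrite E mulrC.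
Qed.

(** The branch where the state is revealed contributes a nonnegative payoff and is dropped; the
    first consultation contributes the 1. *)
Lemma sender_one_step (sigma : @sender_strategy R Omega M)
    (rho : @receiver_strategy R Omega M X) h e (l : R) : rho h e = None ->
  measurable_play sigma rho h e -> all_or_nothing iota m0 l e ->
  1 + (1 - l)%:E * sender_payoff sigma rho (b (rcons h (e, m0)))
        (rcons h (e, m0)) (sigma (rcons h (e, m0))) <=
  sender_payoff sigma rho (b h) h e.
Proof.
move=> rh mp aon; have [/andP[l0 l1] _ _] := aon.
have l'0 : (0 <= 1 - l)%R by rewrite subr_ge0.
set h0 := rcons h (e, m0).
pose P N h' e' := partial b sigma rho (consult_stage rho) N h' e'.
have P0 N h' e' : 0 <= P N h' e' by apply: partial_ge0; exact: consult_stage_ge0.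
have step N : 1 + (1 - l)%:E * P N h0 (sigma h0) <= P N.+1 h e.
  rewrite /P (partial_consultS b_bayes)// leeD2l//.
  have mP := measurable_partial_consult b_bayes N rh mp.
  rewrite integral_marginal//.
  rewrite -[leLHS](integral_probability_cst (b h)).
  have mQ : measurable_fun setT (fun w => \int[e w]_m
      P N (rcons h (e, m)) (sigma (rcons h (e, m)))).
    exact: (@measurable_fun_integral_kernel _ _ _ _ _ _ (measurable_kernel e)).
  apply: ge0_le_integral => //; first by move=> w _; apply: mule_ge0.
  move=> w _; rewrite (integral_aon (measurable_embedding iota_embedding) w aon)//.
  by rewrite leeDr// mule_ge0.
have c1 : (fun N => 1 + (1 - l)%:E * P N h0 (sigma h0)) @ \oo -->
    1 + (1 - l)%:E * sender_payoff sigma rho (b h0) h0 (sigma h0).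
  apply: cvgeD => //; first exact: cvg_cst.
  by apply: cvgeZl => //; exact: partial_consult_cvg.
apply: (cvge_to_le c1); apply: nearW => N; apply: le_trans (step N) _.
rewrite sender_payoffE; apply: nneseries_lim_ge => n _ _.
by apply: expect_ge0; exact: consult_stage_ge0.
Qed.

Lemma learning_valueE mu :
  (learning_value A u mu = full_info_value A u mu - value A u mu)%R.
Proof. by []. Qed.

(* Against a rejection, consulting once and stopping on the revealed state
   would be a profitable deviation. *)
Lemma receiver_accepts (sigma : @sender_strategy R Omega M)
    (rho : @receiver_strategy R Omega M X) h e (l : R) :
  feasible A rho ->
  (forall rho', feasible A rho' -> measurable_play sigma rho' h e ->
     receiver_payoff sigma rho' u c (b h) h e <=
     receiver_payoff sigma rho u c (b h) h e) ->
  all_or_nothing iota m0 l e -> (c < l * learning_value A u (b h))%R ->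
  rho h e = None.
Proof.
move=> fA opt aon cl; case rh : (rho h e) => [a|//]; exfalso.
have [/andP[l0 l1] nm0 _] := aon.
have l'0 : (0 <= 1 - l)%R by rewrite subr_ge0.
have [pX cA _ _ optimal] := dp.
have [r mr ri] := embedding_left_inverse iota_embedding Omega_polish.
have [T1 [s [mT1 T11 ms As sbest]]] := ae_argmax_selection pX cA
  (measurable_utility dp) (fun a w => @utility_cvg _ _ _ _ _ _ dp a w)
  (utility_best dp) (b h).
have [a0 Aa0 a0best] := optimal (b h).
pose alpha m := if `[< m = m0 >] then a0 else s (r m).
have Aalpha m : A (alpha m) by rewrite /alpha; case: ifP.
have alpha_iota w : alpha (iota w) = s w.
  by rewrite /alpha asboolF ?ri// => im0; apply: nm0; exists w.
have malpha : measurable_fun [set: borel M] (alpha : _ -> borel X).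
  apply: (@measurable_fun_piecewise _ _ (borel M) (borel X) [set m0]) => //.
    exact: measurable_singleton.
  exact: (measurableT_comp ms mr).
(* The deviation consults at (h, e) only and stops everywhere else, reading the message off the end
   of the history; m0 is the default for the empty history. *)
pose lastm (h' : @history R Omega M) : M := last m0 (map snd h').
pose rho' : @receiver_strategy R Omega M X := fun h' e' =>
  if `[< h' = h /\ e' = e >] then None else Some (alpha (lastm h')).
have r'h : rho' h e = None by rewrite /rho' asboolT.
have r'next m : rho' (rcons h (e, m)) (sigma (rcons h (e, m))) = Some (alpha m).
  rewrite /rho' asboolF.
    by rewrite /lastm map_rcons last_rcons.
  by move=> [/(congr1 size) + _]; rewrite size_rcons => /esym/n_Sn.
have fA' : feasible A rho'.
  by move=> h' e' a'; rewrite /rho'; case: ifP => // _ [<-].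
have := opt rho' fA' (measurable_play_once r'h r'next malpha).
rewrite (receiver_payoff_once fA' r'h r'next malpha) (receiver_payoff_stop _ fA rh).
have [g mg gE] := joint_utility dp.
have mu_m w : measurable_fun [set: borel M] (fun m => (u (alpha m) w + K)%:E).
  apply/measurable_EFinP/measurable_funD => //.
  rewrite (_ : (fun m => _) = (fun m => g (alpha m, w))).
    by apply: (measurableT_comp mg); exact: measurable_fun_pair.
  by apply/funext => m; rewrite gE.
have ms_w : measurable_fun [set: borel Omega] (fun w => (u (s w) w + K)%:E).
  apply/measurable_EFinP/measurable_funD => //.
  rewrite (_ : (fun w => _) = (fun w => g (s w, w))).
    by apply: (measurableT_comp mg); exact: measurable_fun_pair.
  by apply/funext => w; rewrite gE.
have m0_w : measurable_fun [set: borel Omega] (fun w => (u a0 w + K)%:E).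
  by apply/measurable_EFinP/measurable_funD => //; exact: (measurable_utility dp).
have sge0 w : 0 <= (u (s w) w + K)%:E by rewrite lee_fin (shifted_utility_ge0 dp).
have age0 w : 0 <= (u a0 w + K)%:E by rewrite lee_fin (shifted_utility_ge0 dp).
have sfull : \int[b h]_w (u (s w) w + K)%:E = FK (b h).
  rewrite (shifted_full_valueE dp); apply: ge0_ae_eq_integral => //.
  - apply/measurable_EFinP/measurable_funD => //; exact: (measurable_best_utility dp).
  - by move=> w _; rewrite lee_fin (best_utility_shift_ge0 dp).
  exists (~` T1); split; first exact: measurableC.
    by apply: etrans (probability_setC (b h) mT1) _; rewrite T11 subee.
  move=> w /= nw Tw; apply: nw => _.
  by rewrite (best_utilityE dp (As w) (sbest w Tw)).
under eq_integral => w _.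
  rewrite (integral_aon (measurable_embedding iota_embedding) w aon)//; last first.
    by move=> m; rewrite lee_fin (shifted_utility_ge0 dp).
  rewrite alpha_iota (_ : alpha m0 = a0); last by rewrite /alpha asboolT.
  over.
rewrite ge0_integralD//; last 4 first.
- by move=> w _; exact: mule_ge0.
- exact: measurable_funeM.
- by move=> w _; exact: mule_ge0.
- exact: measurable_funeM.
rewrite !ge0_integralZl// sfull (shifted_utilityE dp)//.
rewrite -(valueE dp Aa0 a0best) /shifted_full_value.
rewrite -!EFinM -!EFinD lee_fin => ineq.
have := value_ge dp (b h) (fA _ _ _ rh).
move: cl ineq; rewrite learning_valueE.
(* The deviation yields l F + (1 - l) V - c, which exceeds V by [cl], whereas the rejection yields
   I, at most V. *)
move: (full_info_value _ _ _) (value _ _ _) (\int[_]_w _)%R => F V I; nra.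
Qed.

End PartOne.

Lemma equilibrium_payoffs (R : realType) (Omega M X : completePseudoMetricType R)
    (Omega_polish : polish Omega) (M_polish : polish M)
    (iota : Omega -> M) (iota_embedding : topological_embedding iota)
    (m0 : M) (m0_new : ~ range iota m0)
    (A : set X) (u : X -> Omega -> R) (K c : R) (dp : decision_problem A u K)
    (mu0 : probability (borel Omega) R)
    (c_gt0 : (0 < c)%R) (c_lt : (c < learning_value A u mu0)%R)
    (sigma : @sender_strategy R Omega M) (rho : @receiver_strategy R Omega M X)
    (b : @belief_system R Omega M) :
  equilibrium A u c mu0 sigma rho b ->
  sender_payoff sigma rho mu0 [::] (sigma [::]) = (learning_value A u mu0 / c)%:E /\
  receiver_payoff sigma rho u c mu0 [::] (sigma [::]) = (value A u mu0)%:E.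
Proof.
move=> [fA mpl [b0 bayes] opS opR].
set v := learning_value A u mu0 in c_lt *.
have v_gt0 : (0 < v)%R by exact: lt_trans c_lt.
set S := sender_payoff sigma rho mu0 [::] (sigma [::]).
have miota := measurable_embedding iota_embedding.
have lower l : (c / v < l < 1)%R -> (l^-1)%:E <= S.
  move=> /andP[cl l1].
  have l0 : (0 < l)%R by apply: lt_trans cl; rewrite divr_gt0.
  have l01 : (0 <= l <= 1)%R by rewrite !ltW.
  have [e aon] := aon_ex miota m0_new l01.
  (* The histories in which e was offered k times and always returned the null message; the belief
     along them is the prior. *)
  pose fix hk k : @history R Omega M := if k is k'.+1 then rcons (hk k') (e, m0) else [::].
  have bk k B : measurable B -> b (hk k) B = mu0 B.
    move=> mB; elim: k => [|k IH] /=; first by rewrite b0.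
    by rewrite (posterior_null bayes M_polish (hk k) l1 aon).
  have vk k : learning_value A u (b (hk k)) = v.
    by apply: eq_learning_value => B; exact: bk.
  pose Sk k := sender_payoff sigma rho (b (hk k)) (hk k) (sigma (hk k)).
  have -> : S = Sk 0%N by rewrite /S /Sk /= b0.
  apply: geometric_lower; first by rewrite l0 ltW.
    by move=> k; exact: sender_payoff_ge0.
  move=> k.
  have acc : rho (hk k) e = None.
    apply: (receiver_accepts bayes dp Omega_polish M_polish iota_embedding fA _ aon).
      by move=> rho' fA' mp'; exact: opR.
    by rewrite vk -ltr_pdivrMr.
  apply: le_trans (sender_one_step bayes iota_embedding acc (mpl _ _) aon) _.
  (* A one-shot deviation: offer e after [hk k] and follow sigma at all other histories, so that
     payoffs and measurability from (hk k, e) on are those of sigma. *)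
  pose sigma' : @sender_strategy R Omega M :=
    fun h' => if `[< h' = hk k >] then e else sigma h'.
  have s'k : sigma' (hk k) = e by rewrite /sigma' asboolT.
  have ss' h' : (size (hk k) < size h')%N -> sigma h' = sigma' h'.
    by move=> kh'; rewrite /sigma' asboolF// => h'k; rewrite h'k ltnn in kh'.
  have := opS (hk k) sigma'; rewrite s'k => /(_ (measurable_play_congr ss' (mpl _ _))).
  by rewrite -(sender_payoff_congr _ _ _ ss').
have [_ _ _ _ optimal] := dp.
have [a0 Aa0 a0best] := optimal mu0.
pose rho' : @receiver_strategy R Omega M X := fun _ _ => Some a0.
have fA' : feasible A rho' by move=> h e a [<-].
have r'0 : rho' [::] (sigma [::]) = Some a0 by [].
have := opR [::] (sigma [::]) rho' fA' (measurable_play_stop sigma r'0).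
rewrite (receiver_payoff_stop bayes c dp sigma fA' r'0) b0.
rewrite -(valueE dp Aa0 a0best) => Vle.
have mp0 := mpl [::] (sigma [::]).
have S_ge0 : 0 <= S by exact: sender_payoff_ge0.
have SE : S = sender_payoff sigma rho (b [::]) [::] (sigma [::]) by rewrite b0.
(* With infinitely many expected consultations the receiver would get -oo, less than by stopping at
   once. *)
have S_lty : S < +oo.
  rewrite ltey; apply/negP => /eqP Soo; move: Vle; rewrite -b0.
  by rewrite (receiver_payoff_oo bayes dp c_gt0 fA mp0) -?SE.
have recE := receiver_payoff_fin bayes c dp fA mp0.
rewrite b0 in recE; have {recE} := recE S_lty => recE.
have netle := net_payoff_le_full bayes dp fA mp0.
have netfin := net_payoff_fin bayes dp fA mp0.
rewrite b0 in netle.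
move: Vle; rewrite recE -/S.
have Sfin : S \is a fin_num by rewrite ge0_fin_numE.
move: netle lower; rewrite -(fineK Sfin) -(fineK netfin) /shifted_full_value.
move: (fine (net_payoff _ _ _ _ _ _ _)) (fine S) => N s.
rewrite -EFinM -!EFinD !lee_fin => netle lower Vle.
have s_le : (s * c <= v)%R.
  move: netle Vle; rewrite /v learning_valueE mulrC.
  move: (full_info_value _ _ _) (value _ _ _) (c * s)%R => F V cs; lra.
have s_ge : (v / c <= s)%R.
  rewrite leNgt; apply/negP => sv.
  have vc1 : (1 < v / c)%R by rewrite ltr_pdivlMr// mul1r.
  (* If s were below v / c, some y would lie strictly between s and v / c. It must also exceed 1 for
     l = 1 / y to be a probability below 1; then [lower] at l gives y <= s, a contradiction. *)
  pose y := ((Num.max s 1%R + v / c) / 2)%R.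
  have my : (Num.max s 1%R < y < v / c)%R.
    have : (Num.max s 1%R < v / c)%R by rewrite gt_max sv vc1.
    by rewrite /y; move: (Num.max s 1%R) (v / c)%R => p q pq; apply/andP; lra.
  move: my; rewrite gt_max => /andP[/andP[sy y1] yv].
  have y0 : (0 < y)%R by exact: lt_trans y1.
  have : (s < s)%R.
    apply: (lt_le_trans sy); rewrite -lee_fin -[y in leLHS]invrK; apply: lower.
    rewrite invf_lt1// y1 andbT -[(c / v)%R]invf_div ltf_pV2// posrE.
    by rewrite divr_gt0.
  by rewrite ltxx.
have sE : (s = v / c)%R.
  by apply/eqP; rewrite eq_le s_ge andbT ler_pdivlMr.
split; first by rewrite sE.
congr (_%:E); have csv : (c * s = v)%R by rewrite sE mulrC divfK// gt_eqF.
move: netle Vle; rewrite csv /v learning_valueE => netle Vle.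
by apply/eqP; rewrite eq_le; apply/andP; split; move: netle Vle;
  move: (full_info_value _ _ _) (value _ _ _) => F V; lra.
Qed.

(** * An equilibrium *)

(* A state carries an optimal action besides the belief, since exactly optimal
   actions need not depend measurably on the belief. *)
Record belief_machine (R : realType) (Omega M X : completePseudoMetricType R)
    (iota : Omega -> M) (m0 : M) (A : set X) (u : X -> Omega -> R) (K c : R) :=
  BeliefMachine {
  bm_state : Type;
  bm_belief : bm_state -> probability (borel Omega) R;
  bm_action : bm_state -> X;
  bm_reveal : bm_state -> R;
  bm_offer : bm_state -> @experiment R Omega M;
  bm_step : bm_state -> @experiment R Omega M -> M -> bm_state;
  bm_known : M -> bm_state;
  bm_measurable_belief : forall p e (B : set (borel Omega)), measurable B ->
    measurable_fun [set: borel M] (fun m => bm_belief (bm_step p e m) B);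
  bm_measurable_action : forall p e,
    measurable_fun [set: borel M] (fun m => bm_action (bm_step p e m) : borel X);
  bm_bayes : forall (p : bm_state) (e : @experiment R Omega M) (B : set (borel Omega))
    (C : set (borel M)), measurable B -> measurable C ->
    \int[bm_belief p]_(w in B) e w C =
    \int[bm_belief p]_w \int[e w]_(m in C) bm_belief (bm_step p e m) B;
  bm_feasible : forall p, A (bm_action p);
  bm_optimal : forall p, (\int[bm_belief p]_w u (bm_action p) w =
    value A u (bm_belief p))%R;
  bm_revealE : forall p, bm_reveal p =
    if (c <= learning_value A u (bm_belief p))%R
    then (c / learning_value A u (bm_belief p))%R else 1%R;
  bm_offerP : forall p, all_or_nothing iota m0 (bm_reveal p) (bm_offer p);
  bm_step_null : forall p, bm_step p (bm_offer p) m0 = p;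
  bm_step_known : forall p m, m <> m0 -> bm_step p (bm_offer p) m = bm_known m;
  bm_known_value : forall m, learning_value A u (bm_belief (bm_known m)) = 0%R;
  bm_measurable_known :
    measurable_fun [set: borel M] (fun m => bm_action (bm_known m) : borel X);
  bm_gain : forall p,
    \int[marginal (bm_belief p) (bm_offer p)]_m
      shifted_value A u K (bm_belief (bm_step p (bm_offer p) m)) =
    (bm_reveal p)%:E * shifted_full_value A u K (bm_belief p) +
    (1 - bm_reveal p)%:E * shifted_value A u K (bm_belief p) }.

(** * Belief updating together with optimal actions *)

Section Construction.
Context {R : realType} {Omega M X : completePseudoMetricType R}.
Hypotheses (Omega_polish : polish Omega) (M_polish : polish M).
Variables (iota : Omega -> M) (m0 : M).
Hypothesis iota_embedding : topological_embedding iota.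
Hypothesis m0_new : ~ range iota m0.
Variables (A : set X) (u : X -> Omega -> R) (K c : R).
Hypothesis dp : decision_problem A u K.
Hypothesis c_gt0 : (0 < c)%R.

(* An exactly optimal measurable choice of actions exists only almost
   everywhere; beliefs will be kept concentrated on T0. *)
Variables (T0 : set (borel Omega)) (s0 : Omega -> X) (w0 : Omega).
Hypotheses (mT0 : measurable T0) (T0_w0 : T0 w0)
  (ms0 : measurable_fun [set: borel Omega] (s0 : _ -> borel X))
  (A_s0 : forall w, A (s0 w))
  (s0_best : forall w, T0 w -> forall a, A a -> (u a w <= u (s0 w) w)%R).
Variable r : M -> Omega.
Hypotheses (mr : measurable_fun [set: borel M] (r : _ -> borel Omega))
  (r_iota : forall w, r (iota w) = w).

Local Notation UK := (shifted_value A u K).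
Local Notation FK := (shifted_full_value A u K).

Definition point_mass (w : Omega) : probability (borel Omega) R :=
  dirac (w : borel Omega).

Definition good_state (p : probability (borel Omega) R * X) : Prop :=
  [/\ p.1 T0 = 1, A p.2 &
      forall a, A a -> (\int[p.1]_w u a w <= \int[p.1]_w u p.2 w)%R].

Definition state := {p | good_state p}.
Definition state_belief (p : state) := (sval p).1.
Definition state_action (p : state) := (sval p).2.

Lemma integral_dirac_utility w a : A a ->
  (\int[point_mass w]_w' u a w' = u a w)%R.
Proof.
move=> Aa; rewrite /Rintegral integral_dirac//; last first.
  by apply/measurable_EFinP; exact: (measurable_utility dp).
by rewrite diracT mul1e.
Qed.

(** Redirecting states outside T0 to w0 lets every message lead to an admissible state; beliefs give
    T0 probability 1, so only null events are affected. *)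
Definition to_T0 (w : Omega) : Omega := if `[< T0 w >] then w else w0.

Lemma to_T0P w : T0 (to_T0 w).
Proof. by rewrite /to_T0; case: asboolP. Qed.

Lemma to_T0_id w : T0 w -> to_T0 w = w.
Proof. by move=> Tw; rewrite /to_T0 asboolT. Qed.

Lemma measurable_to_T0 : measurable_fun [set: borel Omega] (to_T0 : _ -> borel Omega).
Proof.
by apply: measurable_fun_piecewise.
Qed.

Lemma good_dirac w : T0 w -> good_state (point_mass w, s0 w).
Proof.
move=> Tw; split => //=; first by rewrite /point_mass diracE mem_set.
by move=> a Aa; rewrite !integral_dirac_utility//; exact: s0_best.
Qed.

Definition known_state (w : Omega) : state :=
  exist _ (point_mass (to_T0 w), s0 (to_T0 w)) (good_dirac (to_T0P w)).

Definition step_ok (mu : probability (borel Omega) R) (e : @experiment R Omega M)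
    (f : M -> state) : Prop :=
  [/\ forall B : set (borel Omega), measurable B ->
        measurable_fun [set: borel M] (fun m => state_belief (f m) B),
      measurable_fun [set: borel M] (fun m => state_action (f m) : borel X) &
      forall (B : set (borel Omega)) (C : set (borel M)),
        measurable B -> measurable C ->
        \int[mu]_(w in B) e w C =
        \int[mu]_w \int[e w]_(m in C) state_belief (f m) B].

Lemma state_value (p : state) :
  value A u (state_belief p) = (\int[state_belief p]_w u (state_action p) w)%R.
Proof. by have [_ Aa h] := proj2_sig p; exact: (valueE dp Aa h). Qed.

(** For almost every message the disintegrated belief is concentrated on T0 and the measurable
    selection is optimal for it. The remaining messages are sent to [known_state w0]; having
    marginal probability 0, they do not disturb the Bayes identity. *)
Lemma bayes_step_ex (p : state) (e : @experiment R Omega M) :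
  exists f : M -> state, step_ok (state_belief p) e f.
Proof.
have [mT _ _] := proj2_sig p; rewrite /state_belief; set mu := (sval p).1 in mT *.
have [beta [mbeta bayes]] := @disintegration R Omega _ (borel M) mu e Omega_polish.
have [pX cA _ _ optimal] := dp.
have [T1 [s [mT1 T11 ms As sbest]]] :=
  @ae_argmax_selection R _ (borel M) X A (fun a m => \int[beta m]_w u a w)%R pX cA
    (fun a Aa => measurable_expected_utility dp mbeta Aa)
    (fun a m Aa => @expected_utility_cvg _ _ _ _ _ _ dp (beta m) a Aa)
    (fun m => let: ex_intro2 x y z := optimal (beta m) in ex_intro _ x (conj y z))
    (marginal mu e).
pose G0 := [set m : borel M | beta m (~` T0) = 0].
have mbC := mbeta (~` T0) (measurableC mT0).
have mG0 : measurable G0.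
  by have := mbC measurableT [set 0] (emeasurable_set1 _); rewrite setTI.
have mG : measurable (T1 `&` G0) by exact: measurableI.
have muC : mu (~` T0) = 0.
  by apply: etrans (probability_setC mu mT0) _; rewrite mT subee.
have G0ae : ae_eq (marginal mu e) setT (fun m => beta m (~` T0)) (cst 0).
  (* The posterior mass of the complement of T0 averages to its prior mass, which is 0. *)
  apply/ae_eq_integral_abs => //.
  under eq_integral => m _ do rewrite gee0_abs//.
  rewrite integral_marginal//.
  have := bayes (~` T0) setT (measurableC mT0) measurableT => <-.
  under eq_integral => w _ do rewrite prob_kernel.
  by rewrite integral_cst ?mul1e//; exact: measurableC.
have Gae : {ae marginal mu e, forall m, (T1 `&` G0) m}.
  have T1ae : {ae marginal mu e, forall m, T1 m}.
    exists (~` T1); split; first exact: measurableC.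
      by apply: etrans (probability_setC _ mT1) _; rewrite T11 subee.
    by [].
  by apply: filterS2 T1ae G0ae => m T1m /(_ I) bm.
have good m : (T1 `&` G0) m -> good_state (beta m, s m).
  move=> [T1m G0m]; split => /=; [|exact: As|exact: sbest].
  have := probability_setC (beta m) (measurableC mT0).
  by rewrite setCK G0m sube0.
pose f m : state := if pselect ((T1 `&` G0) m) is left Gm then exist _ _ (good m Gm)
  else known_state w0.
have fin m : (T1 `&` G0) m -> state_belief (f m) = beta m /\ state_action (f m) = s m.
  by move=> Gm; rewrite /f; case: pselect.
have fout m : ~ (T1 `&` G0) m -> f m = known_state w0.
  by move=> Gm; rewrite /f; case: pselect.
have mfB (B : set (borel Omega)) : measurable B ->
    measurable_fun [set: borel M] (fun m => state_belief (f m) B).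
  move=> mB; rewrite (_ : (fun m => _) = (fun m => if `[< (T1 `&` G0) m >]
      then beta m B else state_belief (known_state w0) B)).
    by apply: measurable_fun_piecewise => //; exact: mbeta.
  by apply/funext => m; case: asboolP => [/fin[-> _]//|/fout->].
exists f; split => //.
  rewrite (_ : (fun m => _) = (fun m => if `[< (T1 `&` G0) m >]
      then s m else state_action (known_state w0))).
    exact: measurable_fun_piecewise.
  by apply/funext => m; case: asboolP => [/fin[_ ->]//|/fout->].
move=> B C mB mC; rewrite bayes//.
have mres (g : borel M -> \bar R) : measurable_fun setT g ->
    measurable_fun setT (g \_ C).
  by move=> mg; apply/(measurable_restrictT _ _).1 => //; exact: measurable_funTS.
under eq_integral => w _ do rewrite integral_mkcond.
under [RHS]eq_integral => w _ do rewrite integral_mkcond.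
rewrite -(integral_marginal mu e (mres _ (mbeta B mB))); last first.
  by move=> m; rewrite patchE; case: ifP.
rewrite -(integral_marginal mu e (mres _ (mfB B mB))); last first.
  by move=> m; rewrite patchE; case: ifP.
apply: ge0_ae_eq_integral => //.
- exact: (mres _ (mbeta B mB)).
- exact: (mres _ (mfB B mB)).
- by move=> m _; rewrite patchE; case: ifP.
- by move=> m _; rewrite patchE; case: ifP.
by apply: filterS Gae => m Gm _; rewrite !patchE (fin _ Gm).1.
Qed.

(** When the learning value is below c the candidate receiver rejects every offer, and 1 is just an
    admissible probability. *)
Definition state_reveal (p : state) : R :=
  if (c <= learning_value A u (state_belief p))%R
  then (c / learning_value A u (state_belief p))%R else 1%R.

Lemma state_reveal_itv p : (0 <= state_reveal p <= 1)%R.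
Proof.
rewrite /state_reveal; case: ifPn => [cv|_]; last by rewrite ler01 lexx.
have v0 : (0 < learning_value A u (state_belief p))%R by exact: lt_le_trans cv.
by rewrite divr_ge0 ?(ltW c_gt0) ?(ltW v0)//= ler_pdivrMr// mul1r.
Qed.

Definition state_offer (p : state) : @experiment R Omega M :=
  sval (cid (aon_ex (measurable_embedding iota_embedding) m0_new (state_reveal_itv p))).

Lemma state_offerP p : all_or_nothing iota m0 (state_reveal p) (state_offer p).
Proof. by rewrite /state_offer; case: cid. Qed.

(** An explicit posterior in place of a disintegration: after m0 the state p itself returns, action
    included, so that the same offer is repeated and the receiver's choice stays the same. *)
Definition offer_step (p : state) (m : M) : state :=
  if `[< m = m0 >] then p else known_state (r m).

Lemma offer_step_ok p : step_ok (state_belief p) (state_offer p) (offer_step p).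
Proof.
have ms := measurable_singleton m0 M_polish.
have mtr : measurable_fun setT (fun m : borel M => to_T0 (r m) : borel Omega).
  exact: (measurableT_comp measurable_to_T0 mr).
have mB (B : set (borel Omega)) : measurable B -> measurable_fun [set: borel M]
    (fun m => state_belief (offer_step p m) B).
  move=> mB; rewrite (_ : (fun m => _) = (fun m => if `[< m = m0 >]
      then state_belief p B else point_mass (to_T0 (r m)) B)).
    apply: measurable_fun_piecewise => //.
    exact: (measurable_kernel (kdirac mtr) _ mB).
  by apply/funext => m; rewrite /offer_step; case: ifP.
split => //.
  rewrite (_ : (fun m => _) = (fun m => if `[< m = m0 >]
      then state_action p else s0 (to_T0 (r m)))).
    apply: measurable_fun_piecewise => //; exact: (measurableT_comp ms0 mtr).
  by apply/funext => m; rewrite /offer_step; case: ifP.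
move=> B C mB' mC; have aon := state_offerP p; have [_ _ eE] := aon.
set l := state_reveal p in aon eE; set mu := state_belief p.
have /andP[l0 l1] : (0 <= l <= 1)%R := state_reveal_itv p.
have l'0 : (0 <= 1 - l)%R by rewrite subr_ge0.
have miota := measurable_embedding iota_embedding.
have mres : measurable_fun setT ((fun m => state_belief (offer_step p m) B) \_ C).
  by apply/(measurable_restrictT _ _).1 => //; apply: measurable_funTS; exact: mB.
have g0 m : 0 <= ((fun m => state_belief (offer_step p m) B) \_ C) m.
  by rewrite patchE; case: ifP.
have [muT _ _] := proj2_sig p.
transitivity (\int[mu]_w (l%:E *
    ((fun m => state_belief (offer_step p m) B) \_ C) (iota w) +
    (1 - l)%:E * ((fun m => state_belief (offer_step p m) B) \_ C) m0)); last first.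
  apply: eq_integral => w _; rewrite [RHS]integral_mkcond.
  by rewrite (integral_aon miota w aon).
transitivity (\int[mu]_w (l%:E * (dirac (iota w : borel M) C * dirac w B) +
    (1 - l)%:E * (dirac (m0 : borel M) C * dirac w B))).
  rewrite integral_mkcond; apply: eq_integral => w _.
  rewrite patchE eE// !diracE; case: ifPn => wB.
    by rewrite !mule1.
  by rewrite !mule0 adde0.
have d0 (T : Type) (x : T) (S : set T) : 0 <= ((x \in S)%:R)%:E :> \bar R.
  by rewrite lee_fin ler0n.
have md : measurable_fun [set: borel Omega] (fun w => dirac w B : \bar R).
  exact: (measurable_kernel (kdirac (@measurable_id _ (borel Omega) setT)) _ mB').
have mdi : measurable_fun [set: borel Omega] (fun w => dirac (iota w : borel M) C : \bar R).
  exact: (measurable_kernel (kdirac miota) _ mC).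
rewrite ge0_integralD//; last 4 first.
- by move=> w _; rewrite !diracE; do 2 apply: mule_ge0 => //.
- by apply: measurable_funeM; exact: emeasurable_funM.
- by move=> w _; rewrite !diracE; do 2 apply: mule_ge0 => //.
- by apply: measurable_funeM; exact: emeasurable_funM.
rewrite ge0_integralD//; last 3 first.
- by move=> w _; exact: mule_ge0.
- by apply: measurable_funeM; exact: (measurableT_comp mres miota).
- by move=> w _; exact: mule_ge0.
congr (_ + _).
  apply: ge0_ae_eq_integral => //.
  - by apply: measurable_funeM; exact: emeasurable_funM.
  - by apply: measurable_funeM; exact: (measurableT_comp mres miota).
  - by move=> w _; rewrite !diracE; do 2 apply: mule_ge0 => //.
  - by move=> w _; exact: mule_ge0.
  exists (~` T0); split; first exact: measurableC.
    by apply: etrans (probability_setC mu mT0) _; rewrite muT subee.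
  move=> w /= nw Tw; apply: nw => _; congr (_ * _).
  rewrite patchE /offer_step asboolF; last by move=> im0; apply: m0_new; exists w.
  rewrite r_iota /known_state /state_belief /= to_T0_id// /point_mass !diracE.
  by case: ifP; rewrite ?mul1e ?mul0e.
rewrite integral_probability_cst ge0_integralZl//; last 2 first.
- exact: emeasurable_funM.
- by move=> w _; rewrite !diracE; apply: mule_ge0.
congr (_ * _); rewrite ge0_integralZl//.
rewrite patchE /offer_step asboolT// !diracE.
under eq_integral => w _ do rewrite diracE -indicE.
rewrite integral_indic// setIT; case: ifP; rewrite ?mul1e ?mul0e//.
Qed.

Lemma point_mass_value w : T0 w ->
  (value A u (point_mass w) = best_utility A u w)%R.
Proof.
move=> Tw; have [_ Aw sw] := good_dirac Tw.
rewrite (valueE dp Aw sw) integral_dirac_utility//.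
by rewrite (best_utilityE dp Aw (s0_best Tw)).
Qed.

Lemma point_mass_learning w : T0 w -> learning_value A u (point_mass w) = 0%R.
Proof.
move=> Tw; rewrite /learning_value point_mass_value//.
rewrite /full_info_value /Rintegral /point_mass integral_dirac//; last first.
  by apply/measurable_EFinP; exact: (measurable_best_utility dp).
by rewrite diracT mul1e /= subrr.
Qed.

Definition belief_step (p : state) (e : @experiment R Omega M) : M -> state :=
  if `[< e = state_offer p >] then offer_step p else sval (cid (bayes_step_ex p e)).

Lemma belief_step_offer p : belief_step p (state_offer p) = offer_step p.
Proof. by rewrite /belief_step asboolT. Qed.

Lemma belief_step_ok p e : step_ok (state_belief p) e (belief_step p e).
Proof.
rewrite /belief_step; case: asboolP => [->|_]; first exact: offer_step_ok.
by case: cid.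
Qed.

(** A revealed state almost surely lies in T0, where the value of the point mass is the best
    utility; its average is the full-information value. *)
Lemma offer_gain p :
  \int[marginal (state_belief p) (state_offer p)]_m
    UK (state_belief (offer_step p m)) =
  (state_reveal p)%:E * FK (state_belief p) +
  (1 - state_reveal p)%:E * UK (state_belief p).
Proof.
have [mB _ _] := offer_step_ok p.
have mU : measurable_fun setT (fun m : borel M => UK (state_belief (offer_step p m))).
  exact: (measurable_shifted_value dp mB).
have miota := measurable_embedding iota_embedding.
have aon := state_offerP p; have /andP[l0 l1] := state_reveal_itv p.
have l'0 : (0 <= 1 - state_reveal p)%R by rewrite subr_ge0.
have U0 mu := shifted_value_ge0 dp mu.
have mUi : measurable_fun setT (fun w : borel Omega =>
    UK (state_belief (offer_step p (iota w)))).
  exact: (measurableT_comp mU miota).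
rewrite integral_marginal//.
under eq_integral => w _ do rewrite (integral_aon miota w aon)//.
rewrite ge0_integralD//; last 3 first.
- by move=> w _; exact: mule_ge0.
- exact: measurable_funeM.
- by move=> w _; exact: mule_ge0.
rewrite integral_probability_cst ge0_integralZl// /offer_step asboolT//.
congr (_ * _ + _); rewrite (shifted_full_valueE dp).
have [muT _ _] := proj2_sig p.
apply: ge0_ae_eq_integral => //.
- apply/measurable_EFinP/measurable_funD => //; exact: (measurable_best_utility dp).
- by move=> w _; rewrite lee_fin (best_utility_shift_ge0 dp).
exists (~` T0); split; first exact: measurableC.
  by apply: etrans (probability_setC (state_belief p) mT0) _; rewrite muT subee.
move=> w /= nw Tw; apply: nw => _.
rewrite asboolF; last by move=> im0; apply: m0_new; exists w.
rewrite r_iota /known_state /state_belief /= to_T0_id//.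
by rewrite /shifted_value point_mass_value.
Qed.

Definition machine : @belief_machine R Omega M X iota m0 A u K c.
Proof.
refine (@BeliefMachine R Omega M X iota m0 A u K c state state_belief state_action
  state_reveal state_offer belief_step (fun m => known_state (r m))
  _ _ _ _ _ _ state_offerP _ _ _ _ _).
- by move=> p e; have [] := belief_step_ok p e.
- by move=> p e; have [] := belief_step_ok p e.
- by move=> p e; have [] := belief_step_ok p e.
- by move=> p; have [] := proj2_sig p.
- by move=> p; rewrite state_value.
- by [].
- by move=> p; rewrite belief_step_offer /offer_step asboolT.
- by move=> p m mm0; rewrite belief_step_offer /offer_step asboolF.
- by move=> m; apply: point_mass_learning; exact: to_T0P.
- exact: (measurableT_comp ms0 (measurableT_comp measurable_to_T0 mr)).
- by move=> p; rewrite belief_step_offer offer_gain.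
Defined.

End Construction.

Lemma belief_machine_ex (R : realType) (Omega M X : completePseudoMetricType R)
    (Omega_polish : polish Omega) (M_polish : polish M)
    (iota : Omega -> M) (m0 : M) (iota_embedding : topological_embedding iota)
    (m0_new : ~ range iota m0) (A : set X) (u : X -> Omega -> R) (K c : R)
    (dp : decision_problem A u K) (c_gt0 : (0 < c)%R)
    (mu0 : probability (borel Omega) R) :
  exists (bm : @belief_machine R Omega M X iota m0 A u K c) (p : bm_state bm),
    bm_belief p = mu0.
Proof.
have [pX cA _ _ optimal] := dp.
have [r mr r_iota] := embedding_left_inverse iota_embedding Omega_polish.
have [T0 [s0 [mT0 T01 ms0 As0 s0best]]] := ae_argmax_selection pX cA
  (measurable_utility dp) (fun a w => @utility_cvg _ _ _ _ _ _ dp a w)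
  (utility_best dp) mu0.
have [w0 Tw0] : T0 !=set0.
  apply/set0P/negP => /eqP T00; move: T01.
  by rewrite T00 measure0 => /eqP; rewrite eq_sym onee_eq0.
have [a Aa aP] := optimal mu0.
exists (machine Omega_polish M_polish iota_embedding m0_new dp c_gt0 mT0 Tw0
  ms0 As0 s0best mr r_iota).
by exists (exist _ (mu0, a) (And3 T01 Aa aP)).
Qed.

(** * The candidate strategies and their measurability *)

Section Candidate.
Context {R : realType} {Omega M X : completePseudoMetricType R}.
Context {iota : Omega -> M} {m0 : M} {A : set X} {u : X -> Omega -> R} {K c : R}.
Variable bm : @belief_machine R Omega M X iota m0 A u K c.
Variable p0 : bm_state bm.
Hypothesis M_polish : polish M.
Hypothesis iota_embedding : topological_embedding iota.
Hypothesis dp : decision_problem A u K.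
Hypothesis c_gt0 : (0 < c)%R.
Implicit Types (h : @history R Omega M) (e : @experiment R Omega M) (p : bm_state bm).

Local Notation UK := (shifted_value A u K).
Local Notation FK := (shifted_full_value A u K).
Local Notation lv p := (learning_value A u (bm_belief p)).

Definition current h : bm_state bm :=
  foldl (fun p em => bm_step p em.1 em.2) p0 h.

Definition current_belief h := bm_belief (current h).

Definition candidate_offer h := bm_offer (current h).

Definition continuation h e : \bar R :=
  \int[marginal (current_belief h) e]_m UK (current_belief (rcons h (e, m))).

(** A lookahead of one round: stopping now against paying c and stopping after the next message.
    Ties go to consulting, because the offers made at learning values of at least c produce an exact
    tie. *)
Definition candidate_choice h e : option X :=
  if UK (current_belief h) + c%:E <= continuation h e then None
  else Some (bm_action (current h)).

Lemma current_rcons h e m : current (rcons h (e, m)) = bm_step (current h) e m.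
Proof. by rewrite /current foldl_rcons. Qed.

Lemma current_bayes : bayes_rule current_belief.
Proof.
move=> h e; have bE m : current_belief (rcons h (e, m)) = bm_belief (bm_step (current h) e m).
  by rewrite /current_belief current_rcons.
split=> [B mB|B C mB mC].
  by rewrite (_ : (fun m => _) = fun m => bm_belief (bm_step (current h) e m) B);
    [exact: bm_measurable_belief|apply/funext => m; rewrite bE].
rewrite /current_belief (bm_bayes (current h) e mB mC).
by apply: eq_integral => w _; apply: eq_integral => m _; rewrite current_rcons.
Qed.

Lemma candidate_feasible : feasible A candidate_choice.
Proof.
move=> h e a; rewrite /candidate_choice; case: ifP => // _ [<-].
exact: bm_feasible.
Qed.

Lemma full_shift p : FK (bm_belief p) = UK (bm_belief p) + (lv p)%:E.
Proof.
rewrite /shifted_full_value /shifted_value learning_valueE -EFinD; congr _%:E.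
by ring.
Qed.

Lemma learning_value_ge0 p : (0 <= lv p)%R.
Proof.
have := shifted_value_le_full dp (bm_belief p).
by rewrite full_shift /shifted_value -EFinD lee_fin lerDl.
Qed.

Lemma continuation_le h e :
  continuation h e <= UK (current_belief h) + (lv (current h))%:E.
Proof.
rewrite -full_shift -(integral_full_value current_bayes dp h e).
have mb := (current_bayes h e).1.
apply: ge0_le_integral => //.
- by move=> m _; exact: shifted_value_ge0.
- exact: (measurable_shifted_value dp mb).
- exact: (measurable_shifted_full_value dp mb).
- by move=> m _; exact: shifted_value_le_full.
Qed.

Lemma candidate_stop h e : (lv (current h) < c)%R ->
  candidate_choice h e = Some (bm_action (current h)).
Proof.
move=> vc; rewrite /candidate_choice leNgt (le_lt_trans (continuation_le h e))//.
by rewrite /shifted_value -!EFinD lte_fin ltrD2l.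
Qed.

Lemma continuation_offer h : (c <= lv (current h))%R ->
  continuation h (candidate_offer h) = UK (current_belief h) + c%:E.
Proof.
move=> cv; have v0 : (0 < lv (current h))%R by exact: lt_le_trans cv.
transitivity (\int[marginal (bm_belief (current h)) (bm_offer (current h))]_m
    UK (bm_belief (bm_step (current h) (bm_offer (current h)) m))).
  by apply: eq_integral => m _; rewrite /current_belief current_rcons.
rewrite bm_gain full_shift bm_revealE cv /current_belief /shifted_value.
rewrite -!EFinD; congr _%:E.
by field; rewrite gt_eqF.
Qed.

Lemma continuation_offer_le h :
  continuation h (candidate_offer h) <= UK (current_belief h) + c%:E.
Proof.
have [cv|vc] := leP c (lv (current h)); first by rewrite continuation_offer.
apply: le_trans (continuation_le _ _) _.
by rewrite /shifted_value -!EFinD lee_fin lerD2l ltW.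
Qed.

Lemma candidate_choiceE h : candidate_choice h (candidate_offer h) =
  if (c <= lv (current h))%R then None else Some (bm_action (current h)).
Proof.
case: leP => [cv|]; last exact: candidate_stop.
by rewrite /candidate_choice continuation_offer// lexx.
Qed.

Lemma current_null h :
  current (rcons h (candidate_offer h, m0)) = current h.
Proof. by rewrite current_rcons bm_step_null. Qed.

Lemma current_known h m : m <> m0 ->
  current (rcons h (candidate_offer h, m)) = bm_known bm m.
Proof. by move=> mm0; rewrite current_rcons bm_step_known. Qed.

Lemma known_inactive m : (lv (bm_known bm m) < c)%R.
Proof. by rewrite bm_known_value. Qed.

Local Notation consulted_after h ms :=
  (reached candidate_offer candidate_choice h (candidate_offer h) ms /\
   response candidate_offer candidate_choice h (candidate_offer h) ms = None).

Lemma candidate_consulted h ms : consulted_after h ms <->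
  (c <= lv (current h))%R /\ all (pred1 m0) ms.
Proof.
elim: ms h => [|m ms IH] h.
  rewrite /response /= candidate_choiceE; by case: leP => _; split=> -[].
rewrite /response /= candidate_choiceE; set h' := rcons _ _.
have {IH} := IH h'; rewrite /response => IH.
split=> [[[rh re] rs]|[cv /andP[/eqP mm0 a0]]].
  have [cv' a0] := IH.1 (conj re rs).
  case: leP rh => // cv _; split => //; rewrite a0 andbT.
  apply/eqP; apply: contrapT => mm0; move: cv'.
  by rewrite /h' current_known// leNgt known_inactive.
rewrite cv; have [|//] := IH.2.
by rewrite /h' mm0 current_null.
Qed.

Lemma candidate_play h ms : all (pred1 m0) ms ->
  current (play candidate_offer h (candidate_offer h) ms).1 = current h /\
  (play candidate_offer h (candidate_offer h) ms).2 = bm_offer (current h).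
Proof.
elim: ms h => [//|m ms IH] h /= /andP[/eqP-> a0].
by have := IH (rcons h (candidate_offer h, m0)) a0; rewrite current_null; apply.
Qed.

(* The receiver, consulting at first, stops with an action in D exactly after
   these messages. *)
Fixpoint stopping (D : set X) (ms : seq M) : Prop :=
  if ms is m :: ms' then
    (m = m0 /\ stopping D ms') \/
    [/\ m <> m0, ms' = [::] & D (bm_action (bm_known bm m))]
  else False.

Lemma candidate_stopped h ms (D : set X) : (c <= lv (current h))%R ->
  (reached candidate_offer candidate_choice h (candidate_offer h) ms /\
   exists2 a, D a &
     response candidate_offer candidate_choice h (candidate_offer h) ms = Some a) <->
  stopping D ms.
Proof.
elim: ms h => [|m ms IH] h cv.
  by rewrite /response /= candidate_choiceE cv; split=> // -[_ []].
rewrite /response /= candidate_choiceE cv; set h' := rcons _ _.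
have [mm0|mm0] := pselect (m = m0).
  have := IH h'; rewrite /h' mm0 current_null /response => /(_ cv) {}IH.
  split=> [[[_ re] rs]|[[_]|[]//]].
    by left; split => //; apply/IH.
  by move=> /IH[].
have st' : candidate_choice h' (candidate_offer h') =
    Some (bm_action (bm_known bm m)).
  by rewrite candidate_choiceE /h' current_known// leNgt known_inactive.
split=> [[[_ re] [a Da rs]]|[[]//|[_ -> Da]]].
  right; case: ms re rs {IH} => [|m' ms] /=; last by rewrite st' => -[].
  by rewrite st' => _ -[->].
by split => //; exists (bm_action (bm_known bm m)).
Qed.

Lemma measurable_tuple_cons n (P : set (borel M)) (Q : set (n.-tuple (borel M))) :
  measurable P -> measurable Q ->
  measurable [set t : n.+1.-tuple (borel M) | P (thead t) /\ Q [tuple of behead t]].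
Proof.
move=> mP mQ; apply: measurableI.
  by rewrite -[X in measurable X]setTI; apply: (measurable_tnth ord0).
by rewrite -[X in measurable X]setTI; apply: measurable_behead.
Qed.

Lemma measurable_nil n : measurable [set t : n.-tuple (borel M) | tval t = [::]].
Proof.
rewrite (_ : [set _ | _] = [set _ | n = 0%N]); first exact: measurable_cst_set.
apply/seteqP; split => t /= E; first by rewrite -(size_tuple t) E.
by apply: size0nil; rewrite size_tuple.
Qed.

Lemma measurable_null n :
  measurable [set t : n.-tuple (borel M) | all (pred1 m0) t].
Proof.
elim: n => [|n IH].
  rewrite (_ : [set _ | _] = setT)//; apply/seteqP.
  by split => // t _; rewrite /= (tuple0 t).
have := measurable_tuple_cons (measurable_singleton m0 M_polish) IH.
congr (measurable _); apply/seteqP; split => t; case/tupleP: t => m t /=.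
  by rewrite theadE => -[-> ]; rewrite eqxx.
by move=> /andP[/eqP-> ?]; rewrite theadE.
Qed.

Lemma measurable_stopping n (D : set (borel X)) : measurable D ->
  measurable [set t : n.-tuple (borel M) | stopping D t].
Proof.
move=> mD; elim: n => [|n IH].
  rewrite (_ : [set _ | _] = set0)//; apply/seteqP.
  by split => // t; rewrite /= (tuple0 t).
have m1 := measurable_singleton m0 M_polish.
have mE := @measurable_nil n.
have mS : measurable [set m : borel M | m <> m0 /\ D (bm_action (bm_known bm m))].
  apply: measurableI; first exact: (measurableC m1).
  by rewrite -[X in measurable X]setTI; apply: (bm_measurable_known bm).
have := measurableU _ _ (measurable_tuple_cons m1 IH) (measurable_tuple_cons mS mE).
congr (measurable _); apply/seteqP; split => t; case/tupleP: t => m t /=.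
  rewrite theadE => -[[-> st]|[[mm0 Dm] t0]]; first by left.
  by right.
rewrite theadE => -[[-> st]|[mm0 t0 Dm]]; first by left.
by right.
Qed.

Lemma measurable_active h e :
  measurable [set m : borel M | (c <= lv (bm_step (current h) e m))%R].
Proof.
have := measurable_learning_value dp (bm_measurable_belief (current h) e).
move=> /(_ measurableT [set` `[c, +oo[] (measurable_itv _)); rewrite setTI.
by congr (measurable _); apply/seteqP; split => m /=; rewrite in_itv/= andbT.
Qed.


Lemma measurable_reveal h e :
  measurable_fun [set m : borel M | (c <= lv (bm_step (current h) e m))%R]
    (fun m => bm_reveal (bm_step (current h) e m)).
Proof.
set D := [set m | _].
(* The inverse is written as a real power, which is measurable; the two agree because learning
   values are nonnegative. *)
apply: (@eq_measurable_fun _ _ (borel M) R D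
  (fun m => c * (lv (bm_step (current h) e m) `^ -1))%R).
  by move=> m /set_mem /= cv; rewrite bm_revealE cv powR_inv1// learning_value_ge0.
apply: measurable_funTS; apply: measurable_funM => //.
apply: (measurableT_comp (measurable_powR _)).
exact: (measurable_learning_value dp (bm_measurable_belief (current h) e)).
Qed.

(** Only the first message, sent under the arbitrary offer e, moves the state in an uncontrolled
    way; afterwards consultations continue exactly along null messages, which keep it. The offers
    come from an arbitrary choice, but as kernels they are determined by the revelation probability,
    which is measurable in that first message. *)
Lemma candidate_measurable h e :
  measurable_play candidate_offer candidate_choice h e.
Proof.
case rh : (candidate_choice h e) => [a|]; first exact: measurable_play_stop rh.
have mact := measurable_active h e.
have cE n : @consulted _ _ _ _ candidate_offer candidate_choice h e n.+1 =
    [set t | (c <= lv (bm_step (current h) e (thead t)))%R /\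
      [set t : n.-tuple (borel M) | all (pred1 m0) t] [tuple of behead t]].
  apply/seteqP; split => t; case/tupleP: t => m t; rewrite /consulted /= theadE.
    move=> [[_ re] rs]; have := (candidate_consulted (rcons h (e, m)) t).1 (conj re rs).
    by rewrite current_rcons.
  rewrite -current_rcons => /candidate_consulted[re rs].
  by split.
move=> [|n]; split.
- rewrite (_ : @consulted _ _ _ _ candidate_offer candidate_choice h e 0 = setT)//.
  by apply/seteqP; split => // t _; rewrite (tuple0 t); split.
- move=> D mD; rewrite (_ : [set _ | _] = set0)//; apply/seteqP; split => // t.
  by rewrite (tuple0 t) /response /= rh => -[_ []].
- move=> C mC; apply: measurable_funTS.
  rewrite (_ : (fun z => _) = (fun w => e w C) \o snd).
    by apply: measurableT_comp => //; exact: measurable_kernel.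
  by apply/funext => -[ms w] /=; rewrite (tuple0 ms).
- by rewrite cE; exact: (measurable_tuple_cons mact (@measurable_null n)).
- move=> D mD.
  have mstop : measurable [set m : borel M | ~ (c <= lv (bm_step (current h) e m))%R /\
      D (bm_action (bm_step (current h) e m))].
    apply: measurableI; first exact: (measurableC mact).
    by rewrite -[X in measurable X]setTI; apply: (bm_measurable_action (current h) e).
  have mE := @measurable_nil n.
  have := measurableU _ _ (measurable_tuple_cons mact (@measurable_stopping n _ mD))
    (measurable_tuple_cons mstop mE).
  congr (measurable _).
  apply/seteqP; split => t; case/tupleP: t => m t /=; rewrite theadE.
    rewrite -current_rcons.
    move=> [[cv /(candidate_stopped _ _ cv)[re [a Da rs]]]|[[nc Da] t0]].
      by split => //; exists a.
    have -> : t = [tuple] :> seq _ by [].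
    split => //; exists (bm_action (current (rcons h (e, m)))) => //.
    by rewrite /response /= candidate_choiceE (negbTE (introN idP nc)).
  rewrite -current_rcons => -[[_ re] [a Da rs]].
  have [cv|vc] := leP c (lv (current (rcons h (e, m)))).
    by left; split => //; apply/(candidate_stopped _ _ cv); split => //; exists a.
  have st' := candidate_choiceE (rcons h (e, m)); rewrite leNgt vc /= in st'.
  right; move: re rs; rewrite /response /=.
  case: (tval t) => [|m' ms] /=; last by rewrite st' => -[].
  by rewrite st' => _ [aE]; split => //; rewrite aE; split => //; rewrite leNgt vc.
- move=> C mC.
  pose S : set (n.+1.-tuple (borel M)) :=
    @consulted _ _ _ _ candidate_offer candidate_choice h e n.+1.
  have SE : S = [set t | (c <= lv (bm_step (current h) e (thead t)))%R /\
      [set t : n.-tuple (borel M) | all (pred1 m0) t] [tuple of behead t]] := cE n.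
  have mS : measurable S by rewrite SE; exact: (measurable_tuple_cons mact (@measurable_null n)).
  pose l (z : n.+1.-tuple (borel M) * borel Omega) :=
    bm_reveal (bm_step (current h) e (thead z.1)).
  have ml : measurable_fun (S `*` [set: borel Omega]) l.
    have mthead : measurable_fun (S `*` [set: borel Omega])
        (fun z : n.+1.-tuple (borel M) * borel Omega => thead z.1 : borel M).
      apply: measurable_funTS; apply: measurableT_comp => //.
      exact: (measurable_tnth ord0).
    have sub : (fun z : n.+1.-tuple (borel M) * borel Omega => thead z.1 : borel M) @`
        (S `*` [set: borel Omega]) `<=`
        [set m : borel M | (c <= lv (bm_step (current h) e m))%R].
      move=> m [z]; rewrite SE => -[[cv _] _] <-; exact: cv.
    exact: (measurable_comp mact sub (@measurable_reveal h e) mthead).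
  have miota := measurable_embedding iota_embedding.
  apply: (eq_measurable_fun (fun z : n.+1.-tuple (borel M) * borel Omega =>
      (l z)%:E * dirac (iota z.2 : borel M) C +
      (1 - l z)%:E * dirac (m0 : borel M) C)).
    move=> [t w] /set_mem[St _]; have {St} : S t := St.
    rewrite SE /l /= => -[].
    case/tupleP: t => m t /=; rewrite theadE -current_rcons => cv a0.
    have [_ ->] := candidate_play (rcons h (e, m)) a0.
    by have [_ _ ->] := bm_offerP (current (rcons h (e, m))).
  apply: emeasurable_funD; apply: emeasurable_funM.
  - exact/measurable_EFinP.
  - apply: measurable_funTS; exact: (measurableT_comp
      (measurable_kernel (kdirac miota) _ mC) measurable_snd).
  - by apply/measurable_EFinP; apply: measurable_funB.
  - exact: measurable_cst.
Qed.

End Candidate.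

Lemma lee_cvg_to (R : realType) (f g : nat -> \bar R) (x y : \bar R) :
  f @ \oo --> x -> g @ \oo --> y -> (forall n, f n <= g n) -> x <= y.
Proof.
move=> fx gy fg; rewrite -(cvg_lim _ fx)// -(cvg_lim _ gy)//; apply: lee_lim.
- by apply/cvg_ex; exists x.
- by apply/cvg_ex; exists y.
- exact: nearW.
Qed.

(** * Verification of the equilibrium *)

Section CandidateEquilibrium.
Context {R : realType} {Omega M X : completePseudoMetricType R}.
Context {iota : Omega -> M} {m0 : M} {A : set X} {u : X -> Omega -> R} {K c : R}.
Variable bm : @belief_machine R Omega M X iota m0 A u K c.
Variable p0 : bm_state bm.
Hypothesis M_polish : polish M.
Hypothesis iota_embedding : topological_embedding iota.
Hypothesis dp : decision_problem A u K.
Hypothesis c_gt0 : (0 < c)%R.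
Implicit Types (h : @history R Omega M) (e : @experiment R Omega M) (p : bm_state bm).

Local Notation UK := (shifted_value A u K).
Local Notation FK := (shifted_full_value A u K).
Local Notation lv p := (learning_value A u (bm_belief p)).
Local Notation b := (current_belief p0).
Local Notation offer := (candidate_offer p0).
Local Notation choice := (candidate_choice p0).
Local Notation cont := (continuation p0).

Let bayes := current_bayes p0.
Let fA : feasible A choice.
Proof. exact: candidate_feasible. Qed.
Let mp h e : measurable_play offer choice h e.
Proof. exact: candidate_measurable. Qed.

Lemma choice_consult h e : choice h e = None -> UK (b h) + c%:E <= cont h e.
Proof. by rewrite /candidate_choice; case: ifP. Qed.

(** The argument rests on the receiver's acceptance rule and holds for every sender strategy, so it
    caps all deviations of the sender. *)
Lemma consultation_bound (sigma : @sender_strategy R Omega M) h e :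
  measurable_play sigma choice h e ->
  c%:E * sender_payoff sigma choice (b h) h e + UK (b h) <= FK (b h).
Proof.
move=> mps; have := @partial_consult_cvg _ _ _ _ b sigma choice h e.
move: (sender_payoff _ _ _ _ _) => S cvS.
have lim : (c%:E * partial b sigma choice (consult_stage choice) N h e + UK (b h)
    @[N --> \oo] --> c%:E * S + UK (b h))%classic.
  by apply: cvgeD; [exact: fin_num_adde_defl|exact: cvgeZl|exact: cvg_cst].
apply: (cvge_to_le lim); apply: nearW => N.
exact: (partial_consult_bound bayes dp c_gt0 N choice_consult mps).
Qed.

Lemma consultation_finite (sigma : @sender_strategy R Omega M) h e :
  measurable_play sigma choice h e ->
  sender_payoff sigma choice (b h) h e < +oo.
Proof.
move=> /consultation_bound; case: (sender_payoff _ _ _ _ _) => [s _||//].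
  by rewrite ltry.
by rewrite gt0_muley ?lte_fin.
Qed.

(** The guess for the receiver's value with e on offer, shifted by K: the better of stopping and of
    consulting once with the stopping value afterwards. It has the property required of V in the
    verification lemmas, being the stopping value on the candidate's offers. *)
Definition target h e := maxe (UK (b h)) (cont h e - c%:E).

Lemma continuation_fin h e : cont h e \is a fin_num.
Proof.
rewrite ge0_fin_numE; last first.
  by apply: integral_ge0 => m _; exact: shifted_value_ge0.
by apply: le_lt_trans (continuation_le p0 dp h e) _; rewrite -EFinD ltry.
Qed.

Lemma target_offer h : target h (offer h) = UK (b h).
Proof.
apply/max_idPl; rewrite leeBlDr//; exact: continuation_offer_le.
Qed.

Lemma receiver_lower h e :
  target h e - K%:E <= receiver_payoff offer choice u c (b h) h e.
Proof.
have Slt := consultation_finite (mp h e).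
rewrite (receiver_payoff_fin bayes c dp fA (mp h e) Slt).
have net_fin := net_payoff_fin bayes dp fA (mp h e).
set S := sender_payoff _ _ _ _ _ in Slt *.
have S0 : 0 <= S by exact: sender_payoff_ge0.
have Sfin : S \is a fin_num by rewrite ge0_fin_numE.
have Vfin : target h e \is a fin_num.
  by rewrite /target /maxe; case: ifP => // _; rewrite fin_numB continuation_fin.
have cS : (target h e + c%:E * partial b offer choice (consult_stage choice) N h e
    @[N --> \oo] --> target h e + c%:E * S)%classic.
  apply: cvgeD; [exact: fin_num_adde_defr|exact: cvg_cst|].
  by apply: cvgeZl => //; exact: partial_consult_cvg.
have cN : (partial b offer choice (net_stage u K choice) N h e +
    (2 * K)%:E * running b offer choice N h e
    @[N --> \oo] --> net_payoff b u K offer choice h e + (2 * K)%:E * 0)%classic.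
  apply: cvgeD; [by rewrite mule0 fin_num_adde_defl|exact: (partial_net_cvg dp fA)|].
  by apply: cvgeZl => //; exact: running_cvg0.
have : target h e + c%:E * S <= net_payoff b u K offer choice h e + (2 * K)%:E * 0.
  apply: (lee_cvg_to cS cN) => N.
  apply: (partial_net_lower bayes dp c_gt0 fA target_offer) => // {N} h' e'.
  - rewrite /target ge_max; apply/andP; split.
      exact: le_trans (shifted_value_le_full dp _) (shifted_full_value_le dp _).
    rewrite leeBlDr//; apply: le_trans (continuation_le p0 dp h' e') _.
    rewrite -full_shift; apply: le_trans (shifted_full_value_le dp _) _.
    by rewrite leeDl// lee_fin ltW.
  - move=> a ra; have Aa := fA ra; rewrite (shifted_utilityE dp)//.
    move: ra; rewrite /candidate_choice; case: ifPn => // + [<-].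
    rewrite -ltNge bm_optimal /target => lt.
    by rewrite ge_max lexx leeBlDr// ltW.
  - move=> /choice_consult cc; rewrite -leeBrDr// /target ge_max lexx andbT.
    by rewrite leeBrDr.
rewrite mule0 adde0 -(fineK net_fin) -(fineK Sfin) -(fineK Vfin).
by rewrite -!EFinM -!EFinD !lee_fin; lra.
Qed.

Lemma receiver_upper h e (rho : @receiver_strategy R Omega M X) :
  feasible A rho -> measurable_play offer rho h e ->
  receiver_payoff offer rho u c (b h) h e <= target h e - K%:E.
Proof.
move=> fr mr; have [Soo|Sfin'] := eqVneq (sender_payoff offer rho (b h) h e) +oo.
  by rewrite (receiver_payoff_oo bayes dp c_gt0 fr mr Soo) leNye.
have Slt : sender_payoff offer rho (b h) h e < +oo by rewrite ltey.
rewrite (receiver_payoff_fin bayes c dp fr mr Slt).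
have net_fin := net_payoff_fin bayes dp fr mr.
set S := sender_payoff _ _ _ _ _ in Slt *.
have S0 : 0 <= S by exact: sender_payoff_ge0.
have Sfin : S \is a fin_num by rewrite ge0_fin_numE.
have Vfin : target h e \is a fin_num.
  by rewrite /target /maxe; case: ifP => // _; rewrite fin_numB continuation_fin.
have cS : (target h e + c%:E * partial b offer rho (consult_stage rho) N h e
    @[N --> \oo] --> target h e + c%:E * S)%classic.
  apply: cvgeD; [exact: fin_num_adde_defr|exact: cvg_cst|].
  by apply: cvgeZl => //; exact: partial_consult_cvg.
have : net_payoff b u K offer rho h e <= target h e + c%:E * S.
  have cN : (partial b offer rho (net_stage u K rho) N h e
      @[N --> \oo] --> net_payoff b u K offer rho h e)%classic.
    exact: (partial_net_cvg dp fr).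
  apply: (lee_cvg_to cN cS) => N.
  apply: (partial_net_upper bayes dp c_gt0 fr target_offer) => // {N} h' e'.
  - by rewrite /target le_max lexx.
  - by rewrite -leeBlDr// /target le_max lexx orbT.
rewrite -(fineK net_fin) -(fineK Sfin) -(fineK Vfin).
by rewrite -!EFinM -!EFinD !lee_fin; lra.
Qed.

Lemma sender_upper h (sigma : @sender_strategy R Omega M) :
  measurable_play sigma choice h (sigma h) ->
  sender_payoff sigma choice (b h) h (sigma h) <=
  if (c <= lv (current p0 h))%R then (lv (current p0 h) / c)%:E else 0.
Proof.
move=> mps; case: (leP c (lv (current p0 h))) => [cv|vc]; last first.
  by rewrite (sender_payoff_stop b sigma (candidate_stop dp (sigma h) vc)).
have := consultation_bound mps; have := consultation_finite mps.
set S := sender_payoff _ _ _ _ _ => Slt.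
have S0 : 0 <= S by exact: sender_payoff_ge0.
have Sfin : S \is a fin_num by rewrite ge0_fin_numE.
rewrite full_shift -(fineK Sfin) /shifted_value -EFinM -!EFinD !lee_fin.
by rewrite addrC lerD2l ler_pdivlMr// mulrC.
Qed.

(** Along null messages the same accepted offer recurs, so the geometric bound applies with l equal
    to c divided by the learning value; l = 1 is allowed. *)
Lemma sender_lower h : (c <= lv (current p0 h))%R ->
  (lv (current p0 h) / c)%:E <= sender_payoff offer choice (b h) h (offer h).
Proof.
move=> cv; have v0 : (0 < lv (current p0 h))%R by exact: lt_le_trans cv.
pose fix hk k : @history R Omega M :=
  if k is k'.+1 then rcons (hk k') (offer (hk k'), m0) else h.
have ck k : current p0 (hk k) = current p0 h.
  by elim: k => [//|k IH] /=; rewrite current_null.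
set l := (c / lv (current p0 h))%R.
have -> : (lv (current p0 h) / c = l^-1)%R by rewrite /l invf_div.
apply: (geometric_lower (S := fun k =>
  sender_payoff offer choice (b (hk k)) (hk k) (offer (hk k)))).
- by rewrite /l divr_gt0//= ler_pdivrMr// mul1r.
- by move=> k; exact: sender_payoff_ge0.
move=> k; apply: (sender_one_step bayes iota_embedding _ (mp _ _)).
  by rewrite (candidate_choiceE p0 dp c_gt0) ck cv.
by have := bm_offerP (current p0 (hk k)); rewrite bm_revealE {1 2}ck cv.
Qed.

Lemma candidate_equilibrium :
  equilibrium A u c (bm_belief p0) offer choice b.
Proof.
split => //.
- move=> h sigma mps; apply: le_trans (sender_upper mps) _.
  case: ifPn => [cv|_]; first exact: sender_lower.
  exact: sender_payoff_ge0.
- move=> h e rho fr mr.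
  exact: le_trans (receiver_upper fr mr) (receiver_lower h e).
Qed.

Lemma candidate_path n : let h := constant_history offer m0 n in
  (c <= lv p0)%R ->
  [/\ all_or_nothing iota m0 (c / lv p0) (offer h), choice h (offer h) = None
    & forall w, let h' := rcons h (offer h, iota w) in choice h' (offer h') <> None].
Proof.
move=> h cv; have ch : current p0 h = p0.
  by rewrite /h; elim: n {h} => [//|n IH] /=; rewrite current_null.
have m0_new : ~ range iota m0 by have [] := bm_offerP p0.
split.
- by have := bm_offerP (current p0 h); rewrite bm_revealE {1 2}ch cv.
- by rewrite (candidate_choiceE p0 dp c_gt0) ch cv.
move=> w; rewrite /= (candidate_choiceE p0 dp c_gt0) (current_known p0 h); last first.
  by move=> im0; apply: m0_new; exists w.
by rewrite leNgt known_inactive.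
Qed.

End CandidateEquilibrium.

Local Close Scope ereal_scope.

Theorem theorem1 (R : realType) (Omega M X : completePseudoMetricType R)
    (Omega_polish : polish Omega) (M_polish : polish M) (X_polish : polish X)
    (iota : Omega -> M) (iota_embedding : topological_embedding iota)
    (M_larger : exists m : M, ~ range iota m)
    (A : set X) (A_closed : closed A)
    (u : X -> Omega -> R)
    (u_continuous : {within A `*` [set: Omega],
                      continuous (fun z : X * Omega => u z.1 z.2)})
    (u_bounded : exists K : R, forall a w, A a -> `|u a w| <= K)
    (optimal_action : forall mu : probability (borel Omega) R,
        attains_max A (fun a => \int[mu]_w u a w))
    (mu0 : probability (borel Omega) R)
    (c : R) (c_gt0 : 0 < c) (c_lt : c < learning_value A u mu0) :
  (forall (sigma : @sender_strategy R Omega M)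
          (rho : @receiver_strategy R Omega M X)
          (b : @belief_system R Omega M),
     equilibrium A u c mu0 sigma rho b ->
     sender_payoff sigma rho mu0 [::] (sigma [::])
       = (learning_value A u mu0 / c)%:E /\
     receiver_payoff sigma rho u c mu0 [::] (sigma [::])
       = (value A u mu0)%:E) /\
  (exists (sigma : @sender_strategy R Omega M)
          (rho : @receiver_strategy R Omega M X)
          (b : @belief_system R Omega M) (m : M),
     equilibrium A u c mu0 sigma rho b /\
     forall n : nat,
       let h := constant_history sigma m n in
       [/\ all_or_nothing iota m (c / learning_value A u mu0) (sigma h),
           rho h (sigma h) = None
         & forall w : Omega,
             let h' := rcons h (sigma h, iota w) in
             rho h' (sigma h') <> None]).
Proof.
have [K u_le] := u_bounded.
have [m0 m0_new] := M_larger.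
have dp : decision_problem A u K by split.
split.
  move=> sigma rho b eqb.
  exact: (equilibrium_payoffs Omega_polish M_polish iota_embedding m0_new dp
    c_gt0 c_lt eqb).
have [bm [p bp]] := belief_machine_ex Omega_polish M_polish iota_embedding m0_new
  dp c_gt0 mu0.
exists (candidate_offer p), (candidate_choice p), (current_belief p), m0.
rewrite -bp; split; first exact: (candidate_equilibrium p M_polish iota_embedding dp c_gt0).
have cv : (c <= learning_value A u (bm_belief p))%R by rewrite bp ltW.
by move=> n; exact: (candidate_path dp c_gt0 n cv).
Qed.
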